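(* Let $\mathcal{C}$ be a non-degenerate braided pivotal fusion category containing $\mathrm{Rep}(A,z)$ as a braided pivotal subcategory, where $A$ is a finite cyclic group and $z\in A$ satisfies $z^2=1$. Let $a$ be a generator of $A$. With the matrices $S_{1,a},S_{a,1},S_{a^{-1},1},S_{a^{-1},a},S_{a,a},P,Q$ defined in the context, one has $$S_{1,a}S_{a,1}=\frac{\dim(\mathcal{C}_1)}{\# A}\dim^R(\bar{\mathbf{1}})\,P \quad\text{and}\quad S_{a^{-1},1}S_{1,a}=S_{a^{-1},a}S_{a,a}=\frac{\dim(\mathcal{C}_1)}{\# A}\dim^R(\bar{\mathbf{1}})\,Q.$$ In particular, the matrices $S_{1,a^{\pm1}}$ and $S_{a^{\pm 1},1}$ are square matrices and $\#I_{1,n} = \#I_a$.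
   Context: $\Bbbk$ is an algebraically closed field of characteristic $0$; all categories are fusion categories over $\Bbbk$ (unit object $\mathbf 1$ simple). $c$ denotes the braiding and $a_X\colon X\to X^{**}$ the pivotal structure (an isomorphism of monoidal functors, not assumed spherical). The right quantum trace of $f\in\mathrm{End}(X)$ is the scalar $\mathrm{tr}^R_X(f)=\mathrm{ev}_{X^*}\circ((a_X\circ f)\otimes\mathrm{id}_{X^*})\circ\mathrm{coev}_X$, and the left quantum trace is $\mathrm{tr}^L_X(f)=\mathrm{ev}_X\circ(\mathrm{id}_{X^*}\otimes (f\circ a_X^{-1}))\circ\mathrm{coev}_{X^*}$; $\dim^{R}(X)=\mathrm{tr}^R_X(\mathrm{id}_X)$, $\dim^{L}(X)=\mathrm{tr}^L_X(\mathrm{id}_X)$, and $\dim(\mathcal D)=\sum_{X\in\mathrm{Irr}(\mathcal D)}\dim^L(X)\dim^R(X)$ for a full semisimple subcategory $\mathcal D$ closed under direct summands. The $S$-matrix is $S_{X,Y}=\mathrm{tr}^R_{X\otimes Y}(c_{Y,X}\circ c_{X,Y})$ for $X,Y$ simple. Twist: the twist $\theta$ associated with the pivotal structure is defined by $a=u\circ\theta$, where $u_X\colon X\to X^{**}$ is the Drinfeld morphism (composition of $\mathrm{coev}_{X^*}$, $c_{X,X^*}$ and $\mathrm{ev}_X$); it satisfies $\theta_{X\otimes Y}=(\theta_X\otimes\theta_Y)\circ c_{Y,X}\circ c_{X,Y}$. $\mathrm{Rep}(A,z)$ is the symmetric category of finite-dimensional representations of $A$ in which the simple objects $X_\alpha$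 ($\alpha\in\hat A$, the character group) have braiding $c_{X_\alpha,X_\beta}$ equal to the flip, multiplied by $-1$ if $\alpha(z)=\beta(z)=-1$; its pivotal structure is the one with trivial twist, so that $\dim^R(X_\alpha)=\alpha(z)$. Grading: $\mathcal{C}=\bigoplus_{h\in A}\mathcal{C}_h$, where $\mathcal{C}_h$ is the full subcategory of objects $X$ with $c_{X,X_\alpha}\circ c_{X_\alpha,X}=\alpha(h)\,\mathrm{id}_{X_\alpha\otimes X}$ for all $\alpha\in\hat A$. Non-degenerate means the symmetric center of $\mathcal{C}$ is trivial. Involution: since $\mathcal C$ is non-degenerate, for each simple $X$ there is a unique (up to isomorphism) simple $\bar X$ with $S_{X,Y^*}/\dim^R(X)=S_{\bar X,Y}/\dim^R(\bar X)$ for all simple $Y$; $X\mapsto\bar X$ is an involution on $\mathrm{Irr}(\mathcal C)$, which exchanges simple objects of degree $h$ and $h^{-1}$. Sets and matrices: $\hat A$ acts on isomorphism classes of simple objects by $X\mapsto X_\alpha\otimes X$, preserving degrees. $I_h$ is the set of isomorphism classes of simple objects of degree $h$; $I_{1,n}\subset I_1$ is the subset of elements with trivial stabilizer; the action on $I_{a^{\pm1}}$ has trivial stabilizers. $[I_{1,n}]$ and $[I_a]$ are chosen sets of representatives of $I_{1,n}$ and $I_a$ for the action of $\hat A$, and $[I_{a^{-1}}]=\{\bar X: X\in[I_a]\}$; if $\#A=2$, $[I_a]$ is moreover chosen stable under $X\mapsto\bar X$ (which is possible), so $[I_{a^{-1}}]=[I_a]$. Put $S_{1,a^{\pm1}}=(S_{X,Y})_{X\in[I_{1,n}],Y\in[I_{a^{\pm1}}]}$,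 $S_{a^{\pm1},1}={}^tS_{1,a^{\pm1}}$, $S_{a^{\pm1},a}=(S_{X,Y})_{X\in[I_{a^{\pm1}}],Y\in[I_a]}$, $P_{X,Y}=\sum_{\alpha\in\hat A}\alpha(z)\alpha(a^{-1})\,\delta_{\bar Y\simeq X_\alpha\otimes X}$ for $X,Y\in[I_{1,n}]$, and $Q_{W,Z}=\delta_{\bar W\simeq Z}$ for $W\in[I_{a^{-1}}]$, $Z\in[I_a]$. *)

(* Defs.v *)
From HB Require Import structures.
From mathcomp Require Import all_boot all_order all_fingroup all_algebra.
From mathcomp Require Import cyclic mxrepresentation.
From mathcomp Require Import boolp classical_sets.
From mathcomp.real_closed Require Import mxtens.

Set Implicit Arguments.
Unset Strict Implicit.
Unset Printing Implicit Defensive.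

Import GRing.Theory.
Local Open Scope ring_scope.

Declare Scope cat_scope.
Delimit Scope cat_scope with cat.
Local Open Scope cat_scope.

Reserved Notation "X ⊗ Y" (at level 40, left associativity).
Reserved Notation "f ⊠ g" (at level 40, left associativity).
Reserved Notation "g ∘ f" (at level 45, left associativity).

(* A category is given by its structure maps (the records *Data below); the
   axioms they satisfy are collected in separate predicates. Typing morphism
   spaces in [vectType k] makes them finite-dimensional over [k]. *)

Record catData (k : fieldType) := CatData {
  obj :> Type;
  mor : obj -> obj -> vectType k;
  idmor : forall X, mor X X;
  compm : forall X Y Z, mor Y Z -> mor X Y -> mor X Z }.

Arguments mor {k C} : rename.
Arguments idmor {k C} X : rename.
Arguments compm {k C X Y Z} g f : rename.
Notation "g ∘ f" := (compm g f) : cat_scope.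

(* [dual X] is the left dual, with ev_X : X^* ⊗ X -> 1 and
   coev_X : 1 -> X ⊗ X^*. *)
Record rigidData (k : fieldType) := RigidData {
  rigid_cat :> catData k;
  tens : rigid_cat -> rigid_cat -> rigid_cat;
  tensm : forall X X' Y Y' : rigid_cat,
    mor X X' -> mor Y Y' -> mor (tens X Y) (tens X' Y');
  unit_obj : rigid_cat;
  assoc : forall X Y Z, mor (tens (tens X Y) Z) (tens X (tens Y Z));
  associ : forall X Y Z, mor (tens X (tens Y Z)) (tens (tens X Y) Z);
  lunit : forall X, mor (tens unit_obj X) X;
  luniti : forall X, mor X (tens unit_obj X);
  runit : forall X, mor (tens X unit_obj) X;
  runiti : forall X, mor X (tens X unit_obj);
  dual : rigid_cat -> rigid_cat;
  ev : forall X, mor (tens (dual X) X) unit_obj;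
  coev : forall X, mor unit_obj (tens X (dual X)) }.

Arguments tens {k C} X Y : rename.
Arguments tensm {k C X X' Y Y'} f g : rename.
Arguments unit_obj {k C} : rename.
Arguments assoc {k C} X Y Z : rename.
Arguments associ {k C} X Y Z : rename.
Arguments lunit {k C} X : rename.
Arguments luniti {k C} X : rename.
Arguments runit {k C} X : rename.
Arguments runiti {k C} X : rename.
Arguments dual {k C} X : rename.
Arguments ev {k C} X : rename.
Arguments coev {k C} X : rename.
Notation "X ⊗ Y" := (tens X Y) : cat_scope.
Notation "f ⊠ g" := (tensm f g) : cat_scope.

Record braidedData (k : fieldType) := BraidedData {
  braided_rigid :> rigidData k;
  braid : forall X Y : braided_rigid, mor (X ⊗ Y) (Y ⊗ X) }.

Arguments braid {k C} X Y : rename.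

Record pivotalData (k : fieldType) := PivotalData {
  pivotal_braided :> braidedData k;
  piv : forall X : pivotal_braided, mor X (dual (dual X)) }.

Arguments piv {k C} X : rename.

Section Linear.
Variables (k : fieldType) (C : catData k).
Implicit Types X Y Z : C.

Definition inverse_of X Y (f : mor X Y) (g : mor Y X) : Prop :=
  g ∘ f = idmor X /\ f ∘ g = idmor Y.

Definition is_iso X Y (f : mor X Y) : Prop := exists g, inverse_of f g.

(* The inverse of [f] when [f] is an isomorphism, and 0 otherwise. *)
Definition inv_hom X Y (f : mor X Y) : mor Y X := xget 0 (inverse_of f).

Definition isomorphic X Y : Prop := exists f : mor X Y, is_iso f.

Definition is_zero X : Prop := idmor X = 0.

Definition is_mono X Y (f : mor X Y) : Prop :=
  forall W (g h : mor W X), f ∘ g = f ∘ h -> g = h.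

Definition is_epi X Y (f : mor X Y) : Prop :=
  forall W (g h : mor Y W), g ∘ f = h ∘ f -> g = h.

Definition is_kernel X Y (f : mor X Y) K (i : mor K X) : Prop :=
  f ∘ i = 0 /\
  forall W (g : mor W X), f ∘ g = 0 -> exists! h : mor W K, i ∘ h = g.

Definition is_cokernel X Y (f : mor X Y) Q (p : mor Y Q) : Prop :=
  p ∘ f = 0 /\
  forall W (g : mor Y W), g ∘ f = 0 -> exists! h : mor Q W, h ∘ p = g.

Definition simple_object X : Prop :=
  ~ is_zero X /\
  forall Y (i : mor Y X), is_mono i -> is_zero Y \/ is_iso i.

Definition is_direct_sum n (S : 'I_n -> C) X : Prop :=
  exists (i : forall j, mor (S j) X) (p : forall j, mor X (S j)),
  [/\ forall j, p j ∘ i j = idmor (S j),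
      forall j l, j != l -> p j ∘ i l = 0
    & \sum_(j < n) (i j ∘ p j) = idmor X].

Record linear_category : Prop := LinearCategory {
  comp_assoc : forall W X Y Z (h : mor Y Z) (g : mor X Y) (f : mor W X),
    h ∘ (g ∘ f) = (h ∘ g) ∘ f;
  comp_idl : forall X Y (f : mor X Y), idmor Y ∘ f = f;
  comp_idr : forall X Y (f : mor X Y), f ∘ idmor X = f;
  comp_linearl : forall X Y Z (f : mor X Y),
    linear (fun g : mor Y Z => g ∘ f);
  comp_linearr : forall X Y Z (g : mor Y Z),
    linear (fun f : mor X Y => g ∘ f) }.

Record abelian_category : Prop := AbelianCategory {
  has_zero : exists X, is_zero X;
  has_biproducts : forall X Y, exists B (i : mor X B) (j : mor Y B)
      (p : mor B X) (q : mor B Y),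
    [/\ p ∘ i = idmor X, q ∘ j = idmor Y, p ∘ j = 0, q ∘ i = 0
      & i ∘ p + j ∘ q = idmor B];
  has_kernels : forall X Y (f : mor X Y),
    exists K (i : mor K X), is_kernel f i;
  has_cokernels : forall X Y (f : mor X Y),
    exists Q (p : mor Y Q), is_cokernel f p;
  mono_normal : forall X Y (f : mor X Y), is_mono f ->
    exists Z (g : mor Y Z), is_kernel g f;
  epi_normal : forall X Y (f : mor X Y), is_epi f ->
    exists Z (g : mor Z X), is_cokernel g f }.

Definition semisimple_category : Prop :=
  forall X, exists n (S : 'I_n -> C),
    (forall j, simple_object (S j)) /\ is_direct_sum S X.

(* [s] lists each isomorphism class of simple objects exactly once. *)
Definition simple_system (I : Type) (s : I -> C) : Prop :=
  [/\ forall i, simple_object (s i),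
      forall i j, isomorphic (s i) (s j) -> i = j
    & forall X, simple_object X -> exists i, isomorphic X (s i)].

End Linear.

Section Rigid.
Variables (k : fieldType) (C : rigidData k).
Implicit Types X Y Z : C.

Record monoidal_category : Prop := MonoidalCategory {
  tensm_id : forall X Y, idmor X ⊠ idmor Y = idmor (X ⊗ Y);
  tensm_comp : forall X X' X'' Y Y' Y'' (f : mor X X') (f' : mor X' X'')
      (g : mor Y Y') (g' : mor Y' Y''),
    (f' ∘ f) ⊠ (g' ∘ g) = (f' ⊠ g') ∘ (f ⊠ g) :> mor (X ⊗ Y) (X'' ⊗ Y'');
  tensm_linearl : forall X X' Y Y' (g : mor Y Y'),
    linear (fun f : mor X X' => f ⊠ g);
  tensm_linearr : forall X X' Y Y' (f : mor X X'),
    linear (fun g : mor Y Y' => f ⊠ g);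
  assocK : forall X Y Z, inverse_of (assoc X Y Z) (associ X Y Z);
  lunitK : forall X, inverse_of (lunit X) (luniti X);
  runitK : forall X, inverse_of (runit X) (runiti X);
  assoc_natural : forall X X' Y Y' Z Z'
      (f : mor X X') (g : mor Y Y') (h : mor Z Z'),
    assoc X' Y' Z' ∘ ((f ⊠ g) ⊠ h) = (f ⊠ (g ⊠ h)) ∘ assoc X Y Z;
  lunit_natural : forall X Y (f : mor X Y),
    lunit Y ∘ (idmor unit_obj ⊠ f) = f ∘ lunit X;
  runit_natural : forall X Y (f : mor X Y),
    runit Y ∘ (f ⊠ idmor unit_obj) = f ∘ runit X;
  pentagon : forall W X Y Z,
    assoc W X (Y ⊗ Z) ∘ assoc (W ⊗ X) Y Z
    = (idmor W ⊠ assoc X Y Z) ∘ assoc W (X ⊗ Y) Z ∘ (assoc W X Y ⊠ idmor Z);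
  triangle : forall X Y,
    (idmor X ⊠ lunit Y) ∘ assoc X unit_obj Y = runit X ⊠ idmor Y }.

Record rigid_category : Prop := RigidCategory {
  zigzag_obj : forall X,
    runit X ∘ (idmor X ⊠ ev X) ∘ assoc X (dual X) X
      ∘ (coev X ⊠ idmor X) ∘ luniti X = idmor X;
  zigzag_dual : forall X,
    lunit (dual X) ∘ (ev X ⊠ idmor (dual X)) ∘ associ (dual X) X (dual X)
      ∘ (idmor (dual X) ⊠ coev X) ∘ runiti (dual X) = idmor (dual X) }.

(* The morphism Z -> X^* adjoint to a pairing Z ⊗ X -> 1. *)
Definition mate Z X (p : mor (Z ⊗ X) unit_obj) : mor Z (dual X) :=
  lunit (dual X) ∘ (p ⊠ idmor (dual X)) ∘ associ Z X (dual X)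
    ∘ (idmor Z ⊠ coev X) ∘ runiti Z.

Definition dualm X Y (f : mor X Y) : mor (dual Y) (dual X) :=
  mate (ev Y ∘ (idmor (dual Y) ⊠ f)).

(* The canonical isomorphism Y^* ⊗ X^* -> (X ⊗ Y)^*. *)
Definition dual_tens X Y : mor (dual Y ⊗ dual X) (dual (X ⊗ Y)) :=
  mate (ev Y ∘ (idmor (dual Y) ⊠ (lunit Y ∘ (ev X ⊠ idmor Y)
                                  ∘ associ (dual X) X Y))
          ∘ assoc (dual Y) (dual X) (X ⊗ Y)).

(* The scalar c such that f = c id_1, when id_1 spans End(1). *)
Definition scalar_of (f : mor unit_obj unit_obj : vectType k) : k :=
  coord [tuple (idmor unit_obj : mor (unit_obj : C) unit_obj)] ord0 f.

End Rigid.

Section Braided.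
Variables (k : fieldType) (C : braidedData k).
Implicit Types X Y Z : C.

Record braided_category : Prop := BraidedCategory {
  braid_iso : forall X Y, is_iso (braid X Y);
  braid_natural : forall X X' Y Y' (f : mor X X') (g : mor Y Y'),
    braid X' Y' ∘ (f ⊠ g) = (g ⊠ f) ∘ braid X Y;
  hexagon_r : forall X Y Z,
    assoc Y Z X ∘ braid X (Y ⊗ Z) ∘ assoc X Y Z
    = (idmor Y ⊠ braid X Z) ∘ assoc Y X Z ∘ (braid X Y ⊠ idmor Z);
  hexagon_l : forall X Y Z,
    associ Z X Y ∘ braid (X ⊗ Y) Z ∘ associ X Y Z
    = (braid X Z ⊠ idmor Y) ∘ associ X Z Y ∘ (idmor X ⊠ braid Y Z) }.

(* X -> X ⊗ X^* ⊗ X^** -> X^* ⊗ X ⊗ X^** -> X^** *)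
Definition drinfeld X : mor X (dual (dual X)) :=
  mate (ev X ∘ braid X (dual X)).

Definition transparent X : Prop :=
  forall Y, braid Y X ∘ braid X Y = idmor (X ⊗ Y).

Definition nondegenerate_category : Prop :=
  forall X, transparent X ->
    exists n, is_direct_sum (fun _ : 'I_n => unit_obj) X.

End Braided.

Section Pivotal.
Variables (k : fieldType) (C : pivotalData k).
Implicit Types X Y Z : C.

(* [piv_tens] says that [piv] is compatible with the monoidal structure
   X^** ⊗ Y^** -> (X ⊗ Y)^**, composed with (X ⊗ Y)^** -> (Y^* ⊗ X^* )^*. A
   pivotal structure makes left duals into right duals. *)
Record pivotal_category : Prop := PivotalCategory {
  piv_iso : forall X, is_iso (piv X);
  piv_natural : forall X Y (f : mor X Y),
    piv Y ∘ f = dualm (dualm f) ∘ piv X;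
  piv_tens : forall X Y,
    dualm (dual_tens X Y) ∘ piv (X ⊗ Y)
    = dual_tens (dual Y) (dual X) ∘ (piv X ⊠ piv Y) }.

Definition traceR X (f : mor X X) : k :=
  scalar_of (ev (dual X) ∘ ((piv X ∘ f) ⊠ idmor (dual X)) ∘ coev X).

Definition traceL X (f : mor X X) : k :=
  scalar_of (ev X ∘ (idmor (dual X) ⊠ (f ∘ inv_hom (piv X))) ∘ coev (dual X)).

Definition dimR X : k := traceR (idmor X).
Definition dimL X : k := traceL (idmor X).

Definition Smat X Y : k := traceR (braid Y X ∘ braid X Y).

Record braided_pivotal_fusion : Prop := BraidedPivotalFusion {
  fusion_linear : linear_category C;
  fusion_abelian : abelian_category C;
  fusion_semisimple : semisimple_category C;
  fusion_finite : exists n (s : 'I_n -> C), simple_system s;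
  fusion_monoidal : monoidal_category C;
  fusion_unit : simple_object (unit_obj : C);
  fusion_rigid : rigid_category C;
  fusion_braided : braided_category C;
  fusion_pivotal : pivotal_category }.

End Pivotal.

Section Functor.
Variables (k : fieldType) (D C : pivotalData k).

Record functorData := FunctorData {
  fobj :> D -> C;
  fmap : forall X Y : D, mor X Y -> mor (fobj X) (fobj Y);
  ften : forall X Y : D, mor (fobj X ⊗ fobj Y) (fobj (X ⊗ Y));
  fone : mor unit_obj (fobj unit_obj) }.

Variable F : functorData.
Arguments fmap f {X Y}.
Arguments ften f X Y : clear implicits.

(* The canonical isomorphism F(X^* ) -> F(X)^*. *)
Definition fdual (X : D) : mor (F (dual X)) (dual (F X)) :=
  mate (inv_hom (fone F) ∘ fmap F (ev X) ∘ ften F (dual X) X).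

Record full_embedding : Prop := FullEmbedding {
  fmap_id : forall X : D, fmap F (idmor X) = idmor (F X);
  fmap_comp : forall (X Y Z : D) (g : mor Y Z) (f : mor X Y),
    fmap F (g ∘ f) = fmap F g ∘ fmap F f;
  fmap_linear : forall X Y : D, linear (@fmap F X Y);
  fmap_bij : forall X Y : D, bijective (@fmap F X Y) }.

Record monoidal_functor : Prop := MonoidalFunctor {
  ften_iso : forall X Y, is_iso (ften F X Y);
  fone_iso : is_iso (fone F);
  ften_natural : forall (X X' Y Y' : D) (f : mor X X') (g : mor Y Y'),
    ften F X' Y' ∘ (fmap F f ⊠ fmap F g) = fmap F (f ⊠ g) ∘ ften F X Y;
  ften_assoc : forall X Y Z : D,
    fmap F (assoc X Y Z) ∘ ften F (X ⊗ Y) Z ∘ (ften F X Y ⊠ idmor (F Z))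
    = ften F X (Y ⊗ Z) ∘ (idmor (F X) ⊠ ften F Y Z)
        ∘ assoc (F X) (F Y) (F Z);
  ften_lunit : forall X : D,
    fmap F (lunit X) ∘ ften F unit_obj X ∘ (fone F ⊠ idmor (F X)) = lunit (F X);
  ften_runit : forall X : D,
    fmap F (runit X) ∘ ften F X unit_obj ∘ (idmor (F X) ⊠ fone F)
    = runit (F X) }.

Definition braided_functor : Prop :=
  forall X Y : D,
    fmap F (braid X Y) ∘ ften F X Y = ften F Y X ∘ braid (F X) (F Y).

Definition pivotal_functor : Prop :=
  forall X : D,
    dualm (fdual X) ∘ piv (F X) = fdual (dual X) ∘ fmap F (piv X).

(* F identifies D with a full braided pivotal subcategory of C. *)
Record braided_pivotal_embedding : Prop := BraidedPivotalEmbedding {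
  embedding_full : full_embedding;
  embedding_monoidal : monoidal_functor;
  embedding_braided : braided_functor;
  embedding_pivotal : pivotal_functor }.

End Functor.

(* Representations act on row vectors on the right, so a morphism V -> W is a
   (dim V) x (dim W) matrix and composition is reversed matrix product. The
   basis of V ⊗ W is indexed through [mxtens_index]. *)
Section Representations.
Variables (k : fieldType) (A : finGroupType).

Record rep := Rep {
  rdim : nat;
  ract :> mx_representation k [set: A] rdim }.

Implicit Types U V W : rep.

Lemma ract1 V : V 1%g = 1%:M. Proof. exact: repr_mx1. Qed.
Lemma ractM V g h : V (g * h)%g = V g *m V h.
Proof. by apply: repr_mxM; rewrite inE. Qed.

Definition intertwines V W (M : 'M[k]_(rdim V, rdim W)) : Prop :=
  forall g, V g *m M = M *m W g.

Definition intertwining_def V W g (M : 'M[k]_(rdim V, rdim W)) :=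
  V g *m M - M *m W g.

Lemma intertwining_def_linear V W g : linear (@intertwining_def V W g).
Proof.
move=> c M N; rewrite /intertwining_def mulmxDr mulmxDl -scalemxAr -scalemxAl.
by rewrite scalerBr opprD addrACA.
Qed.

HB.instance Definition _ V W g :=
  GRing.isLinear.Build k 'M[k]_(rdim V, rdim W) 'M[k]_(rdim V, rdim W) _
    (@intertwining_def V W g) (@intertwining_def_linear V W g).

Definition intertwiners V W : {vspace 'M[k]_(rdim V, rdim W)} :=
  (\bigcap_(g : A) lker (linfun (@intertwining_def V W g)))%VS.

Lemma intertwinersP V W (M : 'M[k]_(rdim V, rdim W)) :
  intertwines M <-> M \in intertwiners V W.
Proof.
rewrite /intertwiners memvE; split=> [h | /subv_bigcapP h g].
  apply/subv_bigcapP => g _; rewrite -memvE memv_ker lfunE /=.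
  by rewrite /intertwining_def h subrr.
have := h g isT; rewrite -memvE memv_ker lfunE /= subr_eq0.
by move/eqP.
Qed.

Definition rhom V W : vectType k := subvs_of (intertwiners V W).

Definition to_rhom V W M (hM : @intertwines V W M) : rhom V W :=
  Subvs (proj1 (intertwinersP M) hM).

Lemma rhomP V W (f : rhom V W) : intertwines (vsval f).
Proof. exact/intertwinersP/subvsP. Qed.

Lemma rid_subproof V : @intertwines V V 1%:M.
Proof. by move=> g; rewrite mulmx1 mul1mx. Qed.
Definition rid V : rhom V V := to_rhom (@rid_subproof V).

Lemma rcomp_subproof U V W (g : rhom V W) (f : rhom U V) :
  intertwines (vsval f *m vsval g).
Proof. by move=> x; rewrite mulmxA rhomP -mulmxA rhomP mulmxA. Qed.
Definition rcomp U V W (g : rhom V W) (f : rhom U V) : rhom U W :=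
  to_rhom (rcomp_subproof g f).

Definition rep_catData : catData k := CatData rid rcomp.


Lemma tens_mx1 m n : 1%:M *t 1%:M = 1%:M :> 'M[k]_(m * n).
Proof.
apply/matrixP=> p q; case: (mxtens_indexP p) => i j.
case: (mxtens_indexP q) => i' j'; rewrite tensmxE !mxE -natrM mulnb.
by rewrite (can_eq (@mxtens_indexK m n)).
Qed.

Lemma rtens_subproof V W : mx_repr [set: A] (fun g => V g *t W g).
Proof.
by split=> [|g h _ _]; rewrite ?ract1 ?tens_mx1 // !ractM tensmx_mul.
Qed.
Definition rtens V W : rep := Rep (MxRepresentation (rtens_subproof V W)).

Lemma rtensm_subproof V V' W W' (f : rhom V V') (g : rhom W W') :
  @intertwines (rtens V W) (rtens V' W') (vsval f *t vsval g).
Proof. by move=> x; rewrite /= !tensmx_mul !rhomP. Qed.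
Definition rtensm V V' W W' (f : rhom V V') (g : rhom W W') :
    rhom (rtens V W) (rtens V' W') :=
  to_rhom (rtensm_subproof f g).

(* The one-dimensional representation with character [chi]. *)
Section Line.
Variable chi : A -> k.
Hypotheses (chi1 : chi 1%g = 1)
           (chiM : forall g h, chi (g * h)%g = chi g * chi h).
Lemma rline_subproof : mx_repr [set: A] (fun g => (chi g)%:M : 'M_1).
Proof. by split=> [|g h _ _]; rewrite ?chi1 // chiM scalar_mxM. Qed.
Definition rline : rep := Rep (MxRepresentation rline_subproof).
End Line.

Definition rone : rep :=
  @rline (fun=> 1) erefl (fun _ _ => esym (mulr1 1)).

(* The matrix of the linear map sending the i-th basis vector to the f(i)-th. *)
Definition basis_map m n (f : 'I_m -> 'I_n) : 'M[k]_(m, n) :=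
  \matrix_(i, j) (f i == j)%:R.

Section BasisHom.
Variables (V W : rep).
Variables (f : 'I_(rdim V) -> 'I_(rdim W)) (f' : 'I_(rdim W) -> 'I_(rdim V)).
Hypotheses (fK : cancel f f') (f'K : cancel f' f).
Hypothesis f_act : forall g i j, V g i j = W g (f i) (f j).

Lemma basis_map_subproof : intertwines (basis_map f).
Proof.
move=> g; apply/matrixP=> i j; rewrite !mxE.
rewrite (bigD1 (f' j)) //= (bigD1 (f i)) //= !mxE f'K !eqxx mulr1 mul1r.
rewrite f_act f'K !big1 // => l nl; rewrite mxE.
  by rewrite eq_sym (negPf nl) mul0r.
by rewrite (can2_eq fK f'K) (negPf nl) mulr0.
Qed.
Definition basis_hom : rhom V W := to_rhom basis_map_subproof.
End BasisHom.

Section BasisHomInv.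
Variables (V W : rep).
Variables (f : 'I_(rdim V) -> 'I_(rdim W)) (f' : 'I_(rdim W) -> 'I_(rdim V)).
Hypotheses (fK : cancel f f') (f'K : cancel f' f).
Hypothesis f_act : forall g i j, V g i j = W g (f i) (f j).

Lemma basis_act_inv g i j : W g i j = V g (f' i) (f' j).
Proof. by rewrite f_act !f'K. Qed.
Definition basis_homi : rhom W V := basis_hom f'K fK basis_act_inv.
End BasisHomInv.

Definition assoc_index m n p (i : 'I_((m * n) * p)) : 'I_(m * (n * p)) :=
  let: (ij, l) := mxtens_unindex i in let: (i, j) := mxtens_unindex ij in
  mxtens_index (i, mxtens_index (j, l)).
Definition associ_index m n p (i : 'I_(m * (n * p))) : 'I_((m * n) * p) :=
  let: (i, jl) := mxtens_unindex i in let: (j, l) := mxtens_unindex jl in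
  mxtens_index (mxtens_index (i, j), l).
Definition lunit_index n (i : 'I_(1 * n)) : 'I_n := (mxtens_unindex i).2.
Definition luniti_index n (i : 'I_n) : 'I_(1 * n) := mxtens_index (ord0, i).
Definition runit_index n (i : 'I_(n * 1)) : 'I_n := (mxtens_unindex i).1.
Definition runiti_index n (i : 'I_n) : 'I_(n * 1) := mxtens_index (i, ord0).
Definition flip_index m n (i : 'I_(m * n)) : 'I_(n * m) :=
  let: (i, j) := mxtens_unindex i in mxtens_index (j, i).

Lemma assoc_indexK m n p : cancel (@assoc_index m n p) (@associ_index m n p).
Proof.
move=> i; case: (mxtens_indexP i) => ij l; case: (mxtens_indexP ij) => {}i j.
by rewrite /assoc_index /associ_index !mxtens_indexK.
Qed.
Lemma associ_indexK m n p : cancel (@associ_index m n p) (@assoc_index m n p).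
Proof.
move=> i; case: (mxtens_indexP i) => {}i jl; case: (mxtens_indexP jl) => j l.
by rewrite /assoc_index /associ_index !mxtens_indexK.
Qed.
Lemma lunit_indexK n : cancel (@lunit_index n) (@luniti_index n).
Proof.
move=> i; case: (mxtens_indexP i) => o j.
by rewrite /lunit_index /luniti_index !mxtens_indexK (ord1 o).
Qed.
Lemma luniti_indexK n : cancel (@luniti_index n) (@lunit_index n).
Proof. by move=> i; rewrite /lunit_index /luniti_index mxtens_indexK. Qed.
Lemma runit_indexK n : cancel (@runit_index n) (@runiti_index n).
Proof.
move=> i; case: (mxtens_indexP i) => j o.
by rewrite /runit_index /runiti_index !mxtens_indexK (ord1 o).
Qed.
Lemma runiti_indexK n : cancel (@runiti_index n) (@runit_index n).
Proof. by move=> i; rewrite /runit_index /runiti_index mxtens_indexK. Qed.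
Lemma flip_indexK m n : cancel (@flip_index m n) (@flip_index n m).
Proof.
by move=> i; case: (mxtens_indexP i) => j l; rewrite /flip_index !mxtens_indexK.
Qed.

Lemma assoc_act U V W g i j :
  rtens (rtens U V) W g i j
  = rtens U (rtens V W) g (assoc_index i) (assoc_index j).
Proof.
case: (mxtens_indexP i) (mxtens_indexP j) => ij l [ij' l'].
case: (mxtens_indexP ij) (mxtens_indexP ij') => {}i m [i' m'].
by rewrite /assoc_index !mxtens_indexK !tensmxE mulrA.
Qed.
Lemma lunit_act V g i j :
  rtens rone V g i j = V g (lunit_index i) (lunit_index j).
Proof.
case: (mxtens_indexP i) (mxtens_indexP j) => o {}i [o' {}j].
by rewrite /lunit_index !mxtens_indexK tensmxE !ord1 mxE mul1r.
Qed.
Lemma runit_act V g i j :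
  rtens V rone g i j = V g (runit_index i) (runit_index j).
Proof.
case: (mxtens_indexP i) (mxtens_indexP j) => {}i o [{}j o'].
by rewrite /runit_index !mxtens_indexK tensmxE !ord1 mxE mulr1.
Qed.
Lemma flip_act V W g i j :
  rtens V W g i j = rtens W V g (flip_index i) (flip_index j).
Proof.
case: (mxtens_indexP i) (mxtens_indexP j) => {}i l [{}j l'].
by rewrite /flip_index !mxtens_indexK !tensmxE mulrC.
Qed.

Arguments basis_hom V W {f f'} & fK f'K f_act.
Arguments basis_homi V W {f f'} & fK f'K f_act.

Definition rassoc U V W : rhom (rtens (rtens U V) W) (rtens U (rtens V W)) :=
  basis_hom _ _ (@assoc_indexK _ _ _) (@associ_indexK _ _ _) (@assoc_act U V W).
Definition rassoci U V W : rhom (rtens U (rtens V W)) (rtens (rtens U V) W) :=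
  basis_homi _ _ (@assoc_indexK _ _ _) (@associ_indexK _ _ _) (@assoc_act U V W).
Definition rlunit V : rhom (rtens rone V) V :=
  basis_hom _ _ (@lunit_indexK _) (@luniti_indexK _) (@lunit_act V).
Definition rluniti V : rhom V (rtens rone V) :=
  basis_homi _ _ (@lunit_indexK _) (@luniti_indexK _) (@lunit_act V).
Definition rrunit V : rhom (rtens V rone) V :=
  basis_hom _ _ (@runit_indexK _) (@runiti_indexK _) (@runit_act V).
Definition rruniti V : rhom V (rtens V rone) :=
  basis_homi _ _ (@runit_indexK _) (@runiti_indexK _) (@runit_act V).

Lemma rdual_subproof V : mx_repr [set: A] (fun g => (V g^-1%g)^T).
Proof.
split=> [|g h _ _]; first by rewrite invg1 ract1 trmx1.
by rewrite invMg ractM trmx_mul.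
Qed.
Definition rdual V : rep := Rep (MxRepresentation (rdual_subproof V)).

Definition ev_mx n : 'M[k]_(n * n, 1) :=
  \matrix_(i, o) ((mxtens_unindex i).1 == (mxtens_unindex i).2)%:R.

Lemma tens_ev_mx m n (M N : 'M[k]_(m, n)) i j :
  ((M *t N) *m ev_mx n) (mxtens_index (i, j)) ord0 = (M *m N^T) i j.
Proof.
rewrite !mxE (reindex (@mxtens_index n n)) /=; last first.
  exists (@mxtens_unindex n n) => p _; first exact: mxtens_indexK.
  exact: mxtens_unindexK.
transitivity (\sum_a \sum_b (M *t N) (mxtens_index (i, j))
    (mxtens_index (a, b)) * ev_mx n (mxtens_index (a, b)) ord0).
  by rewrite pair_bigA; apply: eq_bigr => -[].
apply: eq_bigr => a _; rewrite (bigD1 a) //= big1 ?addr0 => [|b nb].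
  by rewrite tensmxE !mxE mxtens_indexK eqxx mulr1.
by rewrite !mxE !mxtens_indexK /= eq_sym (negPf nb) mulr0.
Qed.

Lemma rev_subproof V : @intertwines (rtens (rdual V) V) rone (ev_mx (rdim V)).
Proof.
move=> g; rewrite /= mulmx1; apply/matrixP=> i o; rewrite ord1 => {o}.
case: (mxtens_indexP i) => {}i j; rewrite tens_ev_mx -trmx_mul -ractM mulgV.
by rewrite ract1 !mxE mxtens_indexK eq_sym.
Qed.
Definition rev_ V : rhom (rtens (rdual V) V) rone := to_rhom (@rev_subproof V).

Lemma rcoev_subproof V :
  @intertwines rone (rtens V (rdual V)) (ev_mx (rdim V))^T.
Proof.
move=> g; rewrite /= mul1mx; apply: trmx_inj; rewrite trmx_mul !trmxK.
apply/matrixP=> i o; rewrite ord1 => {o} /=; case: (mxtens_indexP i) => {}i j.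
rewrite trmx_tens trmxK tens_ev_mx -trmx_mul -ractM mulVg.
by rewrite ract1 !mxE mxtens_indexK eq_sym.
Qed.
Definition rcoev V : rhom rone (rtens V (rdual V)) :=
  to_rhom (@rcoev_subproof V).

Definition rep_rigidData : rigidData k :=
  @RigidData k rep_catData rtens rtensm rone rassoc rassoci
    rlunit rluniti rrunit rruniti rdual rev_ rcoev.

Hypothesis cA : abelian [set: A].
Variable z : A.

(* On the (e, e')-eigenspace of (z, z), with e and e' in {1, -1}, this is the
   flip multiplied by -1 if e = e' = -1, and by 1 otherwise. *)
Definition super_mx V W : 'M[k]_(rdim V * rdim W) :=
  2%:R^-1 *: (1%:M *t 1%:M + V z *t 1%:M + 1%:M *t W z - V z *t W z).

Lemma ractC V g : V g *m V z = V z *m V g.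
Proof. by rewrite -!ractM (centsP cA) ?inE. Qed.

Lemma rbraid_subproof V W :
  @intertwines (rtens V W) (rtens W V)
    (super_mx V W *m basis_map (@flip_index _ _)).
Proof.
have flipP := @basis_map_subproof (rtens V W) (rtens W V) _ _
  (@flip_indexK _ _) (@flip_indexK _ _) (@flip_act V W).
move=> g; rewrite -mulmxA -flipP !mulmxA; congr (_ *m _).
rewrite /super_mx -scalemxAl -scalemxAr; congr (_ *: _).
rewrite !(mulmxDl, mulmxDr) /= mulNmx mulmxN !tensmx_mul.
by rewrite !mul1mx !mulmx1 !ractC.
Qed.
Definition rbraid V W : rhom (rtens V W) (rtens W V) :=
  to_rhom (@rbraid_subproof V W).

Definition rep_braidedData : braidedData k :=
  @BraidedData k rep_rigidData rbraid.

(* The twist is trivial: the pivotal structure is the Drinfeld morphism. *)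
Definition rep_pivotalData : pivotalData k :=
  @PivotalData k rep_braidedData (@drinfeld k rep_braidedData).

End Representations.

Section Character.
Variables (k : closedFieldType) (A : finGroupType).

Definition is_linear_character (chi : {ffun A -> k}) : bool :=
  (chi 1%g == 1) && [forall g, forall h, chi (g * h)%g == chi g * chi h].

(* The group of characters of A with values in k. *)
Record linear_character := LinearCharacter {
  char_ffun : {ffun A -> k};
  _ : is_linear_character char_ffun }.
HB.instance Definition _ := [isSub for char_ffun].
HB.instance Definition _ := [Choice of linear_character by <:].

Definition char_fun (alpha : linear_character) : A -> k := char_ffun alpha.
Coercion char_fun : linear_character >-> Funclass.

Implicit Type alpha : linear_character.

Lemma char_1 alpha : alpha 1%g = 1.
Proof. by case/andP: (valP alpha) => /eqP. Qed.
Lemma char_M alpha g h : alpha (g * h)%g = alpha g * alpha h.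
Proof. by case/andP: (valP alpha) => _ /forallP/(_ g)/forallP/(_ h)/eqP. Qed.
Lemma char_X alpha g n : alpha (g ^+ n)%g = alpha g ^+ n.
Proof.
by elim: n => [|n IH]; rewrite ?expg0 ?char_1 // expgS char_M IH exprS.
Qed.

Definition roots_of_unity : seq k :=
  sval (closed_field_poly_normal ('X^#|A| - 1%:P)).

Lemma char_root alpha g : alpha g \in roots_of_unity.
Proof.
rewrite /roots_of_unity; case: closed_field_poly_normal => r /= Er.
have A_gt0 : (0 < #|A|)%N by apply/card_gt0P; exists 1%g.
have := monicXnsubC (1 : k) A_gt0 => /monicP lc1.
rewrite -root_prod_XsubC -[X in root X](scale1r) -lc1 -Er.
rewrite rootE !hornerE -char_X -cardsT expg_cardG ?inE //.
by rewrite char_1 subrr.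
Qed.

Definition char_encode alpha : {ffun A -> seq_sub roots_of_unity} :=
  [ffun g => SeqSub (char_root alpha g)].
Definition char_decode (f : {ffun A -> seq_sub roots_of_unity}) :
    option linear_character :=
  insub [ffun g => ssval (f g)].
Lemma char_encodeK : pcancel char_encode char_decode.
Proof.
move=> alpha; rewrite /char_decode.
suff -> : [ffun g => ssval (char_encode alpha g)] = val alpha by rewrite valK.
by apply/ffunP => g; rewrite !ffunE.
Qed.
HB.instance Definition _ : isCountable linear_character :=
  PCanIsCountable char_encodeK.
HB.instance Definition _ : isFinite linear_character :=
  PCanIsFinite char_encodeK.

Definition char_rep alpha : rep k A := rline (char_1 alpha) (@char_M alpha).

End Character.

Section Graded.
Variables (k : closedFieldType) (A : finGroupType).
Variables (cA : abelian [set: A]) (z : A) (C : pivotalData k).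
Variable F : functorData (rep_pivotalData k cA z) C.
Variables (Irr : finType) (s : Irr -> C).

Implicit Types (X Y : C) (alpha : linear_character k A).
Implicit Types (R T : {set Irr}) (a h : A).

(* The image in C of the simple object of Rep(A,z) with character [alpha]. *)
Definition Xchar alpha : C := F (char_rep alpha).

Definition has_degree h X : Prop :=
  forall alpha, braid X (Xchar alpha) ∘ braid (Xchar alpha) X
                = alpha h *: idmor (Xchar alpha ⊗ X).

Definition trivial_stabilizer X : Prop :=
  forall alpha, isomorphic (Xchar alpha ⊗ X) X -> forall g, alpha g = 1.

Definition Ideg h : {set Irr} := [set i | `[< has_degree h (s i) >]].
Definition Ifree : {set Irr} :=
  [set i in Ideg 1 | `[< trivial_stabilizer (s i) >]].

Definition dim_deg h : k := \sum_(i in Ideg h) dimL (s i) * dimR (s i).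

Definition same_orbit i j : Prop :=
  exists alpha, isomorphic (s j) (Xchar alpha ⊗ s i).

Definition representatives R T : Prop :=
  R \subset T /\ forall j, j \in T -> exists! i, i \in R /\ same_orbit i j.

Definition is_bar X X' : Prop :=
  forall Y, simple_object Y -> Smat X (dual Y) / dimR X = Smat X' Y / dimR X'.

(* When C is non-degenerate there is exactly one such simple object for each
   simple X, and the default value is not used. *)
Definition bar X : C :=
  if [pick j | `[< is_bar X (s j) >]] is Some j then s j else X.

Definition bar_set R : {set Irr} :=
  [set j | `[< exists2 i, i \in R & isomorphic (s j) (bar (s i)) >]].

Definition bar_stable R : Prop :=
  forall i, i \in R -> exists2 j, j \in R & isomorphic (s j) (bar (s i)).

(* Matrices indexed by sets of simple objects: the i-th row of a matrix with
   rows in R corresponds to [enum_val i : Irr]. *)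
Definition Smx R T : 'M[k]_(#|R|, #|T|) :=
  \matrix_(i, j) Smat (s (enum_val i)) (s (enum_val j)).

Definition Pmx a R : 'M[k]_#|R| :=
  \matrix_(i, j) \sum_(alpha : linear_character k A) alpha z * alpha a^-1%g *
    `[< isomorphic (bar (s (enum_val j))) (Xchar alpha ⊗ s (enum_val i)) >]%:R.

Definition Qmx R T : 'M[k]_(#|R|, #|T|) :=
  \matrix_(i, j) `[< isomorphic (bar (s (enum_val i))) (s (enum_val j)) >]%:R.

End Graded.

(* Main.v *)
(* Let Omega be the sum of the simple objects Y weighted by dim^L(Y). Sliding a
   strand over a ring colored by Omega shows that a simple object on which the
   ring does not vanish is transparent. When C is non-degenerate this makes the
   rows of S distinct characters of the Grothendieck ring, so orthogonality of
   characters gives S^2 = dim(C) dim^R(bar 1) B, where B is the permutation matrix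
   of X |-> bar X; here dim(C) <> 0 as an eigenvalue of a positive definite
   integral matrix, and the constant is read off from bar X = bar 1 ⊗ X^*.

   Tensoring X with X_alpha multiplies S_{X,Y} by alpha(z) alpha(deg Y).
   Averaging over the characters therefore projects the sum in S^2 onto the Y of
   one degree; grouping these Y by orbits, on which the summand is constant,
   yields the three identities, with dim(C_1) = dim(C) / #A. Simple objects of
   degree 1 with a nontrivial stabilizer pair to zero with those of degree a.
   The action on the objects of degree a is free, as a comparison of twists
   shows. Since P and Q are invertible, the ranks give the equality of
   cardinalities. *)

From HB Require Import structures.
Require Import Defs.
From mathcomp Require Import all_boot all_fingroup all_algebra cyclic.
From mathcomp Require Import mxrepresentation separable cyclotomic.
From mathcomp Require Import boolp ring.
From mathcomp.real_closed Require Import mxtens.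

Set Implicit Arguments.
Unset Strict Implicit.
Unset Printing Implicit Defensive.

Import Num.Theory GRing.Theory VectorInternalTheory.
Local Open Scope ring_scope.
Local Open Scope cat_scope.

Local Notation "g ⊚ f" := (compm g f)
  (at level 46, right associativity, only parsing) : cat_scope.
Local Notation "X ◁ f" := (idmor X ⊠ f) (at level 40, f at level 39) : cat_scope.
Local Notation "f ▷ U" := (f ⊠ idmor U) (at level 40, U at level 39) : cat_scope.

(** * Linear and monoidal categories *)

(** [C] is not strict, so a string diagram cannot be manipulated as drawn. Every diagram is
    therefore read as acting on right-bracketed words X ⊗ (Y ⊗ (... ⊗ U)) whose last object [U] is
    arbitrary: caps, cups and crossings act on the first letters, compose without associators, and
    all remaining strands are absorbed in [U]. Coherence is paid for once, in the lemmas on [cap],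
    [cup] and [bw]. The pivotal structure is not assumed spherical, so dim^L and dim^R may be
    different characters of the Grothendieck ring. The ring Omega carries dim^L, while the row of S
    at the unit is dim^R; the row giving dim^L is that of bar 1. This is why bar 1 ⊗ X^* takes the
    place of X^* in the square of S, and where dim^R(bar 1) comes from. Of the two factors 1/#A met
    in the sums, one comes from projecting onto a degree and is absorbed in dim(C_1); the other
    comes from keeping one representative per free orbit. *)

Section LinearTheory.
Variables (k : fieldType) (C : catData k).
Hypothesis linC : linear_category C.
Implicit Types W X Y Z : C.

Lemma compA W X Y Z (h : mor Y Z) (g : mor X Y) (f : mor W X) :
  h ∘ (g ∘ f) = (h ∘ g) ∘ f.
Proof. exact: (comp_assoc linC). Qed.

Lemma comp1m X Y (f : mor X Y) : idmor Y ∘ f = f.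
Proof. exact: (comp_idl linC). Qed.

Lemma compm1 X Y (f : mor X Y) : f ∘ idmor X = f.
Proof. exact: (comp_idr linC). Qed.

Lemma compDl X Y Z (g g' : mor Y Z) (f : mor X Y) :
  (g + g') ∘ f = g ∘ f + g' ∘ f.
Proof. by have := comp_linearl linC f 1 g g'; rewrite !scale1r. Qed.

Lemma compDr X Y Z (g : mor Y Z) (f f' : mor X Y) :
  g ∘ (f + f') = g ∘ f + g ∘ f'.
Proof. by have := comp_linearr linC g 1 f f'; rewrite !scale1r. Qed.

Lemma comp0m X Y Z (f : mor X Y) : (0 : mor Y Z) ∘ f = 0.
Proof. by apply: (addIr (0 ∘ f)); rewrite add0r -compDl addr0. Qed.

Lemma compm0 X Y Z (g : mor Y Z) : g ∘ (0 : mor X Y) = 0.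
Proof. by apply: (addIr (g ∘ 0)); rewrite add0r -compDr addr0. Qed.

Lemma compZl X Y Z c (g : mor Y Z) (f : mor X Y) : (c *: g) ∘ f = c *: (g ∘ f).
Proof. by have := comp_linearl linC f c g 0; rewrite comp0m !addr0. Qed.

Lemma compZr X Y Z c (g : mor Y Z) (f : mor X Y) : g ∘ (c *: f) = c *: (g ∘ f).
Proof. by have := comp_linearr linC g c f 0; rewrite compm0 !addr0. Qed.

Lemma comp_suml X Y Z (I : Type) (r : seq I) (P : pred I)
    (g : I -> mor Y Z) (f : mor X Y) :
  (\sum_(i <- r | P i) g i) ∘ f = \sum_(i <- r | P i) (g i ∘ f).
Proof.
by apply: (big_morph (fun g => g ∘ f)) => [x y|]; rewrite ?compDl ?comp0m.
Qed.

Lemma comp_sumr X Y Z (I : Type) (r : seq I) (P : pred I)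
    (g : mor Y Z) (f : I -> mor X Y) :
  g ∘ (\sum_(i <- r | P i) f i) = \sum_(i <- r | P i) (g ∘ f i).
Proof.
by apply: (big_morph (fun f => g ∘ f)) => [x y|]; rewrite ?compDr ?compm0.
Qed.

Lemma inverse_sym X Y (f : mor X Y) g : inverse_of f g -> inverse_of g f.
Proof. by case. Qed.

Lemma inverse_comp X Y Z (f : mor X Y) f' (g : mor Y Z) g' :
  inverse_of f f' -> inverse_of g g' -> inverse_of (g ∘ f) (f' ∘ g').
Proof.
move=> [f1 f2] [g1 g2]; split.
  by rewrite -compA (compA g') g1 comp1m.
by rewrite -compA (compA f) f2 comp1m.
Qed.

Lemma iso_refl X : isomorphic X X.
Proof. by exists (idmor X), (idmor X); split; rewrite comp1m. Qed.

Lemma iso_sym X Y : isomorphic X Y -> isomorphic Y X.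
Proof. by case=> f [g fg]; exists g, f; apply: inverse_sym. Qed.

Lemma iso_trans X Y Z : isomorphic X Y -> isomorphic Y Z -> isomorphic X Z.
Proof.
move=> [f [f' ff]] [g [g' gg]]; exists (g ∘ f), (f' ∘ g').
exact: inverse_comp.
Qed.

Lemma inv_homP X Y (f : mor X Y) : is_iso f -> inverse_of f (inv_hom f).
Proof.
by move=> [g fg]; rewrite /inv_hom; case: classical_sets.xgetP => [? -> //|/(_ g)].
Qed.

Lemma iso_monoE X Y Z (f : mor Y Z) (g h : mor X Y) :
  is_iso f -> f ∘ g = f ∘ h -> g = h.
Proof.
move=> [f' [f1 _]] /(congr1 (compm f')).
by rewrite !compA f1 !comp1m.
Qed.

Lemma iso_epiE X Y Z (f : mor X Y) (g h : mor Y Z) :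
  is_iso f -> g ∘ f = h ∘ f -> g = h.
Proof.
move=> [f' [_ f1]] /(congr1 (fun x => x ∘ f')).
by rewrite -!compA f1 !compm1.
Qed.

(* Rewriting under a composition that is associated to the right. *)
Lemma tail2 W X Y Y' Z (f : mor Y Z) (g : mor X Y) (f' : mor Y' Z)
    (g' : mor X Y') (h : mor W X) :
  f ∘ g = f' ∘ g' -> f ∘ (g ∘ h) = f' ∘ (g' ∘ h).
Proof. by move=> e; rewrite !compA e. Qed.

Lemma tail1 W X Y Z (f : mor Y Z) (g : mor X Y) (f' : mor X Z) (h : mor W X) :
  f ∘ g = f' -> f ∘ (g ∘ h) = f' ∘ h.
Proof. by move=> e; rewrite !compA e. Qed.

Lemma tail0 W X Y (f : mor Y X) (g : mor X Y) (h : mor W X) :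
  f ∘ g = idmor X -> f ∘ (g ∘ h) = h.
Proof. by move=> e; rewrite !compA e comp1m. Qed.

End LinearTheory.

Fact word_key : unit. Proof. exact: tt. Qed.

Section Monoidal.
Variables (k : fieldType) (C : rigidData k).
Hypotheses (linC : linear_category C) (monC : monoidal_category C).
Implicit Types U V W X Y Z : C.

Local Notation compA := (compA linC).
Local Notation comp1m := (comp1m linC).
Local Notation compm1 := (compm1 linC).

Lemma tens_id X Y : X ◁ (idmor Y) = idmor (X ⊗ Y).
Proof. exact: (tensm_id monC). Qed.

Lemma tens_comp X X' X'' Y Y' Y'' (f : mor X X') (f' : mor X' X'')
    (g : mor Y Y') (g' : mor Y' Y'') :
  (f' ⊠ g') ∘ (f ⊠ g) = (f' ∘ f) ⊠ (g' ∘ g) :> mor (X ⊗ Y) (X'' ⊗ Y'').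
Proof. by rewrite (tensm_comp monC). Qed.

Lemma wlM X Y Y' Y'' (g' : mor Y' Y'') (g : mor Y Y') :
  X ◁ (g' ∘ g) = (X ◁ g') ∘ (X ◁ g).
Proof. by rewrite tens_comp comp1m. Qed.

Lemma wrM X Y Y' Y'' (g' : mor Y' Y'') (g : mor Y Y') :
  (g' ∘ g) ▷ X = (g' ▷ X) ∘ (g ▷ X).
Proof. by rewrite tens_comp comp1m. Qed.

Lemma interchange X X' Y Y' (f : mor X X') (g : mor Y Y') :
  (f ▷ Y') ∘ (X ◁ g) = (X' ◁ g) ∘ (f ▷ Y).
Proof. by rewrite !tens_comp !comp1m !compm1. Qed.

Lemma wlD X Y Z (f g : mor Y Z) : X ◁ (f + g) = X ◁ f + X ◁ g.
Proof. by have := tensm_linearr monC (idmor X) 1 f g; rewrite !scale1r. Qed.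

Lemma wl0 X Y Z : X ◁ (0 : mor Y Z) = 0.
Proof. by apply: (addIr (X ◁ 0)); rewrite add0r -wlD addr0. Qed.

Lemma wlZ X Y Z c (f : mor Y Z) : X ◁ (c *: f) = c *: (X ◁ f).
Proof. by have := tensm_linearr monC (idmor X) c f 0; rewrite wl0 !addr0. Qed.

Lemma wl_sum X Y Z (I : Type) (r : seq I) (P : pred I) (f : I -> mor Y Z) :
  X ◁ (\sum_(i <- r | P i) f i) = \sum_(i <- r | P i) (X ◁ (f i)).
Proof.
by apply: (big_morph (fun f => X ◁ f)) => [x y|]; rewrite ?wlD ?wl0.
Qed.

Lemma wrD X Y Z (f g : mor Y Z) : (f + g) ▷ X = f ▷ X + g ▷ X.
Proof. by have := tensm_linearl monC (idmor X) 1 f g; rewrite !scale1r. Qed.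

Lemma wr0 X Y Z : (0 : mor Y Z) ▷ X = 0.
Proof. by apply: (addIr (0 ▷ X)); rewrite add0r -wrD addr0. Qed.

Lemma wrZ X Y Z c (f : mor Y Z) : (c *: f) ▷ X = c *: (f ▷ X).
Proof. by have := tensm_linearl monC (idmor X) c f 0; rewrite wr0 !addr0. Qed.

Lemma wr_sum X Y Z (I : Type) (r : seq I) (P : pred I) (f : I -> mor Y Z) :
  (\sum_(i <- r | P i) f i) ▷ X = \sum_(i <- r | P i) (f i ▷ X).
Proof.
by apply: (big_morph (fun f => f ▷ X)) => [x y|]; rewrite ?wrD ?wr0.
Qed.

Lemma tens_inverse X X' Y Y' (f : mor X X') f' (g : mor Y Y') g' :
  inverse_of f f' -> inverse_of g g' -> inverse_of (f ⊠ g) (f' ⊠ g').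
Proof.
by move=> [f1 f2] [g1 g2]; split; rewrite tens_comp ?f1 ?f2 ?g1 ?g2 tens_id.
Qed.

Lemma id_inverse X : inverse_of (idmor X) (idmor X).
Proof. by split; rewrite comp1m. Qed.

Lemma tens_iso X X' Y Y' :
  isomorphic X X' -> isomorphic Y Y' -> isomorphic (X ⊗ Y) (X' ⊗ Y').
Proof.
move=> [f [f' ff]] [g [g' gg]]; exists (f ⊠ g), (f' ⊠ g').
exact: tens_inverse.
Qed.

Lemma aK X Y Z : associ X Y Z ∘ assoc X Y Z = idmor _.
Proof. by case: (assocK monC X Y Z). Qed.
Lemma aVK X Y Z : assoc X Y Z ∘ associ X Y Z = idmor _.
Proof. by case: (assocK monC X Y Z). Qed.
Lemma lK X : luniti X ∘ lunit X = idmor _.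
Proof. by case: (lunitK monC X). Qed.
Lemma lVK X : lunit X ∘ luniti X = idmor _.
Proof. by case: (lunitK monC X). Qed.
Lemma rK X : runiti X ∘ runit X = idmor _.
Proof. by case: (runitK monC X). Qed.
Lemma rVK X : runit X ∘ runiti X = idmor _.
Proof. by case: (runitK monC X). Qed.

Lemma a_iso X Y Z : is_iso (assoc X Y Z).
Proof. by exists (associ X Y Z); apply: (assocK monC). Qed.
Lemma l_iso X : is_iso (lunit X).
Proof. by exists (luniti X); apply: (lunitK monC). Qed.
Lemma r_iso X : is_iso (runit X).
Proof. by exists (runiti X); apply: (runitK monC). Qed.

Lemma assoc_iso X Y Z : isomorphic ((X ⊗ Y) ⊗ Z) (X ⊗ (Y ⊗ Z)).
Proof. by exists (assoc X Y Z); apply: a_iso. Qed.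
Lemma lunit_iso X : isomorphic (unit_obj ⊗ X) X.
Proof. by exists (lunit X); apply: l_iso. Qed.
Lemma runit_iso X : isomorphic (X ⊗ unit_obj) X.
Proof. by exists (runit X); apply: r_iso. Qed.

Lemma wl_iso X Y Z (f : mor Y Z) : is_iso f -> is_iso (X ◁ f).
Proof.
by move=> [g fg]; exists (X ◁ g); apply: tens_inverse => //; apply: id_inverse.
Qed.

Lemma wr_iso X Y Z (f : mor Y Z) : is_iso f -> is_iso (f ▷ X).
Proof.
by move=> [g fg]; exists (g ▷ X); apply: tens_inverse => //; apply: id_inverse.
Qed.

Lemma a_nat_l X X' Y Z (f : mor X X') :
  assoc X' Y Z ∘ ((f ▷ Y) ▷ Z) = (f ▷ (Y ⊗ Z)) ∘ assoc X Y Z.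
Proof. by rewrite (assoc_natural monC) tens_id. Qed.

Lemma a_nat_m X Y Y' Z (f : mor Y Y') :
  assoc X Y' Z ∘ ((X ◁ f) ▷ Z) = (X ◁ (f ▷ Z)) ∘ assoc X Y Z.
Proof. exact: (assoc_natural monC). Qed.

Lemma a_nat_r X Y Z Z' (f : mor Z Z') :
  assoc X Y Z' ∘ ((X ⊗ Y) ◁ f) = (X ◁ (Y ◁ f)) ∘ assoc X Y Z.
Proof. by rewrite -tens_id (assoc_natural monC). Qed.

Lemma ai_swap X Y Z X' Y' Z' (f : mor ((X ⊗ Y) ⊗ Z) ((X' ⊗ Y') ⊗ Z'))
    (g : mor (X ⊗ (Y ⊗ Z)) (X' ⊗ (Y' ⊗ Z'))) :
  assoc _ _ _ ∘ f = g ∘ assoc _ _ _ -> associ _ _ _ ∘ g = f ∘ associ _ _ _.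
Proof.
move=> e; apply: (iso_monoE linC (a_iso X' Y' Z')).
by rewrite !compA aVK comp1m e -compA aVK compm1.
Qed.

Lemma ai_nat_l X X' Y Z (f : mor X X') :
  associ X' Y Z ∘ (f ▷ (Y ⊗ Z)) = ((f ▷ Y) ▷ Z) ∘ associ X Y Z.
Proof. exact/ai_swap/a_nat_l. Qed.

Lemma ai_nat_m X Y Y' Z (f : mor Y Y') :
  associ X Y' Z ∘ (X ◁ (f ▷ Z)) = ((X ◁ f) ▷ Z) ∘ associ X Y Z.
Proof. exact/ai_swap/a_nat_m. Qed.

Lemma ai_nat_r X Y Z Z' (f : mor Z Z') :
  associ X Y Z' ∘ (X ◁ (Y ◁ f)) = ((X ⊗ Y) ◁ f) ∘ associ X Y Z.
Proof. exact/ai_swap/a_nat_r. Qed.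

Lemma l_nat X Y (f : mor X Y) : lunit Y ∘ (unit_obj ◁ f) = f ∘ lunit X.
Proof. exact: (lunit_natural monC). Qed.
Lemma r_nat X Y (f : mor X Y) : runit Y ∘ (f ▷ unit_obj) = f ∘ runit X.
Proof. exact: (runit_natural monC). Qed.
Lemma li_nat X Y (f : mor X Y) : luniti Y ∘ f = (unit_obj ◁ f) ∘ luniti X.
Proof.
apply: (iso_monoE linC (l_iso Y)).
by rewrite !compA lVK comp1m l_nat -compA lVK compm1.
Qed.

Lemma wl1_inj X Y (f g : mor X Y) : unit_obj ◁ f = unit_obj ◁ g -> f = g.
Proof.
by move=> e; apply: (iso_epiE linC (l_iso X)); rewrite -!l_nat e.
Qed.

Lemma wr1_inj X Y (f g : mor X Y) : f ▷ unit_obj = g ▷ unit_obj -> f = g.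
Proof.
by move=> e; apply: (iso_epiE linC (r_iso X)); rewrite -!r_nat e.
Qed.

Lemma pentagonE W X Y Z :
  (W ◁ (assoc X Y Z)) ∘ (assoc W (X ⊗ Y) Z ∘ (assoc W X Y ▷ Z))
  = assoc W X (Y ⊗ Z) ∘ assoc (W ⊗ X) Y Z.
Proof. by rewrite compA -(pentagon monC). Qed.

Lemma triangleE X Y :
  (X ◁ (lunit Y)) ∘ assoc X unit_obj Y = runit X ▷ Y.
Proof. exact: (triangle monC). Qed.

(* Kelly: this compatibility of the unit constraint follows from the pentagon
   and the triangle, after tensoring on the left with the unit object. *)
Lemma lunit_tens X Y : lunit (X ⊗ Y) ∘ assoc unit_obj X Y = lunit X ▷ Y.
Proof.
apply: wl1_inj.
have i1 : is_iso (assoc unit_obj (unit_obj ⊗ X) Y ∘ (assoc unit_obj unit_obj X ▷ Y)).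
  have [f ff] := a_iso unit_obj (unit_obj ⊗ X) Y.
  have [g gg] := wr_iso Y (a_iso unit_obj unit_obj X).
  by exists (g ∘ f); apply: inverse_comp.
apply: (iso_epiE linC i1).
rewrite wlM -compA pentagonE compA triangleE -a_nat_l -triangleE wrM.
by rewrite compA a_nat_m compA.
Qed.

Lemma lunit_tensi X Y : assoc unit_obj X Y ∘ (luniti X ▷ Y) = luniti (X ⊗ Y).
Proof.
apply: (iso_monoE linC (l_iso (X ⊗ Y))).
by rewrite compA lunit_tens -wrM !lVK tens_id.
Qed.

Lemma triangle_i X Y :
  assoc X unit_obj Y ∘ (runiti X ▷ Y) = X ◁ (luniti Y).
Proof.
apply: (iso_monoE linC (wl_iso X (l_iso Y))).
by rewrite compA triangleE -wrM -wlM rVK lVK !tens_id.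
Qed.

(* Locking keeps unification from unfolding the operators [cap] and [cup]. *)
Definition cap X Y (p : mor (X ⊗ Y) unit_obj) U : mor (X ⊗ (Y ⊗ U)) U :=
  locked_with word_key (lunit U ⊚ (p ▷ U) ⊚ associ X Y U).
Definition cup X Y (c : mor unit_obj (X ⊗ Y)) U : mor U (X ⊗ (Y ⊗ U)) :=
  locked_with word_key (assoc X Y U ⊚ (c ▷ U) ⊚ luniti U).

Lemma capE X Y (p : mor (X ⊗ Y) unit_obj) U :
  cap p U = lunit U ⊚ (p ▷ U) ⊚ associ X Y U.
Proof. by rewrite /cap unlock. Qed.
Lemma cupE X Y (c : mor unit_obj (X ⊗ Y)) U :
  cup c U = assoc X Y U ⊚ (c ▷ U) ⊚ luniti U.
Proof. by rewrite /cup unlock. Qed.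

Lemma cap_nat X Y (p : mor (X ⊗ Y) unit_obj) U V (f : mor U V) :
  cap p V ∘ (X ◁ (Y ◁ f)) = f ∘ cap p U.
Proof.
by rewrite !capE -!compA ai_nat_r (compA (p ▷ V)) interchange -!compA !compA l_nat.
Qed.

Lemma cup_nat X Y (p : mor unit_obj (X ⊗ Y)) U V (f : mor U V) :
  (X ◁ (Y ◁ f)) ∘ cup p U = cup p V ∘ f.
Proof.
rewrite !cupE -!compA li_nat (compA (p ▷ V)) interchange -!compA.
by rewrite (tail2 linC _ (a_nat_r X Y f)).
Qed.

Lemma cap_wl X Y Y' (p : mor (X ⊗ Y') unit_obj) (f : mor Y Y') U :
  cap (p ∘ (X ◁ f)) U = cap p U ∘ (X ◁ (f ▷ U)).
Proof. by rewrite !capE wrM -!compA ai_nat_m. Qed.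

Lemma cap_wr X X' Y (p : mor (X' ⊗ Y) unit_obj) (f : mor X X') U :
  cap (p ∘ (f ▷ Y)) U = cap p U ∘ (f ▷ (Y ⊗ U)).
Proof. by rewrite !capE wrM -!compA ai_nat_l. Qed.

Lemma cup_wl X Y Y' (c : mor unit_obj (X ⊗ Y)) (f : mor Y Y') U :
  cup ((X ◁ f) ∘ c) U = (X ◁ (f ▷ U)) ∘ cup c U.
Proof. by rewrite !cupE wrM -!compA (tail2 linC _ (a_nat_m _ _ _)). Qed.

Lemma cup_wr X X' Y (c : mor unit_obj (X ⊗ Y)) (f : mor X X') U :
  cup ((f ▷ Y) ∘ c) U = (f ▷ (Y ⊗ U)) ∘ cup c U.
Proof. by rewrite !cupE wrM -!compA (tail2 linC _ (a_nat_l _ _ _)). Qed.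

(** With a trailing [U], a mate is a cup opened to the right of [Z] followed by a cap on [Z ⊗ X];
    the pentagon and the triangle absorb its associators and unit constraints. *)
Lemma mate_lift Z X (p : mor (Z ⊗ X) unit_obj) U :
  mate p ▷ U = cap p (dual X ⊗ U) ∘ (Z ◁ (cup (coev X) U)).
Proof.
rewrite /mate !capE !cupE !wrM -!compA -lunit_tens -!compA.
rewrite (tail2 linC _ (a_nat_l _ _ _)).
congr (_ ∘ (_ ∘ _)).
apply: (iso_monoE linC (a_iso Z X (dual X ⊗ U))).
rewrite (tail0 linC _ (aVK _ _ _)) !wlM -triangle_i.
rewrite -(tail2 linC _ (a_nat_m _ _ _)) compA -pentagonE -!compA.
rewrite (tail0 linC _ (_ : (assoc Z X (dual X) ▷ U) ∘ (associ _ _ _ ▷ U) = _)) //.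
by rewrite -wrM aVK tens_id.
Qed.

(** The mirror image of [mate_lift], in the shape of the other zigzag axiom: a cup is opened to the
    left of [Z], which is then capped off. *)
Lemma comate_lift Z X Y (c : mor unit_obj (X ⊗ Y)) (p : mor (Y ⊗ Z) unit_obj) U :
  (runit X ⊚ (X ◁ p) ⊚ assoc X Y Z ⊚ (c ▷ Z) ⊚ luniti Z) ▷ U
  = (X ◁ (cap p U)) ∘ cup c (Z ⊗ U).
Proof.
rewrite !capE !cupE !wrM -triangleE -!compA.
rewrite (tail2 linC _ (a_nat_m _ _ _)) !wlM -!compA.
congr (_ ∘ (_ ∘ _)).
rewrite -lunit_tensi -(tail2 linC _ (a_nat_l _ _ _)) (compA (assoc X Y _)).
by rewrite -pentagonE -!compA (tail0 linC) // -wlM aK tens_id.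
Qed.

End Monoidal.

(** * Operators on right-bracketed words *)

Section Operators.
Variables (k : fieldType) (C : rigidData k).
Hypotheses (linC : linear_category C) (monC : monoidal_category C).
Implicit Types (U V W X Y Z : C) (l m : seq C).

Local Notation compA := (compA linC).
Local Notation comp1m := (comp1m linC).
Local Notation compm1 := (compm1 linC).

Fixpoint word l U : C := if l is X :: m then X ⊗ word m U else U.

Fixpoint wordm l U V (f : mor U V) : mor (word l U) (word l V) :=
  match l with
  | [::] => f
  | X :: m => X ◁ (wordm m f)
  end.

(** [C] acts from the right on the tail of a word; [op_mod] below says that an operator commutes
    with this action, as a morphism of right [C]-modules does. *)
Fixpoint word_assoc l U V : mor (word l U ⊗ V) (word l (U ⊗ V)) :=
  match l with
  | [::] => idmor _
  | X :: m => (X ◁ (word_assoc m U V)) ∘ assoc X (word m U) V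
  end.

(* A morphism [word l 1 -> word l' 1], presented through its action on all the
   objects [word l U]: these families compose without associators. *)
Record op l l' := Op {
  opf :> forall U, mor (word l U) (word l' U);
  op_nat : forall U V (f : mor U V), opf V ∘ wordm l f = wordm l' f ∘ opf U;
  op_mod : forall U V,
    word_assoc l' U V ∘ (opf U ▷ V) = opf (U ⊗ V) ∘ word_assoc l U V }.

Lemma wordm_iso l U V (f : mor U V) : is_iso f -> is_iso (wordm l f).
Proof. by elim: l => //= X l IH /IH; apply: wl_iso. Qed.

Lemma word_assoc_iso l U V : is_iso (word_assoc l U V).
Proof.
elim: l => [|X l [g gg]] /=; first by exists (idmor _); apply: id_inverse.
have [h hh] := a_iso monC X (word l U) V.
exists (h ∘ (X ◁ g)); apply: inverse_comp => //.
exact: (tens_inverse monC (id_inverse linC _) gg).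
Qed.

(** By naturality along [lunit U] the component at [U] is determined by the one at [unit_obj ⊗ U],
    and by [op_mod] the latter is the component at the unit tensored with [U]. *)
Lemma op_ext l l' (f g : op l l') : f unit_obj = g unit_obj -> forall U, f U = g U.
Proof.
move=> e U; apply: (iso_epiE linC (wordm_iso l (l_iso monC U))).
rewrite !op_nat; congr (_ ∘ _).
apply: (iso_epiE linC (word_assoc_iso l unit_obj U)).
by rewrite -!op_mod e.
Qed.

Program Definition op_comp l1 l2 l3 (g : op l2 l3) (f : op l1 l2) : op l1 l3 :=
  @Op l1 l3 (fun U => g U ∘ f U) _ _.
Next Obligation. by rewrite -compA op_nat !compA op_nat. Qed.
Next Obligation.
by rewrite (wrM linC monC) compA op_mod -!compA op_mod.
Qed.

Program Definition op_wl X l l' (f : op l l') : op (X :: l) (X :: l') :=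
  @Op (X :: l) (X :: l') (fun U => X ◁ (f U)) _ _.
Next Obligation. by rewrite -!(wlM linC monC) op_nat. Qed.
Next Obligation.
rewrite /= -compA (a_nat_m monC) !compA.
by rewrite -!(wlM linC monC) op_mod.
Qed.

Program Definition op_wr X Y l (f : mor X Y) : op (X :: l) (Y :: l) :=
  @Op (X :: l) (Y :: l) (fun U => f ▷ (word l U)) _ _.
Next Obligation. by rewrite /= (interchange linC monC). Qed.
Next Obligation.
rewrite /= -compA (a_nat_l monC) !compA.
by rewrite (interchange linC monC).
Qed.

Program Definition op_assoc X Y l : op (X ⊗ Y :: l) (X :: Y :: l) :=
  @Op (X ⊗ Y :: l) (X :: Y :: l) (fun U => assoc X Y (word l U)) _ _.
Next Obligation. by rewrite /= (a_nat_r monC). Qed.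
Next Obligation.
rewrite /= (wlM linC monC) -!compA (pentagonE linC monC).
by rewrite (tail2 linC _ (a_nat_r monC _ _ _)).
Qed.

Program Definition op_associ X Y l : op (X :: Y :: l) (X ⊗ Y :: l) :=
  @Op (X :: Y :: l) (X ⊗ Y :: l) (fun U => associ X Y (word l U)) _ _.
Next Obligation. by rewrite /= (ai_nat_r linC monC). Qed.
Next Obligation.
apply: (iso_monoE linC (a_iso monC X Y _)).
rewrite [RHS]compA (aVK monC) comp1m compA.
have /= <- := op_mod (op_assoc X Y l) U V.
by rewrite -compA -(wrM linC monC) (aVK monC) (tensm_id monC) compm1.
Qed.

Program Definition op_lunit l : op (unit_obj :: l) l :=
  @Op (unit_obj :: l) l (fun U => lunit (word l U)) _ _.
Next Obligation. by rewrite /= (l_nat monC). Qed.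
Next Obligation.
by rewrite /= compA (l_nat monC) -compA (lunit_tens linC monC).
Qed.

Program Definition op_luniti l : op l (unit_obj :: l) :=
  @Op l (unit_obj :: l) (fun U => luniti (word l U)) _ _.
Next Obligation. by rewrite /= (li_nat linC monC). Qed.
Next Obligation.
by rewrite /= -compA (lunit_tensi linC monC) (li_nat linC monC).
Qed.

Definition op_cap X Y (p : mor (X ⊗ Y) unit_obj) l : op (X :: Y :: l) l :=
  op_comp (op_lunit l) (op_comp (op_wr l p) (op_associ X Y l)).
Definition op_cup X Y (c : mor unit_obj (X ⊗ Y)) l : op l (X :: Y :: l) :=
  op_comp (op_assoc X Y l) (op_comp (op_wr l c) (op_luniti l)).

Lemma op_capE X Y (p : mor (X ⊗ Y) unit_obj) l U :
  op_cap p l U = cap p (word l U).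
Proof. by rewrite capE. Qed.

Lemma op_cupE X Y (c : mor unit_obj (X ⊗ Y)) l U :
  op_cup c l U = cup c (word l U).
Proof. by rewrite cupE. Qed.

(** Turns an operator on one letter back into a morphism, so that Schur's lemma applies to diagrams
    with a trailing object. *)
Lemma op_rep X Y (f : op [:: X] [:: Y]) :
  exists g : mor X Y, forall U, f U = g ▷ U.
Proof.
exists (runit Y ⊚ f unit_obj ⊚ runiti X).
apply: (@op_ext _ _ f (op_wr [::] _)) => /=.
apply: (iso_monoE linC (r_iso monC Y)).
by rewrite (r_nat monC) -!compA (rK monC) compm1.
Qed.

End Operators.

(** * Schur's lemma *)

Section Schur.
Variables (k : closedFieldType) (C : catData k).
Hypotheses (linC : linear_category C) (abC : abelian_category C).
Implicit Types X Y Z : C.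

Lemma is_zero_comp X Y (f : mor X Y) : is_zero X -> f = 0.
Proof. by move=> X0; rewrite -(compm1 linC f) X0 compm0. Qed.

(** Simplicity is applied twice: to the kernel of [f], which must vanish, and then to [f] itself as
    a subobject of [Y]. *)
Lemma schur_iso X Y (f : mor X Y) :
  simple_object X -> simple_object Y -> f != 0 -> is_iso f.
Proof.
move=> [X0 sX] [Y0 sY] f0.
have [K [i [fi iP]]] := has_kernels abC f.
have mi : is_mono i.
  move=> W g h e; have [|u [_ uP]] := iP W (i ∘ g).
    by rewrite (compA linC) fi comp0m.
  by rewrite -(uP g erefl); apply: uP.
case: (sX K i mi) => [K0|[j [_ ij]]]; last first.
  by case/eqP: f0; rewrite -(compm1 linC f) -ij (compA linC) fi comp0m.
have mf : is_mono f.
  move=> W g h e; apply/eqP; rewrite -subr_eq0; apply/eqP.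
  have [|u [<- _]] := iP W (g - h); last first.
    by rewrite -(comp1m linC u) K0 comp0m // compm0.
  by rewrite -scaleN1r compDr // compZr // e scaleN1r subrr.
case: (sY X f mf) => // X1; by case: X0.
Qed.

Lemma schur_zero X Y (f : mor X Y) :
  simple_object X -> simple_object Y -> ~ isomorphic X Y -> f = 0.
Proof.
move=> sX sY nXY; apply/eqP/negPn/negP => f0; apply: nXY; exists f.
exact: schur_iso.
Qed.

(** Composition with [f] is an endomorphism of the finite-dimensional space End(X). An eigenvector
    [g] is a nonzero endomorphism, hence invertible, and f g = a g forces f = a. *)
Lemma schur_scalar X (f : mor X X) : simple_object X -> exists c, f = c *: idmor X.
Proof.
move=> sX; case: (sX) => X0 _.
pose V := mor X X; pose n := dim V.
pose L (u : 'rV[k]_n) : 'rV[k]_n := v2r (f ∘ (@r2v k V u)).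
have linL : linear L.
  by move=> a u v; rewrite /L !linearP compDr // compZr // linearP.
pose Llin := GRing.isLinear.Build k _ _ _ L linL.
pose LL : {linear 'rV[k]_n -> 'rV[k]_n} := HB.pack L Llin.
have n0 : (0 < n)%N.
  rewrite lt0n; apply/negP => /eqP n0; apply: X0.
  apply: (can_inj (@v2rK k V)); apply/rowP => i.
  by have := leq_ltn_trans (leq0n i) (ltn_ord i); rewrite -[X in (_ < X)%N]/n n0.
pose M := lin1_mx LL.
have [a ra] : exists a, root (char_poly M) a.
  apply/closed_rootP; rewrite size_char_poly.
  by case: (n) n0.
rewrite -eigenvalue_root_char in ra; case/eigenvalueP: ra => v vM v0.
exists a; pose g : mor X X := @r2v k V v.
have fg : (f - a *: idmor X) ∘ g = 0.
  rewrite compDl // -scaleNr compZl // comp1m // scaleNr.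
  apply/eqP; rewrite subr_eq0; apply/eqP; apply: (can_inj (@v2rK k V)).
  by rewrite linearZ /= /g r2vK -vM mul_rV_lin1 /= /L.
have g0 : g != 0.
  apply: contraNneq v0 => g0.
   by have := @r2vK k V v; rewrite -/V (g0 : @r2v k V v = 0) linear0 => <-.
have ig := schur_iso sX sX g0.
apply/eqP; rewrite -subr_eq0; apply/eqP.
by apply: (iso_epiE linC ig); rewrite fg comp0m.
Qed.

End Schur.

(** * Zigzag identities on words *)

Section RigidWords.
Variables (k : fieldType) (C : rigidData k).
Hypotheses (linC : linear_category C) (monC : monoidal_category C).
Hypothesis rigC : rigid_category C.
Implicit Types U V W X Y Z : C.

Local Notation compA := (compA linC).
Local Notation comp1m := (comp1m linC).
Local Notation compm1 := (compm1 linC).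
Local Notation wlM := (wlM linC monC).
Local Notation wrM := (wrM linC monC).
Local Notation interchange := (interchange linC monC).

Local Notation evw X U := (cap (ev X) U).
Local Notation coevw X U := (cup (coev X) U).

Lemma zig X U : (X ◁ (evw X U)) ∘ coevw X (X ⊗ U) = idmor (X ⊗ U).
Proof.
rewrite -(comate_lift linC monC) -(tensm_id monC).
congr (_ ▷ _); rewrite -[RHS](zigzag_obj rigC).
by rewrite !compA.
Qed.

Lemma zag X U : evw X (dual X ⊗ U) ∘ (dual X ◁ (coevw X U)) = idmor (dual X ⊗ U).
Proof.
by rewrite -(mate_lift linC monC) -(tensm_id monC) /mate (zigzag_dual rigC).
Qed.

Lemma mate_cap Z X (p : mor (Z ⊗ X) unit_obj) U :
  evw X U ∘ (mate p ▷ (X ⊗ U)) = cap p U.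
Proof.
rewrite (mate_lift linC monC) compA -(cap_nat linC monC) -compA -wlM.
by rewrite zig (tensm_id monC) compm1.
Qed.

Lemma evw_dual X Y (f : mor X Y) U :
  evw Y U ∘ (dual Y ◁ (f ▷ U)) = evw X U ∘ (dualm f ▷ (X ⊗ U)).
Proof. by rewrite mate_cap (cap_wl linC monC). Qed.

Lemma coevw_dual X Y (f : mor X Y) U :
  (f ▷ (dual X ⊗ U)) ∘ coevw X U = (Y ◁ (dualm f ▷ U)) ∘ coevw Y U.
Proof.
rewrite (mate_lift linC monC) wlM -compA.
rewrite (cup_nat linC monC) (cap_wl linC monC) wlM -!compA.
rewrite (tail2 linC _ (cup_nat linC monC _ _)).
by rewrite (tail0 linC _ (zig _ _)).
Qed.

End RigidWords.

(** * Traces and dimensions *)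

Section Pivotal.
Variables (k : closedFieldType) (C : pivotalData k).
Hypothesis fusC : braided_pivotal_fusion C.
Implicit Types U V W X Y Z : C.

Local Notation linC := (fusion_linear fusC).
Local Notation monC := (fusion_monoidal fusC).
Local Notation rigC := (fusion_rigid fusC).
Local Notation pivC := (fusion_pivotal fusC).
Local Notation one := (unit_obj : C).
Local Notation compA := (compA linC).
Local Notation comp1m := (comp1m linC).
Local Notation compm1 := (compm1 linC).
Local Notation wlM := (wlM linC monC).
Local Notation wrM := (wrM linC monC).
Local Notation interchange := (interchange linC monC).
Local Notation compDl := (compDl linC).
Local Notation compDr := (compDr linC).
Local Notation compZl := (compZl linC).
Local Notation compZr := (compZr linC).
Local Notation tail0 := (tail0 linC).
Local Notation tail1 := (tail1 linC).
Local Notation tail2 := (tail2 linC).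
Local Notation cap_nat := (cap_nat linC monC).
Local Notation cup_nat := (cup_nat linC monC).
Local Notation tens_id := (tensm_id monC).
Local Notation zig := (zig linC monC rigC).
Local Notation zag := (zag linC monC rigC).

Lemma unit_neq0 : idmor one != 0.
Proof. by apply/eqP; case: (fusion_unit fusC). Qed.

Lemma scalar_ofZ c : scalar_of (c *: idmor one) = c.
Proof.
rewrite /scalar_of linearZ /=.
have fr : free [tuple idmor one] by rewrite seq1_free unit_neq0.
by have := coord_free ord0 ord0 fr; rewrite /= => ->; apply: mulr1.
Qed.

Lemma scalar_ofP (f : mor one one) : f = scalar_of f *: idmor one.
Proof.
have [c ->] := schur_scalar linC (fusion_abelian fusC) f (fusion_unit fusC).
by rewrite scalar_ofZ.
Qed.

Lemma scale_idI c d : c *: idmor one = d *: idmor one -> c = d.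
Proof. by move=> /(congr1 (fun f : mor one one => scalar_of f)); rewrite !scalar_ofZ. Qed.

Lemma cap_cup X Y (p : mor (X ⊗ Y) one) (c : mor one (X ⊗ Y)) U :
  cap p U ∘ cup c U = scalar_of (p ∘ c) *: idmor U.
Proof.
rewrite capE cupE -!compA (tail0 _ (aK monC _ _ _)).
rewrite (compA (p ▷ U)) -wrM {1}[p ∘ c]scalar_ofP (wrZ monC).
by rewrite tens_id compZl compZr comp1m (lVK monC).
Qed.

(** The pivotal structure makes [dual X] a dual of [X] on the other side as well; [evR] and [coevR]
    are the evaluation and coevaluation of that duality, and [zigR], [zagR] its zigzags. *)
Definition evR X : mor (X ⊗ dual X) one := ev (dual X) ∘ (piv X ▷ dual X).
Definition coevR X : mor one (dual X ⊗ X) :=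
  (dual X ◁ (inv_hom (piv X))) ∘ coev (dual X).

Lemma piv_inverse X : inverse_of (piv X) (inv_hom (piv X)).
Proof. exact/inv_homP/(piv_iso pivC). Qed.

Lemma pivK X : inv_hom (piv X) ∘ piv X = idmor X.
Proof. by case: (piv_inverse X). Qed.

Lemma pivVK X : piv X ∘ inv_hom (piv X) = idmor _.
Proof. by case: (piv_inverse X). Qed.

Lemma capRE X U : cap (evR X) U = cap (ev (dual X)) U ∘ (piv X ▷ (dual X ⊗ U)).
Proof. by rewrite (cap_wr linC monC). Qed.

Lemma cupRE X U :
  cup (coevR X) U = (dual X ◁ (inv_hom (piv X) ▷ U)) ∘ cup (coev (dual X)) U.
Proof. by rewrite (cup_wl linC monC). Qed.

Lemma zigR X U :
  (dual X ◁ (cap (evR X) U)) ∘ cup (coevR X) (dual X ⊗ U) = idmor (dual X ⊗ U).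
Proof.
rewrite capRE cupRE wlM -!compA (compA (dual X ◁ (piv X ▷ _))) -wlM -wrM pivVK.
by rewrite tens_id tens_id comp1m zig.
Qed.

Lemma zagR X U : cap (evR X) (X ⊗ U) ∘ (X ◁ (cup (coevR X) U)) = idmor (X ⊗ U).
Proof.
rewrite capRE cupRE wlM -!compA (tail2 _ (interchange _ _)) interchange.
rewrite (tail2 _ (cap_nat _ _)) (tail0 _ (zag _ _)) -wrM pivK.
exact: tens_id.
Qed.

Lemma capR_dual X Y (f : mor X Y) U :
  cap (evR Y) U ∘ (f ▷ (dual Y ⊗ U)) = cap (evR X) U ∘ (X ◁ (dualm f ▷ U)).
Proof.
rewrite !capRE -!compA -wrM (piv_natural pivC) wrM compA.
by rewrite -(evw_dual linC monC rigC) -!compA interchange.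
Qed.

Lemma traceR_word X (f : mor X X) U :
  cap (evR X) U ⊚ (f ▷ (dual X ⊗ U)) ⊚ cup (coev X) U = traceR f *: idmor U.
Proof.
rewrite -(cup_wr linC monC) cap_cup /traceR /evR wrM.
by rewrite !compA.
Qed.

Lemma traceL_word X (f : mor X X) U :
  cap (ev X) U ⊚ (dual X ◁ (f ▷ U)) ⊚ cup (coevR X) U = traceL f *: idmor U.
Proof.
rewrite -(cup_wl linC monC) cap_cup /traceL /coevR.
by rewrite !compA -(compA (ev X)) -wlM.
Qed.

Lemma dimR_word X U : cap (evR X) U ∘ cup (coev X) U = dimR X *: idmor U.
Proof. by rewrite -traceR_word tens_id comp1m. Qed.

Lemma dimL_word X U : cap (ev X) U ∘ cup (coevR X) U = dimL X *: idmor U.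
Proof. by rewrite -traceL_word !tens_id comp1m. Qed.

(** The morphism [g] travels around the loop: through the cap it becomes its dual, and through the
    cup it comes back on the other side of [f]. *)
Lemma traceRC X Y (f : mor X Y) (g : mor Y X) : traceR (g ∘ f) = traceR (f ∘ g).
Proof.
apply: scale_idI; rewrite -!traceR_word !wrM -!compA.
rewrite (tail2 _ (capR_dual g _)) -(tail2 _ (interchange _ _)).
by rewrite (coevw_dual linC monC rigC).
Qed.

Lemma traceR_linear X c (f g : mor X X) :
  traceR (c *: f + g) = c * traceR f + traceR g.
Proof.
apply: scale_idI; rewrite -traceR_word.
rewrite (wrD monC) (wrZ monC) compDl compDr compZl compZr.
by rewrite !traceR_word scalerA -scalerDl.
Qed.

Lemma traceR0 X : traceR (0 : mor X X) = 0.
Proof.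
apply: scale_idI; rewrite -traceR_word (wr0 monC) (comp0m linC) (compm0 linC).
by rewrite scale0r.
Qed.

Lemma traceRZ X c (f : mor X X) : traceR (c *: f) = c * traceR f.
Proof. by rewrite -[c *: f]addr0 traceR_linear traceR0 addr0. Qed.

Lemma traceR_sum X (I : Type) (r : seq I) (P : pred I) (f : I -> mor X X) :
  traceR (\sum_(i <- r | P i) f i) = \sum_(i <- r | P i) traceR (f i).
Proof.
apply: (big_morph _ _ (traceR0 X)) => f1 f2.
by rewrite -[f1]scale1r traceR_linear mul1r scale1r.
Qed.

Lemma cap_assoc A B D (r : mor (A ⊗ (B ⊗ D)) one) U :
  cap (r ∘ assoc A B D) U
  = cap r U ⊚ (A ◁ (associ B D U)) ⊚ assoc A B (D ⊗ U).
Proof.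
rewrite !capE wrM -!compA; congr (_ ∘ (_ ∘ _)).
apply: (iso_monoE linC (a_iso monC _ _ _)).
rewrite (tail0 _ (aVK monC _ _ _)).
apply: (iso_monoE linC (wl_iso linC monC A (a_iso monC B D U))).
rewrite (compA _ (A ◁ _)) -wlM (aVK monC) tens_id comp1m.
rewrite (compA (assoc A _ _)) (compA (A ◁ _)) (pentagonE linC monC) -compA.
by rewrite (aVK monC) compm1.
Qed.

Lemma ev_tens X Y U :
  cap (ev (X ⊗ Y)) U ∘ (dual_tens X Y ▷ ((X ⊗ Y) ⊗ U))
  = cap (ev Y) U ⊚ (dual Y ◁ (cap (ev X) (Y ⊗ U)))
    ⊚ (dual Y ◁ (dual X ◁ (assoc X Y U))) ⊚ assoc (dual Y) (dual X) ((X ⊗ Y) ⊗ U).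
Proof.
rewrite (mate_cap linC monC rigC) cap_assoc (cap_wl linC monC) -!compA.
congr (_ ∘ _); rewrite !(compA _ _ (assoc _ _ _)); congr (_ ∘ _).
rewrite -!wlM; congr (_ ◁ _).
rewrite -capE.
have := op_mod (op_cap linC monC (ev X) [::]) Y U.
rewrite !op_capE /= tens_id !comp1m => ->.
by rewrite -!compA (aVK monC) compm1.
Qed.

Definition dtens X Y U : mor (dual Y ⊗ (dual X ⊗ U)) (dual (X ⊗ Y) ⊗ U) :=
  (dual_tens X Y ▷ U) ∘ associ (dual Y) (dual X) U.

(** No axiom relates [coev (X ⊗ Y)] to [coev X] and [coev Y]. But [dual_tens] is a mate and so
    contains [coev (X ⊗ Y)]; the zigzags of [Y] and [X] cancel everything else on the right. *)
Lemma coev_tens X Y U :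
  cup (coev (X ⊗ Y)) U
  = ((X ⊗ Y) ◁ (dtens X Y U)) ⊚ associ X Y (dual Y ⊗ (dual X ⊗ U))
    ⊚ (X ◁ (cup (coev Y) (dual X ⊗ U))) ⊚ cup (coev X) U.
Proof.
apply: (iso_monoE linC (a_iso monC _ _ _)).
set D := dual (X ⊗ Y).
pose c := assoc X Y (D ⊗ U) ∘ cup (coev (X ⊗ Y)) U.
rewrite (tail2 _ (a_nat_r monC _ _ _)) (tail0 _ (aVK monC _ _ _)) -/c.
have -> : dtens X Y U = cap (ev Y) (D ⊗ U) ⊚
    (dual Y ◁ (cap (ev X) (Y ⊗ (D ⊗ U)) ∘ (dual X ◁ c))).
  rewrite /dtens (mate_lift linC monC) -(mate_cap linC monC rigC).
  rewrite ev_tens /c -!compA; congr (_ ∘ _).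
  rewrite !wlM; congr (_ ∘ (_ ∘ _)).
  by rewrite (tail2 _ (a_nat_r monC _ _ _)) (aVK monC) compm1.
rewrite (compA (X ◁ _)) -wlM (wlM Y) -(compA (Y ◁ _)) cup_nat compA zig comp1m.
by rewrite wlM -compA cup_nat compA zig comp1m.
Qed.

(** The monoidality of the pivotal structure enters here: [piv_tens] splits [piv (X ⊗ Y)] into the
    two factors that turn the nested [ev] caps into [evR] caps. *)
Lemma evR_tens X Y U :
  cap (evR (X ⊗ Y)) U ∘ ((X ⊗ Y) ◁ (dtens X Y U))
  = cap (evR X) U ⊚ (X ◁ (cap (evR Y) (dual X ⊗ U)))
    ⊚ assoc X Y (dual Y ⊗ (dual X ⊗ U)).
Proof.
rewrite /dtens wlM compA capRE -(compA (cap _ _)) interchange compA.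
rewrite (evw_dual linC monC rigC) -!compA (compA (_ ▷ _)) -wrM (piv_tens pivC).
rewrite wrM -compA (tail1 _ (ev_tens _ _ _)) -!compA.
rewrite (tail2 _ (assoc_natural monC _ _ _)) (a_nat_r monC).
rewrite [in RHS]capRE -[in RHS]compA; congr (_ ∘ _).
rewrite !compA; congr (_ ∘ _).
rewrite !(tens_comp monC) !comp1m compm1; congr (_ ⊠ _).
by rewrite -!compA !(tens_comp monC) !comp1m compm1 (aVK monC) -capRE.
Qed.

(** The trace over a tensor product is a pair of nested loops: the comparison [dtens] coming from
    the cup slides past [f] and is absorbed by the cap. *)
Lemma traceR_tens X Y (f : mor (X ⊗ Y) (X ⊗ Y)) U :
  cap (evR X) U ⊚ (X ◁ (cap (evR Y) (dual X ⊗ U))) ⊚ assoc X Y _ ⊚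
    (f ▷ (dual Y ⊗ (dual X ⊗ U))) ⊚ associ X Y _ ⊚
    (X ◁ (cup (coev Y) (dual X ⊗ U))) ⊚ cup (coev X) U
  = traceR f *: idmor U.
Proof.
rewrite -traceR_word coev_tens (tail2 _ (interchange f _)).
by rewrite (tail1 _ (evR_tens _ _ _)) -!compA.
Qed.

Lemma dimR_tens X Y : dimR (X ⊗ Y) = dimR X * dimR Y.
Proof.
apply: scale_idI; rewrite -traceR_tens tens_id comp1m.
rewrite (tail0 _ (aVK monC _ _ _)) (compA (X ◁ _)) -wlM dimR_word.
by rewrite (wlZ monC) tens_id compZl compZr comp1m dimR_word scalerA mulrC.
Qed.

Lemma traceR_conj X Y (f : mor X Y) g (h : mor Y Y) : inverse_of f g ->
  traceR (g ⊚ h ⊚ f) = traceR h.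
Proof.
by move=> [_ fg]; rewrite traceRC -compA fg compm1.
Qed.

Lemma dimR_iso X Y : isomorphic X Y -> dimR X = dimR Y.
Proof.
move=> [f [g fg]]; rewrite /dimR -(traceR_conj (idmor Y) fg).
by rewrite comp1m; case: fg => ->.
Qed.

Lemma evR_neq0 X : simple_object X -> evR X != 0.
Proof.
move=> [X0 _]; apply/eqP => e; apply: X0.
have := zagR X one; rewrite capE e (wr0 monC) (comp0m linC) (compm0 linC) (comp0m linC) => X0.
by apply: (wr1_inj linC monC); rewrite tens_id -X0 (wr0 monC).
Qed.

(** Some simple summand of X ⊗ X^* is not killed by [evR X]; it is then a copy of the unit, and
    provides a section [s] of [evR X]. By duality [s] corresponds to an endomorphism of [X], a
    scalar [c], so s = c coev and c dim^R(X) = 1. *)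
Lemma dimR_neq0 X : simple_object X -> dimR X != 0.
Proof.
move=> sX; have [n [S [sS [i [p [_ _ ip]]]]]] := fusion_semisimple fusC (X ⊗ dual X).
have [j ej] : exists j, evR X ∘ i j != 0.
  apply: contrapT => nj; have /eqP := evR_neq0 sX; apply.
  rewrite -(compm1 (evR X)) -ip (comp_sumr linC) big1 // => j _.
  rewrite compA; case: (eqVneq (evR X ∘ i j) 0) => [->|nz]; first exact: (comp0m linC).
  by case: nj; exists j.
have [g [_ g2]] := schur_iso linC (fusion_abelian fusC) (sS j) (fusion_unit fusC) ej.
pose s := i j ∘ g.
have es : evR X ∘ s = idmor one by rewrite /s compA.
have [c ec] : exists c,
    runit X ⊚ (X ◁ (ev X)) ⊚ assoc X (dual X) X ⊚ (s ▷ X) ⊚ luniti X = c *: idmor X.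
  exact: (schur_scalar linC (fusion_abelian fusC) _ sX).
have sE : cup s one = c *: cup (coev X) one.
  have := comate_lift linC monC s (ev X) (dual X ⊗ one); rewrite ec (wrZ monC) tens_id.
  move=> /(congr1 (fun f => f ∘ cup (coev X) one)); rewrite compZl comp1m => ->.
  by rewrite -compA -cup_nat compA -wlM zag tens_id comp1m.
have := cap_cup (evR X) s one; rewrite es sE compZr dimR_word.
rewrite -[idmor one in X in scalar_of X]scale1r scalar_ofZ scalerA => /scale_idI e.
by apply/eqP => d0; move/eqP: e; rewrite d0 mulr0 eq_sym oner_eq0.
Qed.

Lemma dimR_unit : dimR one = 1.
Proof.
apply: (mulIf (dimR_neq0 (fusion_unit fusC))).
by rewrite -dimR_tens mul1r; apply: dimR_iso; apply: (lunit_iso monC).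
Qed.

Lemma traceR_unit (f : mor one one) : traceR f = scalar_of f.
Proof. by rewrite {1}[f]scalar_ofP traceRZ -/(dimR one) dimR_unit mulr1. Qed.

(* Left and right dimensions are compared through the endomorphism
   [coevR X ∘ ev X] of [X^* ⊗ X], which straightens under the right trace. *)
Lemma dimR_dual X : dimR (dual X) = dimL X.
Proof.
have := traceRC (ev X) (coevR X); rewrite traceR_unit.
have := dimL_word X one; rewrite cap_cup => /scale_idI -> <-.
apply/esym/scale_idI; rewrite -traceR_tens -dimR_word.
set W := dual X ⊗ (dual (dual X) ⊗ one).
have E : assoc (dual X) X W ∘ ((coevR X ∘ ev X) ▷ W) ∘ associ (dual X) X W
         = cup (coevR X) W ∘ cap (ev X) W.
  by rewrite cupE capE wrM -!compA (tail0 _ (lK monC _)).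
rewrite [X in _ ∘ (_ ∘ X) = _](_ : _ = cup (coevR X) W ∘ cup (coev (dual X)) one).
  by rewrite (tail0 _ (zigR _ _)).
rewrite !compA E -!compA; congr (_ ∘ _).
by rewrite compA zag comp1m.
Qed.

End Pivotal.

Fact bw_key : unit. Proof. exact: tt. Qed.

(** * Braiding and monodromy *)

Section Braid.
Variables (k : closedFieldType) (C : pivotalData k).
Hypothesis fusC : braided_pivotal_fusion C.
Implicit Types U V W X Y Z : C.

Local Notation linC := (fusion_linear fusC).
Local Notation monC := (fusion_monoidal fusC).
Local Notation braC := (fusion_braided fusC).
Local Notation one := (unit_obj : C).
Local Notation compA := (compA linC).
Local Notation comp1m := (comp1m linC).
Local Notation compm1 := (compm1 linC).
Local Notation wlM := (wlM linC monC).
Local Notation wrM := (wrM linC monC).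
Local Notation compZl := (compZl linC).
Local Notation compZr := (compZr linC).
Local Notation tail0 := (tail0 linC).
Local Notation tail1 := (tail1 linC).
Local Notation tail2 := (tail2 linC).
Local Notation tens_id := (tensm_id monC).

Local Notation a_nat_l := (a_nat_l monC).
Local Notation a_nat_m := (a_nat_m monC).
Local Notation lunit_tens := (lunit_tens linC monC).
Local Notation pentagonE := (pentagonE linC monC).
Local Notation aK := (aK monC).
Local Notation aVK := (aVK monC).

Definition bw X Y U : mor (X ⊗ (Y ⊗ U)) (Y ⊗ (X ⊗ U)) :=
  locked_with bw_key (assoc Y X U ⊚ (braid X Y ▷ U) ⊚ associ X Y U).

Lemma bwE X Y U : bw X Y U = assoc Y X U ⊚ (braid X Y ▷ U) ⊚ associ X Y U.
Proof. by rewrite /bw unlock. Qed.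

Definition op_bw X Y l : op (X :: Y :: l) (Y :: X :: l) :=
  op_comp linC monC (op_assoc linC monC Y X l)
    (op_comp linC monC (op_wr linC monC (Y := Y ⊗ X) l (braid X Y))
       (op_associ linC monC X Y l)).

Lemma op_bwE X Y l U : op_bw X Y l U = bw X Y (word l U).
Proof. by rewrite bwE. Qed.

Lemma bw_iso X Y U : is_iso (bw X Y U).
Proof.
rewrite bwE; have [f ff] := wr_iso linC monC U (braid_iso braC X Y).
exists ((assoc X Y U ∘ f) ∘ associ Y X U).
apply: (inverse_comp linC); last exact: (assocK monC).
apply: (inverse_comp linC) => //; exact/inverse_sym/(assocK monC).
Qed.

Lemma bw_nat X Y U V (f : mor U V) :
  bw X Y V ∘ (X ◁ (Y ◁ f)) = (Y ◁ (X ◁ f)) ∘ bw X Y U.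
Proof. by have := op_nat (op_bw X Y [::]) f; rewrite !op_bwE. Qed.

Lemma bw_natl X X' Y U (f : mor X X') :
  bw X' Y U ∘ (f ▷ (Y ⊗ U)) = (Y ◁ (f ▷ U)) ∘ bw X Y U.
Proof.
rewrite !bwE -!compA (ai_nat_l linC monC) (compA (_ ▷ U)) -wrM.
by rewrite (braid_natural braC) wrM -!compA (tail2 _ (a_nat_m _ _ _)).
Qed.

Lemma bw_natr X Y Y' U (f : mor Y Y') :
  bw X Y' U ∘ (X ◁ (f ▷ U)) = (f ▷ (X ⊗ U)) ∘ bw X Y U.
Proof.
rewrite !bwE -!compA (ai_nat_m linC monC) (compA (_ ▷ U)) -wrM.
by rewrite (braid_natural braC) wrM -!compA (tail2 _ (a_nat_l _ _ _)).
Qed.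

(** The hexagon in word form; only the associator that splits [Y ⊗ Z] survives. *)
Lemma bw_tensr X Y Z U :
  assoc Y Z (X ⊗ U) ∘ bw X (Y ⊗ Z) U
  = (Y ◁ (bw X Z U)) ⊚ bw X Y (Z ⊗ U) ⊚ (X ◁ (assoc Y Z U)).
Proof.
have [f ff] := a_iso monC X (Y ⊗ Z) U.
have [g gg] := wr_iso linC monC U (a_iso monC X Y Z).
apply: (iso_epiE linC (f := assoc X (Y ⊗ Z) U ∘ (assoc X Y Z ▷ U))).
  by exists (g ∘ f); apply: (inverse_comp linC).
rewrite !bwE -!compA (tail0 _ (aK _ _ _)) pentagonE (tail0 _ (aK _ _ _)).
rewrite -(a_nat_l _ _ (braid X Y)) (compA (assoc _ _ (Z ⊗ U))) -pentagonE -!compA.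
rewrite (compA (assoc Y Z _)) -pentagonE !wlM -!compA.
rewrite [in RHS](tail0 (f := Y ◁ (associ X Z U)) (g := Y ◁ (assoc X Z U))); last first.
  by rewrite -wlM aK tens_id.
rewrite -(tail2 _ (a_nat_m _ _ (braid X Z))) -!wrM; congr (_ ∘ (_ ∘ (_ ▷ _))).
by rewrite !compA (hexagon_r braC) -!compA.
Qed.

Lemma bw_tensl X Y Z U :
  (Z ◁ (assoc X Y U)) ∘ bw (X ⊗ Y) Z U
  = bw X Z (Y ⊗ U) ⊚ (X ◁ (bw Y Z U)) ⊚ assoc X Y (Z ⊗ U).
Proof.
have pV V W1 W2 : assoc V W1 (W2 ⊗ U) ∘ (assoc (V ⊗ W1) W2 U ∘ (associ V W1 W2 ▷ U))
    = (V ◁ (assoc W1 W2 U)) ∘ assoc V (W1 ⊗ W2) U.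
  by rewrite compA -pentagonE -!compA -wrM aVK tens_id compm1.
have [f ff] := a_iso monC (X ⊗ Y) Z U.
have [g gg] := wr_iso linC monC U (a_iso monC X Y Z).
apply: (iso_epiE linC (f := assoc (X ⊗ Y) Z U ∘ (associ X Y Z ▷ U))).
  exists ((assoc X Y Z ▷ U) ∘ f); apply: (inverse_comp linC) => //.
  by split; rewrite -wrM ?aK ?aVK tens_id.
rewrite !bwE -!compA (tail0 _ (aK _ _ _)) pV -wrM.
have -> : braid (X ⊗ Y) Z ∘ associ X Y Z
    = assoc Z X Y ⊚ (braid X Z ▷ Y) ⊚ associ X Z Y ⊚ (X ◁ (braid Y Z)).
  apply: (iso_monoE linC (f := associ Z X Y)).
    by exists (assoc Z X Y); apply/inverse_sym/(assocK monC).
  by rewrite (tail0 _ (aK _ _ _)) compA (hexagon_l braC) -!compA.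
rewrite !wrM (compA (assoc Z _ _)) (compA (Z ◁ _)) pentagonE -!compA.
rewrite (tail2 _ (a_nat_l _ _ (braid X Z))); congr (_ ∘ (_ ∘ _)).
rewrite !wlM -!compA (tail0 (f := X ◁ (associ Y Z U)) (g := X ◁ (assoc Y Z U))).
  rewrite -a_nat_m (compA (X ◁ _)) -pV -!compA.
  by rewrite (tail0 _ (aK _ _ _)).
by rewrite -wlM aK tens_id.
Qed.

(** Crossing 1 ⊗ 1 amounts both to crossing the unit once, by naturality along [lunit], and to
    crossing it twice, by the hexagon. One of the invertible crossings cancels. *)
Lemma bw_unitr X U : lunit (X ⊗ U) ∘ bw X one U = X ◁ (lunit U).
Proof.
have e1 : lunit (X ⊗ (one ⊗ U)) ∘ bw X one (one ⊗ U) = X ◁ (lunit (one ⊗ U)).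
  apply: (iso_monoE linC (bw_iso X one U)).
  apply: (iso_epiE linC (wl_iso linC monC X (a_iso monC one one U))).
  rewrite -!compA -wlM lunit_tens bw_natr -lunit_tens -compA bw_tensr.
  by rewrite (tail2 _ (esym (l_nat monC _))).
apply: (iso_epiE linC (wl_iso linC monC X (wl_iso linC monC one (l_iso monC U)))).
rewrite -compA bw_nat compA (l_nat monC) -compA e1 -!wlM.
by rewrite (l_nat monC).
Qed.

Lemma bw_unitl X U : (X ◁ (lunit U)) ∘ bw one X U = lunit (X ⊗ U).
Proof.
have e1 : (X ◁ (lunit (one ⊗ U))) ∘ bw one X (one ⊗ U) = lunit (X ⊗ (one ⊗ U)).
  apply: (iso_epiE linC (wl_iso linC monC one (bw_iso one X U))).
  apply: (iso_epiE linC (a_iso monC one one (X ⊗ U))).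
  rewrite -!compA -bw_tensl (compA (X ◁ _)) -wlM lunit_tens -bw_natl.
  by rewrite -lunit_tens !compA (l_nat monC).
apply: (iso_epiE linC (wl_iso linC monC one (wl_iso linC monC X (l_iso monC U)))).
rewrite -compA bw_nat (l_nat monC) -e1 !compA -!wlM.
by rewrite (l_nat monC).
Qed.

(** A strand that crosses both legs of a cap can be pulled off it: it crosses X ⊗ Y, hence, by
    naturality, the unit, and this crossing is trivial. *)
Lemma cap_bwr X Y (p : mor (X ⊗ Y) one) W U :
  cap p (W ⊗ U) ⊚ (X ◁ (bw W Y U)) ⊚ bw W X (Y ⊗ U) = W ◁ (cap p U).
Proof.
rewrite capE [in RHS]capE -!compA.
have -> : associ X Y (W ⊗ U) ⊚ (X ◁ (bw W Y U)) ⊚ bw W X (Y ⊗ U)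
    = bw W (X ⊗ Y) U ∘ (W ◁ (associ X Y U)).
  apply: (iso_monoE linC (a_iso monC X Y (W ⊗ U))).
  rewrite (tail0 _ (aVK _ _ _)) compA bw_tensr -!compA -wlM aVK tens_id.
  by rewrite compm1.
by rewrite -(tail2 _ (bw_natr _ _ _)) compA bw_unitr -!wlM.
Qed.

Lemma cup_bwr X Y (c : mor one (X ⊗ Y)) W U :
  (X ◁ (bw W Y U)) ⊚ bw W X (Y ⊗ U) ⊚ (W ◁ (cup c U)) = cup c (W ⊗ U).
Proof.
rewrite cupE [in RHS]cupE.
have := tail2 (W ◁ ((c ▷ U) ∘ luniti U)) (bw_tensr W X Y U).
rewrite -!compA -wlM => <-; congr (_ ∘ _).
rewrite wlM (tail2 _ (bw_natr _ _ _)); congr (_ ∘ _).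
apply: (iso_epiE linC (wl_iso linC monC W (l_iso monC U))).
by rewrite -compA -wlM (lK monC) tens_id compm1 -bw_unitr (tail0 _ (lK monC _)).
Qed.

Definition mw X Y U : mor (X ⊗ (Y ⊗ U)) (X ⊗ (Y ⊗ U)) :=
  locked_with bw_key (bw Y X U ∘ bw X Y U).

Lemma mw_bw X Y U : mw X Y U = bw Y X U ∘ bw X Y U.
Proof. by rewrite /mw unlock. Qed.

Lemma mwE X Y U :
  mw X Y U = assoc X Y U ⊚ ((braid Y X ∘ braid X Y) ▷ U) ⊚ associ X Y U.
Proof.
by rewrite !mw_bw !bwE wrM -!compA (tail0 _ (aK _ _ _)).
Qed.

Lemma mw_nat X Y U V (f : mor U V) :
  mw X Y V ∘ (X ◁ (Y ◁ f)) = (X ◁ (Y ◁ f)) ∘ mw X Y U.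
Proof. by rewrite !mw_bw -!compA bw_nat (tail2 _ (bw_nat _ _ _)). Qed.

Lemma mw_natr X Y Y' U (f : mor Y Y') :
  mw X Y' U ∘ (X ◁ (f ▷ U)) = (X ◁ (f ▷ U)) ∘ mw X Y U.
Proof. by rewrite !mw_bw -!compA bw_natr (tail2 _ (bw_natl _ _ _)). Qed.

Lemma mw_tensr X Y Z U :
  (X ◁ (assoc Y Z U)) ∘ mw X (Y ⊗ Z) U
  = bw Y X (Z ⊗ U) ⊚ (Y ◁ (mw X Z U)) ⊚ bw X Y (Z ⊗ U) ⊚ (X ◁ (assoc Y Z U)).
Proof.
rewrite mw_bw (tail1 _ (bw_tensl _ _ _ _)) -!compA bw_tensr.
by rewrite !mw_bw [in RHS]wlM -!compA.
Qed.

Definition op_mw X Y l : op (X :: Y :: l) (X :: Y :: l) :=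
  op_comp linC monC (op_bw Y X l) (op_bw X Y l).

Lemma op_mwE X Y l U : op_mw X Y l U = mw X Y (word l U).
Proof. by rewrite mw_bw -!op_bwE. Qed.

Lemma mw_inj X Y : mw X Y one = idmor _ -> braid Y X ∘ braid X Y = idmor (X ⊗ Y).
Proof.
move=> e; apply: (wr1_inj linC monC).
apply: (iso_monoE linC (a_iso monC X Y one)); rewrite tens_id compm1.
have := mwE X Y one; rewrite e => /(congr1 (fun f => f ∘ assoc X Y one)).
by rewrite comp1m -!compA aK compm1.
Qed.

Definition ring X Y U : mor (X ⊗ U) (X ⊗ U) := locked_with bw_key
  ((X ◁ (cap (evR Y) U)) ⊚ mw X Y (dual Y ⊗ U) ⊚ (X ◁ (cup (coev Y) U))).

Lemma ringE X Y U : ring X Y U =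
  (X ◁ (cap (evR Y) U)) ⊚ mw X Y (dual Y ⊗ U) ⊚ (X ◁ (cup (coev Y) U)).
Proof. by rewrite /ring unlock. Qed.

Definition op_ring X Y : op [:: X] [:: X] :=
  op_comp linC monC (op_wl linC monC X (op_cap linC monC (evR Y) [::]))
    (op_comp linC monC (op_mw X Y [:: dual Y])
       (op_wl linC monC X (op_cup linC monC (coev Y) [::]))).

Lemma op_ringE X Y U : op_ring X Y U = ring X Y U.
Proof.
rewrite !ringE -(op_capE linC monC (evR Y) [::] U) -(op_mwE X Y [:: dual Y] U).
by rewrite -(op_cupE linC monC (coev Y) [::] U).
Qed.

Lemma Smat_word X Y U :
  cap (evR X) U ⊚ ring X Y (dual X ⊗ U) ⊚ cup (coev X) U = Smat X Y *: idmor U.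
Proof. by rewrite -(traceR_tens fusC) ringE mwE -!compA. Qed.

(** The ring is a scalar by Schur's lemma, and closing the strand [X] identifies it: the scalar
    times dim^R(X) is S_{X,Y}. *)
Lemma ring_simple X Y U : simple_object X ->
  ring X Y U = (Smat X Y / dimR X) *: idmor (X ⊗ U).
Proof.
move=> sX; have [f ef] := op_rep linC monC (op_ring X Y).
have [c ec] := schur_scalar linC (fusion_abelian fusC) f sX.
have e V : ring X Y V = c *: idmor (X ⊗ V).
  by rewrite -op_ringE ef ec (wrZ monC) tens_id.
rewrite e; congr (_ *: _); apply: (canRL (mulfK (dimR_neq0 fusC sX))).
apply: (scale_idI fusC).
by rewrite -Smat_word e compZl compZr comp1m dimR_word // scalerA.
Qed.

Lemma SmatC X Y : Smat X Y = Smat Y X.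
Proof. exact: (traceRC fusC). Qed.

Lemma monodromy_nat X Y Y' (f : mor Y Y') :
  (braid Y' X ∘ braid X Y') ∘ (X ◁ f) = (X ◁ f) ∘ (braid Y X ∘ braid X Y).
Proof.
by rewrite -compA (braid_natural braC) !compA (braid_natural braC).
Qed.

Lemma Smat_sum X Y n (S : 'I_n -> C) : is_direct_sum S Y ->
  Smat X Y = \sum_(j < n) Smat X (S j).
Proof.
move=> [i [p [pi _ ip]]].
rewrite /Smat -[braid Y X ∘ _](compm1) -tens_id -ip (wl_sum monC).
rewrite (comp_sumr linC) (traceR_sum fusC); apply: eq_bigr => j _.
rewrite wlM compA traceRC // monodromy_nat compA -wlM pi tens_id.
by rewrite comp1m.
Qed.

Lemma Smat_iso X Y Y' : isomorphic Y Y' -> Smat X Y = Smat X Y'.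
Proof.
move=> [f [g [gf fg]]]; have := @Smat_sum X Y 1 (fun=> Y').
rewrite big_ord1; apply; exists (fun=> g), (fun=> f); split => // [j l|].
  by rewrite !ord1.
by rewrite big_ord1.
Qed.

(** A ring of color [Y ⊗ Z] is a pair of concentric rings. On a simple [X] the inner one is a scalar
    and can be taken out, which makes S_{X,-} multiplicative after division by dim^R(X). *)
Lemma ring_tens X Y Z U :
  ring X (Y ⊗ Z) U = (X ◁ (cap (evR Y) U)) ⊚ bw Y X (dual Y ⊗ U) ⊚
    (Y ◁ (ring X Z (dual Y ⊗ U))) ⊚ bw X Y (dual Y ⊗ U) ⊚ (X ◁ (cup (coev Y) U)).
Proof.
have := evR_tens fusC Y Z U; have := coev_tens fusC Y Z U; rewrite ringE.
move: (dtens Y Z U) => t -> eR; rewrite [in RHS]ringE !wlM (tail2 _ (mw_nat _ _ _)).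
rewrite (compA (X ◁ _)) -wlM eR !wlM -!compA.
rewrite (tail2 _ (mw_tensr _ _ _ _)) -!compA.
rewrite (tail0 (f := X ◁ (assoc _ _ _)) (g := X ◁ (associ _ _ _))).
  by rewrite -!(tail2 _ (bw_nat _ _ _)).
by rewrite -wlM aVK tens_id.
Qed.

Lemma scale_id_unitI X c d : simple_object X ->
  c *: idmor (X ⊗ one) = d *: idmor (X ⊗ one) -> c = d.
Proof.
move=> [X0 _] /eqP; rewrite -subr_eq0 -scalerBl scaler_eq0 subr_eq0.
case/orP => [/eqP //|/eqP e]; case: X0; apply: (wr1_inj linC monC).
by rewrite tens_id e (wr0 monC).
Qed.

Lemma Smat_tens X Y Z : simple_object X ->
  Smat X (Y ⊗ Z) * dimR X = Smat X Y * Smat X Z.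
Proof.
move=> sX; have d0 := dimR_neq0 fusC sX.
have := ring_tens X Y Z one; rewrite [ring X Z _]ring_simple // (wlZ monC) !tens_id.
rewrite compZl comp1m !compZr (compA (bw Y X _)) -mw_bw -ringE.
rewrite !ring_simple // scalerA => /(scale_id_unitI sX) /(canRL (divfK d0)) ->.
by rewrite -(mulrA _ (_ / _)) divfK // mulrAC divfK // mulrC.
Qed.

Lemma Smat1 Y : Smat one Y = dimR Y.
Proof.
rewrite /Smat mw_inj.
  by apply: (dimR_iso fusC); apply: (lunit_iso monC).
rewrite !mw_bw.
have e : bw Y one one = luniti _ ∘ (Y ◁ (lunit one)).
  by rewrite -bw_unitr (tail0 _ (lK monC _)).
by rewrite e -compA bw_unitl (lK monC).
Qed.

End Braid.

Lemma dim_le_inj (k : fieldType) (V W : vectType k) (f : V -> W) :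
  linear f -> injective f -> (\dim {:V} <= \dim {:W})%N.
Proof.
move=> linf injf.
pose f' := GRing.isLinear.Build k _ _ _ f linf.
pose F : {linear V -> W} := HB.pack f f'.
have kF : (lker (linfun F) == 0)%VS.
  by apply/lker0P => x y; rewrite !lfunE; apply: injf.
rewrite -(limg_dim_eq (f := linfun F)) ?dimvS ?subvf //.
by rewrite (eqP kF) capv0.
Qed.

Lemma dim_eq_bij (k : fieldType) (V W : vectType k) (f : V -> W) (g : W -> V) :
  linear f -> linear g -> cancel f g -> cancel g f -> \dim {:V} = \dim {:W}.
Proof.
move=> lf lg fg gf; apply/eqP; rewrite eqn_leq.
by rewrite (dim_le_inj lf (can_inj fg)) (dim_le_inj lg (can_inj gf)).
Qed.

(** * The Grothendieck ring *)

Section Fusion.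
Variables (k : closedFieldType) (C : pivotalData k).
Hypothesis fusC : braided_pivotal_fusion C.
Implicit Types U V W X Y Z : C.

Local Notation linC := (fusion_linear fusC).
Local Notation monC := (fusion_monoidal fusC).
Local Notation rigC := (fusion_rigid fusC).
Local Notation braC := (fusion_braided fusC).
Local Notation pivC := (fusion_pivotal fusC).
Local Notation one := (unit_obj : C).
Local Notation compA := (compA linC).
Local Notation comp1m := (comp1m linC).
Local Notation compm1 := (compm1 linC).
Local Notation wlM := (wlM linC monC).
Local Notation interchange := (interchange linC monC).
Local Notation compDl := (compDl linC).
Local Notation compDr := (compDr linC).
Local Notation compZl := (compZl linC).
Local Notation compZr := (compZr linC).
Local Notation tail2 := (tail2 linC).
Local Notation cap_nat := (cap_nat linC monC).
Local Notation cup_nat := (cup_nat linC monC).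
Local Notation zig := (zig linC monC rigC).
Local Notation zag := (zag linC monC rigC).

Local Notation abC := (fusion_abelian fusC).

Lemma comp_linear W X Y Z (g : mor Y Z) (f : mor W X) :
  linear (fun h : mor X Y => g ∘ (h ∘ f)).
Proof. by move=> c h h'; rewrite compDl compDr compZl compZr. Qed.

Lemma dim_hom_iso X X' Y Y' : isomorphic X X' -> isomorphic Y Y' ->
  \dim {: mor X Y} = \dim {: mor X' Y'}.
Proof.
move=> [f [f' [f1 f2]]] [g [g' [g1 g2]]].
apply: (dim_eq_bij (comp_linear g f') (comp_linear g' f)) => h.
  by rewrite -!compA f1 compm1 compA g1 comp1m.
by rewrite -!compA f2 compm1 compA g2 comp1m.
Qed.

Lemma dim_hom_dual W A B :
  \dim {: mor (dual W ⊗ A) B} = \dim {: mor A (W ⊗ B)}.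
Proof.
apply: (@dim_eq_bij _ _ _
  (fun f : mor (dual W ⊗ A) B => (W ◁ f) ∘ cup (coev W) A)
  (fun g : mor A (W ⊗ B) => cap (ev W) B ∘ (dual W ◁ g))) => [c f g|c f g|f|g].
- by rewrite (wlD monC) (wlZ monC) compDl compZl.
- by rewrite (wlD monC) (wlZ monC) compDr compZr.
- by rewrite wlM compA cap_nat -compA zag compm1.
by rewrite wlM -compA cup_nat compA zig comp1m.
Qed.

Lemma dualm_linear X Y : linear (@dualm _ C X Y).
Proof.
move=> c f g; rewrite /dualm /mate (wlD monC) (wlZ monC) compDr compZr.
rewrite (wrD monC) (wrZ monC) compDr compZr.
by rewrite 3!compDl 3!compZl.
Qed.

Lemma dualm_inj X Y : injective (@dualm _ C X Y).
Proof.
move=> f g e; apply: (wr1_inj linC monC).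
have h (f' : mor X Y) : f' ▷ one
    = (Y ◁ (cap (ev X) one)) ⊚ (Y ◁ (dualm f' ▷ (X ⊗ one))) ⊚ cup (coev Y) (X ⊗ one).
  rewrite -(coevw_dual linC monC rigC) -(tail2 _ (interchange _ _)).
  by rewrite zig compm1.
by rewrite [LHS]h [RHS]h e.
Qed.

Lemma piv_isom X : isomorphic X (dual (dual X)).
Proof. by exists (piv X); apply: (piv_iso pivC). Qed.

(** Injectivity of [dualm] gives one inequality; dualizing a second time and identifying double
    duals by [piv] gives the other. *)
Lemma dim_hom_duals X Y : \dim {: mor (dual X) (dual Y)} = \dim {: mor Y X}.
Proof.
have le A B := dim_le_inj (@dualm_linear A B) (@dualm_inj A B).
apply/eqP; rewrite eqn_leq le andbT.
apply: leq_trans (le _ _) _.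
by rewrite -(dim_hom_iso (piv_isom Y) (piv_isom X)).
Qed.

Lemma dim_end_simple X : simple_object X -> \dim {: mor X X} = 1%N.
Proof.
move=> sX; have n0 : idmor X != 0 by apply/eqP; case: sX.
have <- : <[idmor X]>%VS = {: mor X X}%VS; last by rewrite dim_vline n0.
apply/eqP; rewrite eqEsubv subvf; apply/subvP => f _.
have [c ->] := schur_scalar linC abC f sX.
by rewrite memvZ // memv_line.
Qed.

Lemma dim_hom_simple X Y : simple_object X -> simple_object Y ->
  ~ isomorphic X Y -> \dim {: mor X Y} = 0%N.
Proof.
move=> sX sY nXY; apply/eqP; rewrite dimv_eq0 -subv0; apply/subvP => f _.
by rewrite (schur_zero linC abC f sX sY nXY) mem0v.
Qed.

Lemma simple_iso X Y : isomorphic X Y -> simple_object X -> simple_object Y.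
Proof.
move=> [f [g [gf fg]]] [X0 sX]; split=> [Y0|Z i mi].
  by apply: X0; rewrite /is_zero -gf -[f]comp1m Y0 (comp0m linC) (compm0 linC).
have [Z0|[h hh]] : is_zero Z \/ is_iso (g ∘ i).
  apply: sX => W u v; rewrite -!compA => e; apply: mi.
  by apply: (iso_monoE linC) e; exists f.
  by left.
right; exists (h ∘ g).
rewrite -[i]comp1m -fg -compA; apply: (inverse_comp linC hh).
by split.
Qed.

(** A summand of [X] gives a nonzero idempotent endomorphism. It is a scalar, hence the identity,
    and [X] is that summand. Simplicity of duals and of products with invertible objects thereby
    becomes a count of dimensions. *)
Lemma simple_of_dim X : \dim {: mor X X} = 1%N -> simple_object X.
Proof.
move=> d1; have n0 : idmor X != 0.
  apply/eqP => X0; suff : (\dim {: mor X X} <= 0)%N by rewrite d1.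
  rewrite leqn0 dimv_eq0 -subv0; apply/subvP => f _.
  by rewrite (is_zero_comp linC f X0) mem0v.
have fE (f : mor X X) : exists c, f = c *: idmor X.
  have e : <[idmor X]>%VS = {: mor X X}%VS.
    by apply/eqP; rewrite eqEdim subvf dim_vline n0 d1.
  have : f \in <[idmor X]>%VS by rewrite e memvf.
  by move/vlineP.
have [n [S [sS [i [p [pi _ ip]]]]]] := fusion_semisimple fusC X.
have [j _] : exists j : 'I_n, True.
  apply: contrapT => nj; case/eqP: n0; rewrite -ip big1 // => j.
  by case: nj; exists j.
have [c ec] := fE (i j ∘ p j).
have ij : i j = c *: i j.
  by rewrite -{1}(compm1 (i j)) -(pi j) compA ec compZl comp1m.
have i0 : i j != 0.
  apply/eqP => i0; case: (sS j) => S0 _; apply: S0.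
  by rewrite /is_zero -(pi j) i0 (compm0 linC).
apply: (simple_iso _ (sS j)); exists (i j), (p j); split => //.
rewrite ec; suff -> : c = 1 by rewrite scale1r.
apply/eqP; rewrite -subr_eq0; move/eqP: ij.
rewrite -subr_eq0 -{1}[i j]scale1r -scalerBl scaler_eq0 (negPf i0) orbF.
by rewrite -opprB oppr_eq0.
Qed.

Lemma dim_simpleP X : simple_object X <-> \dim {: mor X X} = 1%N.
Proof. by split; [exact: dim_end_simple | exact: simple_of_dim]. Qed.

Lemma dual_simple X : simple_object X -> simple_object (dual X).
Proof. by rewrite !dim_simpleP dim_hom_duals. Qed.

Lemma dual_isoP X Y : simple_object X -> simple_object Y ->
  isomorphic (dual X) (dual Y) -> isomorphic X Y.
Proof.
move=> sX sY i; apply: contrapT => nXY.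
have : \dim {: mor (dual X) (dual X)} = 0%N.
  rewrite (dim_hom_iso (iso_refl linC _) i) dim_hom_duals.
  by apply: dim_hom_simple => // /iso_sym.
by rewrite dim_hom_duals dim_end_simple.
Qed.

Lemma dim_hom_isoP X Y : simple_object X -> simple_object Y ->
  \dim {: mor X Y} <> 0%N <-> isomorphic X Y.
Proof.
move=> sX sY; split=> [d0|i]; last first.
  by rewrite -(dim_hom_iso (iso_refl linC X) i) dim_end_simple.
by apply: contrapT => /(dim_hom_simple sX sY).
Qed.

Section Multiplicity.
Variables (Irr : finType) (s : Irr -> C).
Hypothesis irr_s : simple_system s.

Definition mult X (i : Irr) : nat := \dim {: mor X (s i)}.

Lemma s_simple i : simple_object (s i).
Proof. by case: irr_s. Qed.

Lemma s_inj i j : isomorphic (s i) (s j) -> i = j.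
Proof. by case: irr_s => _ h _; apply: h. Qed.

Lemma mult_s i j : mult (s i) j = (i == j).
Proof.
rewrite /mult; case: eqVneq => [->|nij]; first exact: dim_end_simple (s_simple j).
apply: dim_hom_simple; try exact: s_simple.
by move/s_inj/eqP; apply/negP.
Qed.

Lemma mult_iso X Y i : isomorphic X Y -> mult X i = mult Y i.
Proof. by move=> h; apply: (dim_hom_iso h (iso_refl linC _)). Qed.

Lemma simple_decomp X : exists n (c : 'I_n -> Irr), is_direct_sum (s \o c) X.
Proof.
have [n [S [sS [i [p [pi pi0 ip]]]]]] := fusion_semisimple fusC X.
have /choice[c hc] : forall j, exists c, isomorphic (S j) (s c).
  by move=> j; have [_ _ h] := irr_s; apply/h/sS.
pose f j := projT1 (cid (hc j)); pose hf j : is_iso (f j) := projT2 (cid (hc j)).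
pose g j := projT1 (cid (hf j)); pose fg j : inverse_of (f j) (g j) := projT2 (cid (hf j)).
exists n, c, (fun j => i j ∘ g j), (fun j => f j ∘ p j); split => [j|j l njl|] /=.
- by rewrite -compA (compA (p j)) pi comp1m; case: (fg j).
- by rewrite -compA (compA (p j)) pi0 // (comp0m linC) (compm0 linC).
rewrite -ip; apply: eq_bigr => j _.
by rewrite -compA (compA (g j)); case: (fg j) => -> _; rewrite comp1m.
Qed.

(** The summands of type [i] yield bases of Hom(X, s i) and of Hom(s i, X) that are dual to each
    other; both spaces therefore have the same dimension. *)
Lemma mult_sum X n (c : 'I_n -> Irr) i : is_direct_sum (s \o c) X ->
  mult X i = (\sum_(j < n) (c j == i))%N
  /\ \dim {: mor (s i) X} = (\sum_(j < n) (c j == i))%N.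
Proof.
move=> [ii [p [pi pi0 ip]]]; simpl in ii, p.
(* The target of [q j] is [s i] for all [j], with zero maps as default values when the summand has
   another type; the transport along [c j = i] is confined to this choice. *)
have /choice[q /choice[r qr]] : forall j, exists (q : mor X (s i)) (r : mor (s i) X),
    c j = i -> q ∘ r = idmor (s i) /\ r ∘ q = ii j ∘ p j.
  move=> j; case: (c j =P i) => [<-|nc]; last by exists 0, 0 => /nc.
  by exists (p j), (ii j); split => //; apply: pi.
have qr0 j l : c j = i -> c l = i -> q j ∘ r l = (j == l)%:R *: idmor (s i).
  case: eqVneq => [<-|njl] cj cl; first by rewrite scale1r; case: (qr j cj).
  have [qj rj] := qr j cj; have [ql rl] := qr l cl.
  rewrite -(comp1m (q j)) -qj -(compm1 (r l)) -ql -!compA (compA (r j)) rj.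
  rewrite (compA (r l) (q l)) rl -!compA (compA (p j)) pi0 //.
  by rewrite (comp0m linC) !(compm0 linC) scale0r.
pose J := [pred j : 'I_n | c j == i]; have cJ (a : 'I_#|J|) : c (enum_val a) = i.
  by have := enum_valP a; rewrite inE => /eqP.
have -> : (\sum_(j < n) (c j == i))%N = #|J|.
  by rewrite -sum1_card [RHS]big_mkcond; apply: eq_bigr => j _; rewrite inE; case: eqP.
split.
pose B := [tuple q (enum_val a) | a < #|J|].
have fr : free B.
  apply/freeP => x e a.
  have := congr1 (fun f : mor X (s i) => f ∘ r (enum_val a)) e.
  rewrite (comp0m linC) (comp_suml linC).
  rewrite (bigD1 a) //= big1 ?addr0 => [|b nba].
    rewrite nth_mktuple compZl qr0 // eqxx scale1r => /eqP.
    rewrite scaler_eq0 => /orP[/eqP //|/eqP si0].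
    by case: (s_simple i) => h; case: h.
  rewrite nth_mktuple compZl qr0 // (negPf (_ : enum_val b != enum_val a)).
    by rewrite scale0r scaler0.
  by rewrite (inj_eq enum_val_inj).
have sp : <<B>>%VS = {: mor X (s i)}%VS.
  apply/eqP; rewrite eqEsubv subvf; apply/subvP => f _.
  rewrite -(compm1 f) -ip (comp_sumr linC); apply: memv_suml => j _.
  have [cj|ncj] := eqVneq (c j) i; last first.
    rewrite compA (_ : f ∘ ii j = 0) ?(comp0m linC) ?mem0v //.
    apply: (schur_zero linC abC); try exact: s_simple.
    by move/s_inj/eqP; apply/negP.
  have [qj rj] := qr j cj; rewrite -rj compA.
  have [x ->] := schur_scalar linC abC (f ∘ r j) (s_simple i).
  rewrite compZl comp1m memvZ // memv_span //; apply/tnthP.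
  have jJ : j \in J by rewrite inE cj.
  by exists (enum_rank_in jJ j); rewrite tnth_mktuple enum_rankK_in.
by have := eqP fr; rewrite sp size_tuple.
pose B := [tuple r (enum_val a) | a < #|J|].
have fr : free B.
  apply/freeP => x e a.
  have := congr1 (fun f : mor (s i) X => q (enum_val a) ∘ f) e.
  rewrite (compm0 linC) (comp_sumr linC).
  rewrite (bigD1 a) //= big1 ?addr0 => [|b nba].
    rewrite nth_mktuple compZr qr0 // eqxx scale1r => /eqP.
    rewrite scaler_eq0 => /orP[/eqP //|/eqP si0].
    by case: (s_simple i) => h; case: h.
  rewrite nth_mktuple compZr qr0 // (negPf (_ : enum_val a != enum_val b)).
    by rewrite scale0r scaler0.
  by rewrite (inj_eq enum_val_inj) eq_sym.
have sp : <<B>>%VS = {: mor (s i) X}%VS.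
  apply/eqP; rewrite eqEsubv subvf; apply/subvP => f _.
  rewrite -(comp1m f) -ip (comp_suml linC); apply: memv_suml => j _.
  have [cj|ncj] := eqVneq (c j) i; last first.
    rewrite -compA (_ : p j ∘ f = 0) ?(compm0 linC) ?mem0v //.
    apply: (schur_zero linC abC); try exact: s_simple.
    by move/s_inj/esym/eqP; apply/negP.
  have [qj rj] := qr j cj; rewrite -rj -compA.
  have [x ->] := schur_scalar linC abC (q j ∘ f) (s_simple i).
  rewrite compZr compm1 memvZ // memv_span //; apply/tnthP.
  have jJ : j \in J by rewrite inE cj.
  by exists (enum_rank_in jJ j); rewrite tnth_mktuple enum_rankK_in.
by have := eqP fr; rewrite sp size_tuple.
Qed.

Definition additive (phi : C -> k) :=
  forall X, phi X = \sum_i (mult X i)%:R * phi (s i).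

Lemma additive_sum (phi : C -> k) :
  (forall X n (S : 'I_n -> C), is_direct_sum S X ->
     phi X = \sum_(j < n) phi (S j)) -> additive phi.
Proof.
move=> h X; have [n [c dX]] := simple_decomp X.
rewrite (h _ _ _ dX); under [RHS]eq_bigr do rewrite (proj1 (mult_sum _ dX)) natr_sum mulr_suml.
rewrite exchange_big; apply: eq_bigr => j _ /=.
rewrite (bigD1 (c j)) //= eqxx mul1r big1 ?addr0 // => i /negPf nij.
by rewrite eq_sym nij mul0r.
Qed.

Lemma additive_iso phi X Y : additive phi -> isomorphic X Y -> phi X = phi Y.
Proof.
move=> h i; rewrite (h X) (h Y); apply: eq_bigr => j _.
by rewrite (mult_iso _ i).
Qed.

Lemma Smat_additive X : additive (Smat X).
Proof. by apply: additive_sum => Y n S; apply: Smat_sum. Qed.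

Lemma dimR_additive : additive (@dimR k C).
Proof.
move=> X; rewrite -Smat1 // Smat_additive.
by apply: eq_bigr => i _; rewrite Smat1.
Qed.

Lemma star_ex i : exists j, isomorphic (dual (s i)) (s j).
Proof. by have [_ _ h] := irr_s; apply/h/dual_simple/s_simple. Qed.

Definition star i : Irr := projT1 (cid (star_ex i)).

Lemma starP i : isomorphic (dual (s i)) (s (star i)).
Proof. exact: projT2 (cid (star_ex i)). Qed.

Lemma star_inj : injective star.
Proof.
move=> i j e; apply/s_inj/dual_isoP; try exact: s_simple.
by apply: (iso_trans linC (starP i)); rewrite e; apply/iso_sym/starP.
Qed.

Lemma mult_hom X i : mult X i = \dim {: mor (s i) X}.
Proof.
by have [n [c dX]] := simple_decomp X; have [-> ->] := mult_sum i dX.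
Qed.

Lemma mult_dual X i : mult (dual X) (star i) = mult X i.
Proof.
rewrite /mult -(dim_hom_iso (iso_refl linC _) (starP i)) dim_hom_duals.
by rewrite -mult_hom.
Qed.

Lemma dual_iso_simple X Y : simple_object X -> isomorphic X Y ->
  isomorphic (dual X) (dual Y).
Proof.
move=> sX i; have sY := simple_iso i sX.
apply/(dim_hom_isoP (dual_simple sX) (dual_simple sY)).
by rewrite dim_hom_duals; apply/(dim_hom_isoP sY sX)/iso_sym.
Qed.

Lemma starK : involutive star.
Proof.
move=> i; apply: s_inj; apply: (iso_trans linC (iso_sym (starP _))).
apply: (iso_trans linC _ (iso_sym (piv_isom _))).
apply: (dual_iso_simple (s_simple _)); exact: iso_sym (starP i).
Qed.

Lemma braid_isom X Y : isomorphic (X ⊗ Y) (Y ⊗ X).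
Proof. by exists (braid X Y); apply: (braid_iso braC). Qed.

(** Rotation of a trivalent vertex; the braiding and the pivotal structure identify the left and
    right versions of the duals that occur. *)
Lemma mult_rot i j l : mult (s i ⊗ s j) l = mult (dual (s l) ⊗ s i) (star j).
Proof.
rewrite [RHS]/mult -(dim_hom_iso (iso_refl linC _) (starP j)) dim_hom_dual.
rewrite -(dim_hom_iso (iso_refl linC _) (braid_isom _ _)) -dim_hom_dual.
rewrite /mult (dim_hom_iso (braid_isom _ _) (iso_refl linC _)).
apply: dim_hom_iso (iso_refl linC _).
exact: (tens_iso monC (piv_isom _) (iso_refl linC _)).
Qed.

Definition is_character (phi : C -> k) :=
  [/\ additive phi, forall X Y, phi (X ⊗ Y) = phi X * phi Y & phi one = 1].

Lemma character_star phi i : is_character phi ->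
  phi (s (star i)) = phi (dual (s i)).
Proof. by case=> h _ _; apply/additive_iso/iso_sym/starP. Qed.

(* Both sides compute the pairing of [chi] and [psi] twisted by [s z]. *)
Lemma character_orth chi psi z : is_character chi -> is_character psi ->
  chi (s z) <> psi (s z) -> \sum_i chi (s i) * psi (dual (s i)) = 0.
Proof.
move=> hc hp ne; have [ac mc _] := hc; have [ap mp _] := hp.
suff e : chi (s z) * \sum_i chi (s i) * psi (dual (s i))
       = psi (s z) * \sum_i chi (s i) * psi (dual (s i)).
  apply/eqP; move/eqP: e; rewrite -subr_eq0 -mulrBl mulf_eq0 subr_eq0.
  by case/orP => // /eqP.
rewrite !mulr_sumr.
transitivity (\sum_i \sum_l (mult (s z ⊗ s i) l)%:R * chi (s l) * psi (dual (s i))).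
  by apply: eq_bigr => i _; rewrite mulrA -mc ac mulr_suml.
transitivity (\sum_l \sum_i (mult (dual (s l) ⊗ s z) i)%:R * psi (s i) * chi (s l)).
  rewrite exchange_big; apply: eq_bigr => l _ /=.
  rewrite [RHS](reindex_inj star_inj); apply: eq_bigr => i _ /=.
  by rewrite -mult_rot (character_star _ hp) mulrAC.
apply: eq_bigr => l _; rewrite -mulr_suml -ap mp.
by rewrite mulrAC mulrC [X in _ * X]mulrC.
Qed.

Lemma dimR_character : is_character (@dimR k C).
Proof.
split; [exact: dimR_additive | exact: dimR_tens fusC | exact: dimR_unit fusC].
Qed.

Definition chi X Y := Smat X Y / dimR X.

Lemma chi_character X : simple_object X -> is_character (chi X).
Proof.
move=> sX; have d0 := dimR_neq0 fusC sX; split=> [Y|Y Z|]; rewrite /chi.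
- by rewrite Smat_additive mulr_suml; apply: eq_bigr => i _; rewrite mulrA.
- by rewrite mulrACA -(Smat_tens fusC _ _ sX) mulrA mulfK.
by rewrite SmatC // Smat1 // divff.
Qed.

Lemma unit_index : exists i0, isomorphic one (s i0).
Proof. by have [_ _ h] := irr_s; apply/h/(fusion_unit fusC). Qed.

(* The sum is an eigenvalue of the positive definite integral matrix
   [\sum_i N_i N_i^T], where [N_i] is the matrix of tensoring with [s i]. *)
Lemma character_norm phi : [pchar k] =i pred0 -> is_character phi ->
  \sum_i phi (s i) * phi (dual (s i)) != 0.
Proof.
move=> char0 hp; have [ap mp p1] := hp; have [i0 one0] := unit_index.
apply/eqP => D0; set n := #|Irr|.
pose N i : 'M[int]_n := \matrix_(a, b) (mult (s i ⊗ s (enum_val a)) (enum_val b))%:R.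
have NT i : (N i)^T = N (star i).
  apply/matrixP => a b; rewrite !mxE; congr (_%:R).
  rewrite -(mult_iso _ (tens_iso monC (starP i) (iso_refl linC _))).
  by rewrite /mult dim_hom_dual -mult_hom.
pose M := \sum_i N i *m (N i)^T.
pose v : 'cV[k]_n := \col_a phi (s (enum_val a)).
have Nv i : map_mx intr (N i) *m v = phi (s i) *: v.
  apply/matrixP => a b; rewrite !mxE -mp ap.
  rewrite (reindex _ (onW_bij _ (enum_val_bij Irr))) /=.
  by apply: eq_bigr => l _; rewrite !mxE rmorph_nat.
have Mv : map_mx intr M *m v = 0.
  rewrite -[RHS](scale0r v) -D0 /M raddf_sum mulmx_suml scaler_suml.
  apply: eq_bigr => i _; rewrite /= map_mxM NT -mulmxA Nv -scalemxAr Nv scalerA.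
  by rewrite (character_star _ hp) mulrC.
have v0 : v != 0.
  apply/eqP => /colP/(_ (enum_rank i0)); rewrite !mxE enum_rankK => /eqP.
  by rewrite -(additive_iso ap one0) p1 oner_eq0.
(* In characteristic 0 an integer that vanishes in [k] is zero. The singularity of [M] thus passes
   to the rationals, where a sum of squares vanishes only if each term does. *)
have dM : \det M = 0.
  have : \det (map_mx intr M : 'M[k]_n) == 0.
    rewrite -det_tr; apply/det0P; exists v^T.
      by apply: contraNneq v0 => /(congr1 trmx); rewrite trmxK trmx0 => ->.
    by rewrite -trmx_mul Mv trmx0.
  rewrite det_map_mx; move/pcharf0P: char0 => c0.
  case: (\det M) => m /=; first by rewrite -pmulrn c0 => /eqP ->.
  by rewrite NegzE rmorphN /= oppr_eq0 -pmulrn c0.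
have /det0P[u u0 uM] : \det (map_mx intr M : 'M[rat]_n) == 0.
  by rewrite det_map_mx dM rmorph0.
pose w i := u *m map_mx intr (N i).
have w0 : \sum_i \sum_a w i 0 a ^+ 2 = 0.
  have := congr1 (fun x : 'rV[rat]_n => (x *m u^T) 0 0) uM.
  rewrite mul0mx [RHS]mxE => e; apply: etrans e; rewrite /M raddf_sum mulmx_sumr mulmx_suml summxE.
  apply: eq_bigr => i _; rewrite /= map_mxM -map_trmx mulmxA -(mulmxA (u *m _)) -trmx_mul mxE.
  by apply: eq_bigr => a _; rewrite [X in _ * X]mxE expr2.
(* The matrix of tensoring with the unit is the identity, so this one term already makes the form
   definite. *)
have wi0 : w i0 = u.
  apply/rowP => b; rewrite mxE (bigD1 b) //= big1 ?addr0 => [|a nab]; rewrite !mxE.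
    rewrite -(mult_iso _ (tens_iso monC one0 (iso_refl linC _))).
    by rewrite (mult_iso _ (lunit_iso monC _)) mult_s eqxx mulr1.
  rewrite -(mult_iso _ (tens_iso monC one0 (iso_refl linC _))).
  rewrite (mult_iso _ (lunit_iso monC _)) mult_s (inj_eq enum_val_inj).
  by rewrite (negPf nab) mulr0.
case/negP: u0; apply/eqP/rowP => b; rewrite mxE.
have sq i a : true -> 0 <= w i 0 a ^+ 2 by rewrite sqr_ge0.
have := psumr_eq0P (fun i _ => sumr_ge0 _ (sq i)) w0 (i := i0) isT.
move=> /(psumr_eq0P (sq i0))/(_ b isT)/eqP.
by rewrite wi0 sqrf_eq0 => /eqP.
Qed.

End Multiplicity.
End Fusion.

(** * Handle slide *)

Section HandleSlide.
Variables (k : closedFieldType) (C : pivotalData k).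
Hypothesis fusC : braided_pivotal_fusion C.
Implicit Types U V W X Y Z : C.

Local Notation linC := (fusion_linear fusC).
Local Notation monC := (fusion_monoidal fusC).
Local Notation rigC := (fusion_rigid fusC).
Local Notation one := (unit_obj : C).
Local Notation compA := (compA linC).
Local Notation comp1m := (comp1m linC).
Local Notation compm1 := (compm1 linC).
Local Notation wlM := (wlM linC monC).
Local Notation wrM := (wrM linC monC).
Local Notation interchange := (interchange linC monC).
Local Notation compZl := (compZl linC).
Local Notation compZr := (compZr linC).
Local Notation tail0 := (tail0 linC).
Local Notation tail1 := (tail1 linC).
Local Notation tail2 := (tail2 linC).
Local Notation cap_nat := (cap_nat linC monC).
Local Notation cup_nat := (cup_nat linC monC).
Local Notation tens_id := (tensm_id monC).
Local Notation zig := (zig linC monC rigC).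
Local Notation zag := (zag linC monC rigC).

Local Notation abC := (fusion_abelian fusC).
Local Notation aK := (aK monC).
Local Notation aVK := (aVK monC).
Local Notation zagR := (zagR fusC).
Variables (Irr : finType) (s : Irr -> C).
Hypothesis irr_s : simple_system s.
Local Notation s_simple := (s_simple irr_s).

(** Each of the [n] summands carries maps to and from every [s i], zero unless the summand has type
    [i]; the index set then does not depend on [i], and the sums over types and summands can be
    exchanged. *)
Lemma isotypic X : exists n (q : forall i, 'I_n -> mor X (s i))
    (r : forall i, 'I_n -> mor (s i) X),
  [/\ forall i a b, a != b -> q i a ∘ r i b = 0,
      forall i a, q i a ∘ r i a = idmor (s i) \/ q i a = 0 /\ r i a = 0
    & \sum_i \sum_a (r i a ∘ q i a) = idmor X].
Proof.
have [n [c [ii [p [pi pi0 ip]]]]] := simple_decomp fusC irr_s X.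
simpl in ii, p.
have ht i a : exists qr : mor X (s i) * mor (s i) X,
    if c a == i then qr.1 ∘ qr.2 = idmor (s i) /\ qr.2 ∘ qr.1 = ii a ∘ p a
    else qr = (0, 0).
  case: eqP => [<-|nc]; last by exists (0, 0).
  by exists (p a, ii a); split => //; apply: pi.
pose t i a := projT1 (cid (ht i a)).
have ht' i a : if c a == i then (t i a).1 ∘ (t i a).2 = idmor (s i)
    /\ (t i a).2 ∘ (t i a).1 = ii a ∘ p a else t i a = (0, 0).
  exact: projT2 (cid (ht i a)).
move: t ht' => {ht} t ht.
exists n, (fun i a => (t i a).1), (fun i a => (t i a).2); split=> [i a b nab|i a|].
- have := ht i a; case: eqP => [ca [qa ra]|_ ->]; last exact: (comp0m linC).
  have := ht i b; case: eqP => [cb [qb rb]|_ ->]; last exact: (compm0 linC).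
  rewrite -(comp1m (t i a).1) -qa -(compm1 (t i b).2) -qb -!compA.
  rewrite (compA (t i a).2) ra (compA (t i b).2 (t i b).1) rb -!compA (compA (p a)).
  by rewrite pi0 // (comp0m linC) !(compm0 linC).
- by have := ht i a; case: eqP => [_ []|_ ->]; [left | right].
rewrite exchange_big -ip; apply: eq_bigr => a _ /=.
rewrite (bigD1 (c a)) //= big1 ?addr0 => [|i ni].
  by have := ht (c a) a; rewrite eqxx => -[].
by have := ht i a; rewrite eq_sym (negPf ni) => ->; apply: (compm0 linC).
Qed.

(** * Rotated trivalent vertices *)

Section Hat.
Variables V Y Z : C.

(* [pihat q] and [iohat r] are the rotations of [q : V ⊗ Y -> Z] and
   [r : Z -> V ⊗ Y] to morphisms between [Z^* ⊗ V] and [Y^*]. *)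
Definition pitil (q : mor (V ⊗ Y) Z) U : mor (V ⊗ U) (Z ⊗ (dual Y ⊗ U)) :=
  (q ▷ (dual Y ⊗ U)) ⊚ associ V Y (dual Y ⊗ U) ⊚ (V ◁ (cup (coev Y) U)).
Definition iotil (r : mor Z (V ⊗ Y)) U : mor (Z ⊗ (dual Y ⊗ U)) (V ⊗ U) :=
  (V ◁ (cap (evR Y) U)) ⊚ assoc V Y (dual Y ⊗ U) ⊚ (r ▷ (dual Y ⊗ U)).
Definition pihat q U : mor (dual Z ⊗ (V ⊗ U)) (dual Y ⊗ U) :=
  cap (ev Z) (dual Y ⊗ U) ∘ (dual Z ◁ (pitil q U)).
Definition iohat r U : mor (dual Y ⊗ U) (dual Z ⊗ (V ⊗ U)) :=
  (dual Z ◁ (iotil r U)) ∘ cup (coevR Z) (dual Y ⊗ U).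

Definition op_pihat q : op [:: dual Z; V] [:: dual Y] :=
  op_comp linC monC (op_cap linC monC (ev Z) [:: dual Y])
   (op_wl linC monC (dual Z) (op_comp linC monC (op_wr linC monC (Y := Z) [:: dual Y] q)
     (op_comp linC monC (op_associ linC monC V Y [:: dual Y])
        (op_wl linC monC V (op_cup linC monC (coev Y) [::]))))).

Lemma op_pihatE q U : op_pihat q U = pihat q U.
Proof.
rewrite /pihat /pitil -(op_capE linC monC (ev Z) [:: dual Y] U).
by rewrite -(op_cupE linC monC (coev Y) [::] U).
Qed.

Definition op_iohat r : op [:: dual Y] [:: dual Z; V] :=
  op_comp linC monC
   (op_wl linC monC (dual Z) (op_comp linC monC (op_wl linC monC V (op_cap linC monC (evR Y) [::]))
     (op_comp linC monC (op_assoc linC monC V Y [:: dual Y]) (op_wr linC monC [:: dual Y] r))))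
   (op_cup linC monC (coevR Z) [:: dual Y]).

Lemma op_iohatE r U : op_iohat r U = iohat r U.
Proof.
rewrite /iohat /iotil -(op_capE linC monC (evR Y) [::] U).
by rewrite -(op_cupE linC monC (coevR Z) [:: dual Y] U).
Qed.

Lemma pitilE q U : (Z ◁ (pihat q U)) ∘ cup (coev Z) (V ⊗ U) = pitil q U.
Proof. by rewrite /pihat wlM -compA cup_nat compA zig comp1m. Qed.

Lemma iotilE r U : cap (evR Z) (V ⊗ U) ∘ (Z ◁ (iohat r U)) = iotil r U.
Proof. by rewrite /iohat wlM compA cap_nat -compA zagR compm1. Qed.

Lemma ev_pihat q U : cap (ev Y) U ∘ pihat q (Y ⊗ U)
  = cap (ev Z) U ⊚ (dual Z ◁ (q ▷ U)) ⊚ (dual Z ◁ (associ V Y U)).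
Proof.
rewrite /pihat (tail2 _ (esym (cap_nat _ _))) -!wlM; congr (_ ∘ (_ ◁ _)).
rewrite /pitil (tail2 _ (esym (interchange _ _))).
rewrite (tail2 _ (esym (ai_nat_r linC monC _ _ _))).
by rewrite -wlM zig tens_id compm1.
Qed.

Lemma iohat_coev r U : iohat r (Y ⊗ U) ∘ cup (coevR Y) U
  = (dual Z ◁ (assoc V Y U)) ⊚ (dual Z ◁ (r ▷ U)) ⊚ cup (coevR Z) U.
Proof.
rewrite /iohat -compA -cup_nat !compA -!wlM; congr ((_ ◁ _) ∘ _).
rewrite /iotil -!compA interchange (tail2 _ (a_nat_r monC _ _ _)).
by rewrite compA -wlM zagR tens_id comp1m.
Qed.

(** Closing the strand Y^* of the rotated vertices gives the same planar diagram as closing the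
    strand [Z] of [q ∘ r], after the zigzags of [Y] are straightened. *)
Lemma hat_trace q r U :
  cap (ev Y) U ⊚ pihat q (Y ⊗ U) ⊚ iohat r (Y ⊗ U) ⊚ cup (coevR Y) U
  = traceL (q ∘ r) *: idmor U.
Proof.
rewrite iohat_coev (tail1 _ (ev_pihat _ _)) -!compA -(traceL_word fusC) wrM wlM -!compA.
by rewrite (compA (dual Z ◁ (associ _ _ _))) -wlM aK tens_id comp1m.
Qed.

Lemma pihat_sum (I : finType) (c : I -> k) (q : I -> mor (V ⊗ Y) Z) U :
  pihat (\sum_a c a *: q a) U = \sum_a c a *: pihat (q a) U.
Proof.
rewrite /pihat /pitil (wr_sum monC) (comp_suml linC) (wl_sum monC) (comp_sumr linC).
by apply: eq_bigr => a _; rewrite (wrZ monC) compZl (wlZ monC) compZr.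
Qed.

Lemma pihat_surj (g : mor (dual Z ⊗ V) (dual Y)) :
  exists h : mor (V ⊗ Y) Z, forall U, pihat h U = (g ▷ U) ∘ associ (dual Z) V U.
Proof.
(* The body of [gw] is hidden behind two equations, so that the rewriting below treats it as a
   single operator. *)
have [gw [gwE gwY]] : exists gw : forall l, op [:: dual Z, V & l] (dual Y :: l),
    (forall T, gw [::] T = (g ▷ T) ∘ associ (dual Z) V T) /\
    forall T, gw [:: Y] T = gw [::] (Y ⊗ T).
  by exists (fun l => op_comp linC monC (op_wr linC monC (Y := dual Y) l g)
    (op_associ linC monC (dual Z) V l)).
have [h eh] := op_rep linC monC (X := V ⊗ Y) (Y := Z)
  (op_comp linC monC (op_wl linC monC Z (op_cap linC monC (ev Y) [::]))
  (op_comp linC monC (op_wl linC monC Z (gw [:: Y]))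
  (op_comp linC monC (op_cup linC monC (coev Z) [:: V; Y]) (op_assoc linC monC V Y [::])))).
exists h => U; rewrite /pihat /pitil -eh.
have -> : forall T, op_comp linC monC (op_wl linC monC Z (op_cap linC monC (ev Y) [::]))
  (op_comp linC monC (op_wl linC monC Z (gw [:: Y]))
  (op_comp linC monC (op_cup linC monC (coev Z) [:: V; Y]) (op_assoc linC monC V Y [::]))) T
  = (Z ◁ (cap (ev Y) T)) ⊚ (Z ◁ (gw [::] (Y ⊗ T))) ⊚ cup (coev Z) (V ⊗ (Y ⊗ T))
     ⊚ assoc V Y T.
  move=> T; rewrite -(op_capE linC monC (ev Y) [::] T).
  by rewrite -(op_cupE linC monC (coev Z) [:: V; Y] T) -gwY.
rewrite -gwE -!compA (tail0 _ (aVK _ _ _)) !wlM.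
rewrite (tail2 _ (cap_nat _ _)) (tail2 _ (cap_nat _ _)) (tail0 _ (zag _ _)).
by rewrite (op_nat (gw [::])) /= (tail0 _ (zag _ _)).
Qed.

End Hat.

Lemma op_zero X Y (f : op [:: X] [:: Y]) U : simple_object X -> simple_object Y ->
  ~ isomorphic X Y -> f U = 0.
Proof.
move=> sX sY nXY; have [g ->] := op_rep linC monC f.
by rewrite (schur_zero linC abC g sX sY nXY) (wr0 monC).
Qed.

Lemma op_scalar X (f : op [:: X] [:: X]) : simple_object X ->
  exists c, forall U, f U = c *: idmor (X ⊗ U).
Proof.
move=> sX; have [g eg] := op_rep linC monC f.
have [c ec] := schur_scalar linC abC g sX.
by exists c => U; rewrite eg ec (wrZ monC) tens_id.
Qed.

Lemma traceL_scale X c : traceL (c *: idmor X) = c * dimL X.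
Proof.
apply: (scale_idI fusC); rewrite -traceL_word // (wrZ monC) (wlZ monC).
by rewrite compZl compZr !tens_id comp1m dimL_word // scalerA.
Qed.

Lemma dimL_neq0 X : simple_object X -> dimL X != 0.
Proof. by move=> sX; rewrite -dimR_dual // dimR_neq0 //; apply: (dual_simple fusC). Qed.

(** The composite is a scalar on Y^* by Schur's lemma. Its trace, by [hat_trace], is also e
    dim^L(Z); the ratio of left dimensions comes from this comparison. *)
Lemma hat_scalar V Y Z (q : mor (V ⊗ Y) Z) (r : mor Z (V ⊗ Y)) e U :
  simple_object Y -> q ∘ r = e *: idmor Z ->
  pihat q U ∘ iohat r U = (e * dimL Z / dimL Y) *: idmor (dual Y ⊗ U).
Proof.
move=> sY qr.
have [c hc] := op_scalar (op_comp linC monC (op_pihat q) (op_iohat r)) (dual_simple fusC sY).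
have {}hc T : pihat q T ∘ iohat r T = c *: idmor _.
  by rewrite -hc /= -op_pihatE -op_iohatE.
rewrite hc; congr (_ *: _); apply: (canRL (mulfK (dimL_neq0 sY))).
rewrite -[in RHS]traceL_scale -qr; apply: (scale_idI fusC); rewrite -hat_trace.
by rewrite (compA (pihat _ _)) hc compZl comp1m compZr dimL_word // scalerA.
Qed.

(** * Moving a ring across a strand *)

Section Slide.
Variables (W V : C) (z : Irr).
Local Notation Z := (s z).

Variables (n : Irr -> nat) (q : forall y i, 'I_(n y) -> mor (V ⊗ s y) (s i))
  (r : forall y i, 'I_(n y) -> mor (s i) (V ⊗ s y)).
Arguments q : clear implicits.
Arguments r : clear implicits.
Hypothesis VYP : forall y, [/\ forall i a b, a != b -> q y i a ∘ r y i b = 0,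
  forall i a, q y i a ∘ r y i a = idmor (s i) \/ q y i a = 0 /\ r y i a = 0
  & \sum_i \sum_a (r y i a ∘ q y i a) = idmor (V ⊗ s y)].

Lemma hom_expand y (h : mor (V ⊗ s y) Z) : exists c : 'I_(n y) -> k,
  h = \sum_a c a *: q y z a.
Proof.
have [_ _ e] := VYP y.
have /choice[c hc] : forall a, exists c, h ∘ r y z a = c *: idmor Z.
  by move=> a; apply: (schur_scalar linC abC (h ∘ r y z a) (s_simple z)).
exists c.
rewrite -{1}(compm1 h) -e (comp_sumr linC) (bigD1 z) //= [X in _ + X]big1 => [|i ni].
  rewrite addr0 (comp_sumr linC); apply: eq_bigr => a _.
  by rewrite compA hc compZl comp1m.
rewrite (comp_sumr linC) big1 // => a _.
rewrite compA (schur_zero linC abC (h ∘ r y i a)) ?(comp0m linC) //; try exact: s_simple.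
by move/(s_inj irr_s)/eqP; apply/negP.
Qed.

Lemma q_r y a b : exists e : k, q y z a ∘ r y z b = e *: idmor Z /\
  (if a == b then e *: q y z a = q y z a else e = 0).
Proof.
have [e1 e2 _] := VYP y.
case: eqVneq => [<-|nab]; last by exists 0; rewrite e1 // scale0r.
case: (e2 z a) => [->|[-> _]]; first by exists 1; rewrite !scale1r.
by exists 0; rewrite (comp0m linC) !scale0r.
Qed.

(** Completeness of the rotated vertices: by [hat_scalar], those of type [y] become dual families
    after rescaling by dim^L(s y) / dim^L(Z). The identity is tested against all morphisms from Z^*
    ⊗ V to duals of simple objects, which are combinations of the [pihat] by [pihat_surj] and
    [hom_expand]. *)
Lemma hat_sum U : \sum_y dimL (s y) *: \sum_a (iohat (r y z a) U ∘ pihat (q y z a) U)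
  = dimL Z *: idmor (dual Z ⊗ (V ⊗ U)).
Proof.
set Psi := LHS.
have testP y (g : mor (dual Z ⊗ V) (dual (s y))) :
   ((g ▷ U) ∘ associ (dual Z) V U) ∘ Psi = dimL Z *: ((g ▷ U) ∘ associ (dual Z) V U).
  have [h <-] := pihat_surj g; have [c ->] := hom_expand h.
  rewrite pihat_sum (comp_suml linC) scaler_sumr; apply: eq_bigr => a _.
  rewrite compZl scalerA [dimL Z * _]mulrC -scalerA; congr (_ *: _).
  rewrite /Psi (comp_sumr linC) (bigD1 y) //= [X in _ + X]big1 => [|x nx].
    rewrite addr0 compZr (comp_sumr linC) (bigD1 a) //= [X in _ + X]big1 => [|b nb].
      have [e [he]] := q_r a a; rewrite eqxx => eq_.
      rewrite addr0 compA (hat_scalar U (s_simple y) he) compZl comp1m scalerA.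
      rewrite mulrC divfK ?(dimL_neq0 (s_simple y)) // mulrC -scalerA; congr (_ *: _).
      have := pihat_sum (fun _ : 'I_1 => e) (fun=> q y z a) U.
      by rewrite !big_ord1 eq_ => <-.
    have [e [he]] := q_r a b; rewrite eq_sym (negPf nb) => e0.
    by rewrite compA (hat_scalar U (s_simple y) he) e0 !mul0r scale0r (comp0m linC).
  rewrite compZr (comp_sumr linC) big1 ?scaler0 // => b _.
  rewrite compA (_ : pihat _ _ ∘ iohat _ _ = 0) ?(comp0m linC) //.
  rewrite -op_pihatE -op_iohatE.
  apply: (op_zero (op_comp linC monC (op_pihat (q y z a)) (op_iohat (r x z b))) U).
  - exact: (dual_simple fusC (s_simple x)).
  - exact: (dual_simple fusC (s_simple y)).
  move/(dual_isoP fusC (s_simple x) (s_simple y))/(s_inj irr_s)/eqP.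
  by apply/negP.
have [m [c [ii [p [_ _ ip]]]]] := simple_decomp fusC irr_s (dual Z ⊗ V); simpl in ii, p.
have idE : idmor (dual Z ⊗ (V ⊗ U)) = \sum_j
    (assoc (dual Z) V U ⊚ (ii j ▷ U) ⊚ (p j ▷ U) ⊚ associ (dual Z) V U).
  rewrite -(comp_sumr linC) -aVK -{1}(comp1m (associ _ _ _)) -tens_id -ip.
  rewrite (wr_sum monC) (comp_suml linC) !(comp_sumr linC); apply: eq_bigr => j _.
  by rewrite wrM -!compA.
rewrite -(comp1m Psi) idE (comp_suml linC) scaler_sumr; apply: eq_bigr => j _.
(* [testP] treats targets of the form [dual (s y)]; since [star] is an involution, every simple
   object is isomorphic to one of these. *)
have [f [f' [ff _]]] : isomorphic (s (c j)) (dual (s (star fusC irr_s (c j)))).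
  rewrite -{1}(starK fusC irr_s (c j)); exact/iso_sym/starP.
have -> : p j = f' ∘ (f ∘ p j) by rewrite compA ff comp1m.
by rewrite wrM -!compA (compA (_ ▷ U) (associ _ _ _) Psi) testP !compZr.
Qed.

(** Inserting [hat_sum] on the strands Z^* and [V] fuses [V] into the ring: [V] merges with the
    strand [s y] into [Z], passes around [W], and splits off again. *)
Lemma ring_pull U :
  dimL Z *: ring W Z (V ⊗ U) = \sum_y dimL (s y) *: \sum_a
   ((W ◁ (iotil (r y z a) U)) ⊚ mw W Z (dual (s y) ⊗ U) ⊚ (W ◁ (pitil (q y z a) U))).
Proof.
transitivity ((W ◁ (cap (evR Z) (V ⊗ U))) ⊚ mw W Z (dual Z ⊗ (V ⊗ U)) ⊚
   (W ◁ (Z ◁ (dimL Z *: idmor (dual Z ⊗ (V ⊗ U))))) ⊚ (W ◁ (cup (coev Z) (V ⊗ U)))).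
  by rewrite !(wlZ monC) !tens_id compZl comp1m !compZr ringE.
rewrite -hat_sum !(wl_sum monC) !(comp_suml linC) !(comp_sumr linC).
apply: eq_bigr => y _; rewrite !(wlZ monC) !compZl !compZr; congr (_ *: _).
rewrite !(wl_sum monC) !(comp_suml linC) !(comp_sumr linC); apply: eq_bigr => a _.
rewrite -iotilE -pitilE.
move: (iohat _ _) (pihat _ _) => i p.
by rewrite !wlM -!compA (tail2 _ (mw_nat fusC _ _ _)).
Qed.

End Slide.

(** The scalar [chi W Y] is a ring of color [Y] on [W]. Together with the monodromy of [V] it forms
    the monodromy of [W] with V ⊗ Y, which is expanded into simple objects. The terms are those of
    [ring_pull], summed over [z] instead of [y]. *)
Lemma mw_slide W V Y U (simpleW : simple_object W) n
  (q : forall i, 'I_n -> mor (V ⊗ Y) (s i)) (r : forall i, 'I_n -> mor (s i) (V ⊗ Y)) :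
  \sum_i \sum_a (r i a ∘ q i a) = idmor (V ⊗ Y) ->
  chi W Y *: mw W V U = \sum_z \sum_a
   ((W ◁ (iotil (r z a) U)) ⊚ mw W (s z) (dual Y ⊗ U) ⊚ (W ◁ (pitil (q z a) U))).
Proof.
move=> e; transitivity (bw V W U ⊚ (V ◁ (ring W Y U)) ⊚ bw W V U).
  by rewrite ring_simple // (wlZ monC) tens_id compZl comp1m compZr mw_bw.
rewrite ringE !wlM -!compA (tail2 _ (bw_nat fusC _ _ _)) -(bw_nat fusC).
have := mw_tensr fusC W V Y (dual Y ⊗ U).
move=> /(congr1 (fun f => f ∘ (W ◁ (associ V Y (dual Y ⊗ U))))).
rewrite -!compA -wlM aVK tens_id compm1 => E.
have mwE T : mw W (V ⊗ Y) T = \sum_z \sum_a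
    ((W ◁ (r z a ▷ T)) ⊚ mw W (s z) T ⊚ (W ◁ (q z a ▷ T))).
  rewrite -[mw _ _ _]comp1m -tens_id -(tens_id (V ⊗ Y)) -e.
  rewrite (wr_sum monC) (wl_sum monC) (comp_suml linC); apply: eq_bigr => z _.
  rewrite (wr_sum monC) (wl_sum monC) (comp_suml linC); apply: eq_bigr => a _.
  by rewrite wrM wlM -compA -(mw_natr fusC).
have -> : bw V W (Y ⊗ (dual Y ⊗ U)) ⊚ (V ◁ (mw W Y (dual Y ⊗ U))) ⊚
    bw W V (Y ⊗ (dual Y ⊗ U)) ⊚ (W ◁ (V ◁ (cup (coev Y) U)))
  = (W ◁ (assoc V Y (dual Y ⊗ U))) ⊚ mw W (V ⊗ Y) (dual Y ⊗ U) ⊚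
    (W ◁ (associ V Y (dual Y ⊗ U))) ⊚ (W ◁ (V ◁ (cup (coev Y) U))).
  rewrite (compA (mw W _ _)) (compA (W ◁ _)) E -!compA.
  by [].
rewrite mwE (comp_suml linC) !(comp_sumr linC); apply: eq_bigr => z _.
rewrite (comp_suml linC) !(comp_sumr linC); apply: eq_bigr => a _.
by rewrite /iotil /pitil !wlM -!compA.
Qed.

(* Expanding [V ⊗ s y] into simples and rotating the summands moves the ring of
   color [y] across the strand [V], which turns [mw W V] into the identity. *)
Lemma handle_slide W V U : simple_object W ->
  (\sum_y dimL (s y) * chi W (s y)) *: mw W V U
  = (\sum_y dimL (s y) * chi W (s y)) *: idmor (W ⊗ (V ⊗ U)).
Proof.
move=> sW.
pose n y := projT1 (cid (isotypic (V ⊗ s y))).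
have /(_ _)/cid h y : exists qr :
    (forall i, 'I_(n y) -> mor (V ⊗ s y) (s i)) * (forall i, 'I_(n y) -> mor (s i) (V ⊗ s y)),
  [/\ forall i a b, a != b -> qr.1 i a ∘ qr.2 i b = 0,
      forall i a, qr.1 i a ∘ qr.2 i a = idmor (s i) \/ qr.1 i a = 0 /\ qr.2 i a = 0
    & \sum_i \sum_a (qr.2 i a ∘ qr.1 i a) = idmor (V ⊗ s y)].
  by have [q [r h]] := projT2 (cid (isotypic (V ⊗ s y))); exists (q, r).
have [q [r VYP]] : exists (q : forall y i, 'I_(n y) -> mor (V ⊗ s y) (s i))
  (r : forall y i, 'I_(n y) -> mor (s i) (V ⊗ s y)),
  forall y, [/\ forall i a b, a != b -> q y i a ∘ r y i b = 0,
      forall i a, q y i a ∘ r y i a = idmor (s i) \/ q y i a = 0 /\ r y i a = 0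
    & \sum_i \sum_a (r y i a ∘ q y i a) = idmor (V ⊗ s y)].
  exists (fun y => (projT1 (h y)).1), (fun y => (projT1 (h y)).2) => y.
  exact: projT2 (h y).
rewrite [RHS]scaler_suml.
transitivity (\sum_z dimL (s z) *: ring W (s z) (V ⊗ U)); last first.
  by apply: eq_bigr => z _; rewrite ring_simple // scalerA.
under [RHS]eq_bigr => z _ do rewrite (ring_pull _ _ VYP).
rewrite exchange_big scaler_suml; apply: eq_bigr => y _.
rewrite -scalerA -scaler_sumr; congr (_ *: _).
by have [_ _ e] := VYP y; apply: mw_slide.
Qed.

(* Nondegeneracy enters here: a simple object with nonzero total ring scalar is
   transparent. *)
Lemma nondeg_killing W : nondegenerate_category C -> simple_object W ->
  ~ isomorphic W one -> \sum_y dimL (s y) * chi W (s y) = 0.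
Proof.
move=> ndC sW nW; apply/eqP/negPn/negP => t0; apply: nW.
have [|n [ii [p [pi _ ip]]]] := ndC W.
  move=> V; apply: (mw_inj fusC).
  by apply: (scalerI t0); apply: handle_slide.
have [j _] : exists j : 'I_n, True.
  apply: contrapT => nj; case: sW => W0 _; apply: W0.
  rewrite /is_zero -ip big1 // => j; by case: nj; exists j.
have nz : p j != 0.
  apply/eqP => p0; case: (fusion_unit fusC) => h _; apply: h.
  by rewrite /is_zero -(pi j) p0 (comp0m linC).
by exists (p j); apply: (schur_iso linC abC sW (fusion_unit fusC) nz).
Qed.

End HandleSlide.

(** * The square of the S-matrix *)

Section Modular.
Variables (k : closedFieldType) (C : pivotalData k).
Hypothesis fusC : braided_pivotal_fusion C.
Implicit Types U V W X Y Z : C.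

Local Notation linC := (fusion_linear fusC).
Local Notation monC := (fusion_monoidal fusC).
Local Notation one := (unit_obj : C).

Variables (Irr : finType) (s : Irr -> C).
Hypothesis irr_s : simple_system s.
Local Notation s_simple := (s_simple irr_s).
Hypotheses (char0 : [pchar k] =i pred0) (ndC : nondegenerate_category C).
Local Notation s_inj := (s_inj irr_s).
Local Notation star := (star fusC irr_s).
Local Notation starP := (starP fusC irr_s).
Local Notation starK := (starK fusC irr_s).
Local Notation is_character := (is_character s).

Lemma iso_of_mult X i : (forall l, mult s X l = (l == i)) -> isomorphic X (s i).
Proof.
move=> m; have [n [c dX]] := simple_decomp fusC irr_s X.
have n1 : n = 1%N.
  transitivity (\sum_l mult s X l)%N; last first.
    by rewrite (bigD1 i) //= m eqxx big1 // => l /negPf nl; rewrite m nl.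
  under eq_bigr do rewrite (proj1 (mult_sum fusC irr_s _ dX)).
  rewrite exchange_big /= (eq_bigr (fun=> 1%N)) ?sum1_card ?card_ord // => j _.
  by rewrite (bigD1 (c j)) //= eqxx big1 // => l /negPf nl; rewrite eq_sym nl.
subst n; have := m i; rewrite eqxx (proj1 (mult_sum fusC irr_s _ dX)) big_ord1.
case: eqP => // <- _; case: dX => [ii [p [pi _]]]; rewrite big_ord1 => ip.
by exists (p ord0), (ii ord0); split => //; apply: pi.
Qed.

Lemma dual_unit_iso : isomorphic (dual one) one.
Proof.
have su := fusion_unit fusC.
apply/(dim_hom_isoP fusC (dual_simple fusC su) su).
rewrite (dim_hom_iso fusC (iso_sym (runit_iso monC _)) (iso_refl linC _)).
rewrite dim_hom_dual // (dim_hom_iso fusC (iso_refl linC _) (lunit_iso monC _)).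
by rewrite dim_end_simple.
Qed.

(** The multiplicities in the dual of X ⊗ Y and in Y^* ⊗ X^* agree by adjunction, and the values of
    [phi] commute. *)
Lemma character_dual phi : is_character phi -> is_character (phi \o @dual k C).
Proof.
move=> hp; have [ap mp p1] := hp; split=> [X|X Y|] /=.
- rewrite ap (reindex_inj (can_inj starK)); apply: eq_bigr => l _ /=.
  by rewrite mult_dual (character_star fusC irr_s _ hp).
- rewrite mulrC -mp !ap; apply: eq_bigr => l _; congr (_%:R * _).
  rewrite -(starK l) mult_dual [RHS]/mult.
  rewrite -(dim_hom_iso fusC (iso_refl linC _) (starP _)) dim_hom_dual //.
  rewrite (dim_hom_iso fusC (iso_refl linC _) (braid_isom fusC _ _)) -dim_hom_dual //.
  rewrite (mult_hom fusC irr_s) -dim_hom_dual //; apply: (dim_hom_iso fusC _ (iso_refl linC _)).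
  apply: (iso_trans linC (braid_isom fusC _ _)).
  exact: (tens_iso monC (piv_isom fusC _) (iso_refl linC _)).
by rewrite (additive_iso fusC ap dual_unit_iso).
Qed.

Definition Sirr i j := Smat (s i) (s j).
Definition chis i := chi (s i).
Definition global_dim := \sum_y dimL (s y) * dimR (s y).
Definition i0 : Irr := projT1 (cid (unit_index fusC irr_s)).

Lemma i0P : isomorphic one (s i0).
Proof. exact: projT2 (cid (unit_index fusC irr_s)). Qed.

Let d_neq0 i : dimR (s i) != 0 := dimR_neq0 fusC (s_simple i).

Lemma global_dim_neq0 : global_dim != 0.
Proof.
rewrite /global_dim; under eq_bigr do rewrite mulrC -dimR_dual //.
exact: (character_norm fusC irr_s char0 (dimR_character fusC irr_s)).
Qed.

Lemma SirrC i j : Sirr i j = Sirr j i.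
Proof. exact: SmatC. Qed.

Lemma SirrE i j : Sirr i j = chis i (s j) * dimR (s i).
Proof. by rewrite /chis /chi divfK. Qed.

Lemma chis_char i : is_character (chis i).
Proof. exact: (chi_character fusC irr_s (s_simple i)). Qed.

Lemma chis_iso i Y Z : isomorphic Y Z -> chis i Y = chis i Z.
Proof. by have [h _ _] := chis_char i; apply: (additive_iso fusC h). Qed.

Lemma dimR_i0 : dimR (s i0) = 1.
Proof. by rewrite -(dimR_iso fusC i0P) dimR_unit. Qed.

Lemma chis_i0 Y : chis i0 Y = dimR Y.
Proof.
rewrite /chis /chi dimR_i0 divr1 SmatC // -(Smat_iso fusC _ i0P).
by rewrite SmatC // Smat1.
Qed.

Lemma killing i : \sum_y dimL (s y) * chis i (s y) = (i == i0)%:R * global_dim.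
Proof.
case: eqVneq => [->|ni]; last first.
  rewrite mul0r; apply: (nondeg_killing fusC irr_s ndC (s_simple i)) => h.
  by move/eqP: ni; apply; apply/s_inj/(iso_trans linC h i0P).
by rewrite mul1r; apply: eq_bigr => y _; rewrite chis_i0.
Qed.

(** Exhibits the inverse of S up to dim(C). By multiplicativity the summand is the row of [y]
    evaluated at s_i^* ⊗ s_j; in its expansion [killing] leaves only the multiplicity of the unit,
    which is the Kronecker delta. *)
Lemma Sirr_inverse i j :
  \sum_y dimL (s y) * chis y (dual (s i)) * Sirr y j = (i == j)%:R * global_dim.
Proof.
transitivity (\sum_y \sum_l dimL (s y) *
    ((mult s (dual (s i) ⊗ s j) l)%:R * (chis l (s y) * dimR (s l)))).
  apply: eq_bigr => y _; rewrite -mulrA -mulr_sumr; congr (_ * _).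
  have [a m _] := chis_char y.
  rewrite SirrE mulrA -m a mulr_suml; apply: eq_bigr => l _.
  by rewrite -mulrA -!SirrE SirrC.
rewrite exchange_big (bigD1 i0) //= [X in _ + X]big1 => [|l nl].
  rewrite addr0; under eq_bigr do rewrite dimR_i0 mulr1 mulrCA.
  rewrite -mulr_sumr killing eqxx mul1r; congr (_%:R * _).
  rewrite [LHS]/mult dim_hom_dual //.
  rewrite (dim_hom_iso fusC (iso_refl linC _)
    (iso_trans linC (tens_iso monC (iso_refl linC _) (iso_sym i0P)) (runit_iso monC _))).
  by rewrite -[LHS]/(mult s _ _) (mult_s fusC irr_s) eq_sym.
under eq_bigr do rewrite mulrCA (mulrA _ _ (dimR _)).
by rewrite -mulr_sumr -mulr_suml killing (negPf nl) mul0r mul0r mulr0.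
Qed.

Lemma Sirr_inj (f : Irr -> k) :
  (forall j, \sum_y Sirr j y * f y = 0) -> forall i, f i = 0.
Proof.
move=> h i; apply: (mulfI global_dim_neq0); rewrite mulr0.
transitivity (\sum_y dimL (s y) * chis y (dual (s i)) * (\sum_j Sirr y j * f j)).
  under eq_bigr do rewrite mulr_sumr.
  rewrite exchange_big (bigD1 i) //= [X in _ + X]big1 => [|j nj].
    rewrite addr0; under eq_bigr do rewrite mulrA.
    by rewrite -mulr_suml Sirr_inverse eqxx mul1r.
  under eq_bigr do rewrite mulrA.
  by rewrite -mulr_suml Sirr_inverse eq_sym (negPf nj) !mul0r.
by rewrite big1 // => y _; rewrite h mulr0.
Qed.

(** Equal characters make the columns [i] and [j] of S proportional; the diagonal value dim(C) of
    [Sirr_inverse] would then be a multiple of an off-diagonal value, that is, zero. *)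
Lemma chis_inj i j : (forall y, chis i (s y) = chis j (s y)) -> i = j.
Proof.
move=> h; apply/eqP; have := Sirr_inverse i i; rewrite eqxx mul1r.
case: eqVneq => // nij /eqP; rewrite eq_sym -subr_eq0 => /eqP e.
have := Sirr_inverse i j; rewrite (negPf nij) mul0r => z0.
move/eqP: global_dim_neq0; case; apply: (mulIf (d_neq0 j)); rewrite mul0r.
rewrite -[global_dim]subr0 -e opprB addrC subrK mulr_suml.
transitivity (\sum_y dimL (s y) * chis y (dual (s i)) * Sirr y j * dimR (s i)).
  apply: eq_bigr => y _; rewrite -!(mulrA (_ * _)); congr (_ * _).
  by rewrite SirrC SirrE h mulrAC -SirrE SirrC.
by rewrite -mulr_suml z0 mul0r.
Qed.

Lemma chis_distinct i j : i != j -> exists z, chis i (s z) <> chis j (s z).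
Proof.
move=> nij; apply: contrapT => h; case/eqP: nij; apply: chis_inj => y.
by apply: contrapT => n; apply: h; exists y.
Qed.

(** The function chi_i composed with duality is a character. Were it different from every chi_j,
    orthogonality would put the row [i] of S in the kernel of S; S being invertible, that row would
    vanish, but its entry at the unit is dim^R(s i). *)
Lemma bar_index_exists i : exists j, forall y, chis j (s y) = chis i (dual (s y)).
Proof.
apply: contrapT => h.
have n j : exists z, chis j (s z) <> chis i (dual (s z)).
  apply: contrapT => h'; apply: h; exists j => y.
  by apply: contrapT => e; apply: h'; exists y.
have z0 : Sirr i i0 = 0.
  apply: (@Sirr_inj (fun y => Sirr i y)) => j; have [z hz] := n j.
  have := character_orth fusC irr_s (chis_char j) (character_dual (chis_char i)) hz.
  move/(congr1 (fun x => x * (dimR (s j) * dimR (s i)))).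
  rewrite mul0r mulr_suml => e; apply: etrans e; apply: eq_bigr => y _.
  by rewrite !SirrE mulrACA (chis_iso i (piv_isom fusC (s y))).
move/eqP: z0; rewrite SirrC SirrE chis_i0 dimR_i0 mulr1.
exact/negP.
Qed.

Definition bar_index i : Irr := projT1 (cid (bar_index_exists i)).

Lemma chis_bar_index i y : chis (bar_index i) (s y) = chis i (dual (s y)).
Proof. exact: projT2 (cid (bar_index_exists i)) y. Qed.

Lemma chis_bar_index_dual i y : chis (bar_index i) (dual (s y)) = chis i (s y).
Proof.
by rewrite (chis_iso _ (starP y)) chis_bar_index (chis_iso _ (starP (star y))) starK.
Qed.

Lemma bar_indexK : involutive bar_index.
Proof. by move=> i; apply: chis_inj => y; rewrite chis_bar_index chis_bar_index_dual. Qed.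

Lemma Sirr2_zero i j : i != bar_index j -> \sum_y Sirr i y * Sirr y j = 0.
Proof.
move=> nij; have [z hz] := chis_distinct nij.
have := character_orth fusC irr_s (chis_char i) (chis_char (bar_index j)) hz.
move/(congr1 (fun x => x * (dimR (s i) * dimR (s j)))).
rewrite mul0r mulr_suml => e; apply: etrans e; apply: eq_bigr => y _.
by rewrite [Sirr y j]SirrC !SirrE chis_bar_index_dual mulrACA.
Qed.

Local Notation b := (bar_index i0).

Lemma chis_b y : chis b (s y) = dimL (s y).
Proof. by rewrite chis_bar_index chis_i0 dimR_dual. Qed.

(** The weight dim^L(s y) in [Sirr_inverse] is the character of bar 1 at [s y]. Up to the factor
    dim^R(bar 1), the inverse of S is therefore made of values of S at bar 1 ⊗ s_i^*. *)
Lemma Sirr2_tens i l : \sum_y Smat (s y) (s b ⊗ dual (s i)) * Sirr y l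
  = (i == l)%:R * (global_dim * dimR (s b)).
Proof.
rewrite mulrA -Sirr_inverse mulr_suml; apply: eq_bigr => y _.
rewrite mulrAC; congr (_ * _).
have [_ m _] := chis_char y.
rewrite -[Smat _ _](divfK (d_neq0 y)) -[_ / _]/(chis y _) m mulrAC -SirrE SirrC SirrE chis_b.
by rewrite mulrAC.
Qed.

(** Among the constituents of bar 1 ⊗ s_i^*, only bar l pairs with the column [l] of S, by
    [Sirr2_zero]. *)
Lemma Sirr2_mult i l : (mult s (s b ⊗ dual (s i)) (bar_index l))%:R
    * (\sum_y Sirr (bar_index l) y * Sirr y l)
  = (i == l)%:R * (global_dim * dimR (s b)).
Proof.
rewrite -Sirr2_tens.
transitivity (\sum_j (mult s (s b ⊗ dual (s i)) j)%:R * (\sum_y Sirr j y * Sirr y l)).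
  rewrite [RHS](bigD1 (bar_index l)) //= [X in _ + X]big1 ?addr0 // => j nj.
  by rewrite Sirr2_zero ?mulr0.
under eq_bigr do rewrite mulr_sumr.
rewrite exchange_big; apply: eq_bigr => y _ /=.
rewrite (Smat_additive fusC irr_s (s y)) mulr_suml.
by apply: eq_bigr => j _; rewrite mulrA SirrC.
Qed.

Lemma global_dim_dimR_bar_neq0 : global_dim * dimR (s b) != 0.
Proof. by rewrite mulf_neq0 ?global_dim_neq0. Qed.

(** The product in [Sirr2_mult] vanishes, while its second factor does not, by the same identity for
    equal indices; characteristic 0 turns the vanishing in [k] into that of the multiplicity. *)
Lemma mult_b i l : l != bar_index i -> mult s (s b ⊗ dual (s i)) l = 0%N.
Proof.
move=> nl; have := Sirr2_mult i (bar_index l);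
  rewrite bar_indexK (negPf (_ : i != bar_index l)); last first.
  by apply: contraNneq nl => ->; rewrite bar_indexK.
rewrite mul0r => /eqP; rewrite mulf_eq0 => /orP[|/eqP z0].
  by move/pcharf0P: char0 => -> /eqP.
have := Sirr2_mult (bar_index l) (bar_index l); rewrite bar_indexK z0 mulr0 eqxx mul1r => /esym/eqP.
by rewrite (negPf global_dim_dimR_bar_neq0).
Qed.

(** Since bar is an involution, [mult_b] leaves the unit as the only possible constituent; it occurs
    once because bar 1 is simple. *)
Lemma b_inv : isomorphic (s b ⊗ dual (s b)) one.
Proof.
apply: (iso_trans linC _ (iso_sym i0P)); apply: iso_of_mult => l.
case: (eqVneq l i0) => [->|nl]; last by apply: mult_b; rewrite bar_indexK.
rewrite (mult_hom fusC irr_s) -dim_hom_dual //.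
rewrite (dim_hom_iso fusC (iso_trans linC (tens_iso monC (iso_refl linC _) (iso_sym i0P))
  (runit_iso monC _)) (iso_refl linC _)).
exact: (dim_end_simple fusC (dual_simple fusC (s_simple b))).
Qed.

(** Tensoring with the invertible object bar 1 keeps s_i^* simple, so the single constituent allowed
    by [mult_b] is the whole object. *)
Lemma b_tens i : isomorphic (s b ⊗ dual (s i)) (s (bar_index i)).
Proof.
have sB : simple_object (s b ⊗ dual (s i)).
  apply/(dim_simpleP fusC); rewrite -dim_hom_dual //.
  have i1 : isomorphic (dual (s b) ⊗ (s b ⊗ dual (s i))) (dual (s i)).
    apply: (iso_trans linC (iso_sym (assoc_iso monC _ _ _))).
    apply: (iso_trans linC _ (lunit_iso monC _)).
    apply: (tens_iso monC _ (iso_refl linC _)).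
    exact: (iso_trans linC (braid_isom fusC _ _) b_inv).
  rewrite (dim_hom_iso fusC i1 (iso_refl linC _)).
  exact: (dim_end_simple fusC (dual_simple fusC (s_simple i))).
have [_ _ /(_ _ sB)[j hj]] := irr_s.
suff <- : j = bar_index i by [].
apply/eqP/negPn/negP => nj.
by have := mult_b nj; rewrite (mult_iso fusC s _ hj) (mult_s fusC irr_s) eqxx.
Qed.

Lemma Sirr2 i j : \sum_y Sirr i y * Sirr y j = (i == bar_index j)%:R * (global_dim * dimR (s b)).
Proof.
case: eqVneq => [->|nij]; last by rewrite Sirr2_zero // mul0r.
have := Sirr2_mult j j; rewrite eqxx mul1r => <-.
by rewrite (mult_iso fusC s _ (b_tens j)) (mult_s fusC irr_s) eqxx !mul1r.
Qed.

Lemma is_barP i j : is_bar (s i) (s j) <-> j = bar_index i.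
Proof.
split=> [h|-> Y sY].
  apply: chis_inj => y; rewrite chis_bar_index; symmetry; exact: (h (s y) (s_simple y)).
have [_ _ /(_ _ sY)[y hy]] := irr_s.
rewrite -[LHS]/(chis i _) -[RHS]/(chis (bar_index i) _) (chis_iso _ hy) chis_bar_index.
by apply: chis_iso; apply: (dual_iso_simple fusC sY).
Qed.

Lemma bar_s i : bar s (s i) = s (bar_index i).
Proof.
rewrite /bar; case: pickP => [j /asboolP/is_barP -> //|/(_ (bar_index i))/asboolP].
by case; apply/is_barP.
Qed.

Lemma is_bar_iso Y Y' Z : isomorphic Y Y' -> is_bar Y Z -> is_bar Y' Z.
Proof.
move=> i h U sU; rewrite -(h U sU) (dimR_iso fusC i); congr (_ / _).
by rewrite SmatC // -(Smat_iso fusC _ i) SmatC.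
Qed.

Lemma bar_one : bar s one = s b.
Proof.
rewrite /bar; case: pickP => [j /asboolP/(is_bar_iso i0P)/is_barP -> //|/(_ b)/asboolP].
by case; apply: (is_bar_iso (iso_sym i0P)); apply/is_barP.
Qed.

End Modular.

(** * One-dimensional representations *)

Section Lines.
Variables (k : closedFieldType) (A : finGroupType).
Implicit Types (V W : rep k A) (alpha beta : linear_character k A).

(* The sum of the entries of a morphism: for one-dimensional representations
   this is the coefficient of the corresponding 1 x 1 matrix. *)
Definition entry_sum V W (f : rhom V W) : k := \sum_i \sum_j vsval f i j.

Lemma sum_ord_one n (h : 'I_n -> k) (m : 'I_n) : n = 1%N -> \sum_j h j = h m.
Proof.
by move=> n1; move: h m; rewrite n1 => h m; rewrite big_ord1 (ord1 ord0) (ord1 m).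
Qed.

Lemma entry_sum_comp U V W (g : rhom V W) (f : rhom U V) : rdim V = 1%N ->
  entry_sum (rcomp g f) = entry_sum g * entry_sum f.
Proof.
move=> dV; rewrite /entry_sum /= mulrC.
have [m _] : exists m : 'I_(rdim V), True by rewrite dV; exists ord0.
rewrite (sum_ord_one _ m dV) mulr_suml; apply: eq_bigr => i _.
rewrite (sum_ord_one _ m dV) mulr_sumr; apply: eq_bigr => j _.
by rewrite mxE (sum_ord_one _ m dV).
Qed.

Lemma entry_sum_tens V V' W W' (f : rhom V V') (g : rhom W W') :
  entry_sum (rtensm f g) = entry_sum f * entry_sum g.
Proof.
have sumI m n (h : 'I_(m * n) -> k) : \sum_i h i = \sum_i \sum_j h (mxtens_index (i, j)).
  rewrite (reindex (@mxtens_index m n)) /=; last first.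
    exists (@mxtens_unindex m n) => p _; first exact: mxtens_indexK.
    exact: mxtens_unindexK.
  by rewrite pair_bigA; apply: eq_bigr => -[].
rewrite /entry_sum sumI mulr_suml; apply: eq_bigr => i _.
transitivity (\sum_i' \sum_j \sum_j' vsval f i j * vsval g i' j').
  apply: eq_bigr => i' _; rewrite sumI; apply: eq_bigr => j _.
  by apply: eq_bigr => j' _; rewrite /= tensmxE.
rewrite exchange_big mulr_suml; apply: eq_bigr => j _ /=.
by rewrite mulr_sumr; apply: eq_bigr => i' _; rewrite mulr_sumr.
Qed.

Lemma entry_sum_inj V W (f g : rhom V W) : rdim V = 1%N -> rdim W = 1%N ->
  entry_sum f = entry_sum g -> f = g.
Proof.
move=> dV dW e; apply: val_inj; apply/matrixP; move: e; rewrite /entry_sum /=.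
move: (vsval f) (vsval g); rewrite dV dW => M N; rewrite !big_ord1 => e i j.
by rewrite !ord1.
Qed.

Lemma entry_sum_basis V W f f' fK f'K f_act :
  entry_sum (@basis_hom k A V W f f' fK f'K f_act)
  = (rdim V)%:R.
Proof.
rewrite /entry_sum (eq_bigr (fun=> 1)) ?sumr_const ?card_ord // => i _.
rewrite (bigD1 (f i)) //= mxE eqxx big1 ?addr0 // => j /negPf nj.
by rewrite mxE eq_sym nj.
Qed.

Lemma entry_sum_id V : entry_sum (rid V) = (rdim V)%:R.
Proof.
rewrite /entry_sum (eq_bigr (fun=> 1)) ?sumr_const ?card_ord // => i _.
rewrite (bigD1 i) //= mxE eqxx big1 ?addr0 // => j /negPf nj.
by rewrite mxE eq_sym nj.
Qed.

Lemma entry_sum_scale V W c (f : rhom V W) : entry_sum (c *: f) = c * entry_sum f.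
Proof.
rewrite /entry_sum mulr_sumr; apply: eq_bigr => i _; rewrite mulr_sumr.
by apply: eq_bigr => j _; rewrite linearZ mxE.
Qed.

Lemma entry_sum_ev V : rdim V = 1%N -> entry_sum (rev_ V) = 1.
Proof.
rewrite /entry_sum /= => dV.
have [m _] : exists m : 'I_(rdim V), True by rewrite dV; exists ord0.
rewrite (sum_ord_one _ (mxtens_index (m, m))) ?dV // big_ord1 mxE mxtens_indexK.
by rewrite eqxx.
Qed.

Lemma entry_sum_coev V : rdim V = 1%N -> entry_sum (rcoev V) = 1.
Proof.
move=> dV; rewrite -(entry_sum_ev dV) /entry_sum /= exchange_big /=.
by apply: eq_bigr => i _; apply: eq_bigr => j _; rewrite mxE.
Qed.

(** The dimension is 1 only up to a proof, so that tensor products and duals of lines are again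
    lines. *)
Definition line V (chi : A -> k) := rdim V = 1%N /\ forall g, V g = (chi g)%:M.

Lemma line_char alpha : line (char_rep alpha) alpha.
Proof. by []. Qed.

Lemma line_one : line (rone k A) (fun=> 1).
Proof. by []. Qed.

Lemma line_tens V W chi psi : line V chi -> line W psi ->
  line (rtens V W) (fun g => chi g * psi g).
Proof.
move=> [dV lV] [dW lW]; split=> [|g] /=; first by rewrite dV dW.
rewrite lV lW; apply/matrixP => i j.
case: (mxtens_indexP i) => i1 i2; case: (mxtens_indexP j) => j1 j2.
rewrite tensmxE !mxE (can_eq (@mxtens_indexK _ _)) xpair_eqE.
by case: eqP; case: eqP; rewrite ?mulr0n ?mulr1n ?mul0r ?mulr0.
Qed.

Lemma line_dual V chi : line V chi -> line (rdual V) (fun g => chi g^-1%g).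
Proof. by move=> [dV lV]; split=> // g /=; rewrite lV tr_scalar_mx. Qed.

Lemma line_iso V W chi psi : line V chi -> line W psi -> chi =1 psi ->
  @isomorphic k (rep_catData k A) V W.
Proof.
move=> [dV lV] [dW lW] e.
have h1 : @intertwines k A V W (const_mx 1).
  by move=> g; rewrite lV lW e mul_scalar_mx mul_mx_scalar.
have h2 : @intertwines k A W V (const_mx 1).
  by move=> g; rewrite lV lW e mul_scalar_mx mul_mx_scalar.
exists (to_rhom h1), (to_rhom h2); split; apply: val_inj => /=; apply/matrixP;
  move: dV dW; clear => dV dW.
  move: (rdim V) (rdim W) dV dW => n m -> -> i j.
  by rewrite !ord1 !mxE big_ord1 !mxE mulr1.
move: (rdim V) (rdim W) dV dW => n m -> -> i j.
by rewrite !ord1 !mxE big_ord1 !mxE mulr1.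
Qed.

Lemma is_linear_charM alpha beta :
  is_linear_character [ffun g => alpha g * beta g].
Proof.
rewrite /is_linear_character ffunE !char_1 mulr1 eqxx /=.
by apply/forallP => g; apply/forallP => h; rewrite !ffunE !char_M mulrACA.
Qed.
Definition charM alpha beta := LinearCharacter (is_linear_charM alpha beta).

Lemma is_linear_char1 : is_linear_character [ffun _ : A => 1 : k].
Proof.
rewrite /is_linear_character ffunE eqxx /=.
by apply/forallP => g; apply/forallP => h; rewrite !ffunE mulr1.
Qed.
Definition char1 := LinearCharacter is_linear_char1.

Lemma char_neq0 alpha g : alpha g != 0.
Proof.
apply/eqP => e; have := char_M alpha g g^-1%g; rewrite mulgV char_1 e mul0r.
by move/eqP; rewrite oner_eq0.
Qed.

Lemma charV_E alpha g : alpha g^-1%g = (alpha g)^-1.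
Proof.
apply: (mulfI (char_neq0 alpha g)); rewrite -char_M mulgV char_1 mulfV //.
exact: char_neq0.
Qed.

Lemma is_linear_charV alpha : is_linear_character [ffun g => (alpha g)^-1].
Proof.
rewrite /is_linear_character ffunE char_1 invr1 eqxx /=.
by apply/forallP => g; apply/forallP => h; rewrite !ffunE char_M invfM.
Qed.
Definition charV alpha := LinearCharacter (is_linear_charV alpha).

Lemma charME alpha beta g : charM alpha beta g = alpha g * beta g.
Proof. by rewrite /char_fun ffunE. Qed.
Lemma char1E g : char1 g = 1.
Proof. by rewrite /char_fun ffunE. Qed.
Lemma charVE alpha g : charV alpha g = (alpha g)^-1.
Proof. by rewrite /char_fun ffunE. Qed.

Lemma charP alpha beta : (forall g, alpha g = beta g) -> alpha = beta.
Proof. by move=> h; apply/val_inj/ffunP => g; apply: h. Qed.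

Section Braid.
Hypothesis (cA : abelian [set: A]) (char0 : [pchar k] =i pred0).
Variable z : A.
Hypothesis z2 : (z ^+ 2 = 1)%g.

Lemma char_z alpha : alpha z * alpha z = 1.
Proof. by rewrite -char_M -expg2 z2 char_1. Qed.

Lemma entry_sum_braid V W chi psi : line V chi -> line W psi ->
  entry_sum (rbraid cA z V W) = 2%:R^-1 * (1 + chi z + psi z - chi z * psi z).
Proof.
move=> [dV lV] [dW lW].
have [m _] : exists m : 'I_(rdim V), True by rewrite dV; exists ord0.
have [n _] : exists n : 'I_(rdim W), True by rewrite dW; exists ord0.
pose mn := mxtens_index (m, n).
have d1 : (rdim V * rdim W)%N = 1%N by rewrite dV dW.
have d2 : (rdim W * rdim V)%N = 1%N by rewrite dV dW.
rewrite /entry_sum (sum_ord_one _ mn d1) (sum_ord_one _ (flip_index mn) d2) mxE (sum_ord_one _ mn d1).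
have E N (c : k) (T1 T2 T3 T4 : 'M[k]_N) i j :
    (c *: (T1 + T2 + T3 - T4)) i j = c * (T1 i j + T2 i j + T3 i j - T4 i j).
  by rewrite !mxE.
rewrite [X in _ * X]mxE eqxx mulr1 /super_mx lV lW E !tensmxE !mxE !eqxx.
by rewrite !mulr1n !mul1r !mulr1.
Qed.

(** Since alpha(z)^2 = 1, half of 1 + 2 alpha(z) - 1 remains. *)
Lemma entry_sum_braid_char alpha :
  entry_sum (rbraid cA z (char_rep alpha) (char_rep alpha)) = alpha z.
Proof.
rewrite (entry_sum_braid (line_char alpha) (line_char alpha)) char_z.
have n2 : 2%:R != 0 :> k by move/pcharf0P: char0 => ->.
apply: (mulfI n2); rewrite mulrA mulfV // mul1r.
by rewrite mulr_natl mulr2n -(addrA 1) addrAC subrr add0r.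
Qed.

(* The pivotal structure of Rep(A,z) is the Drinfeld morphism; on lines the
   defining property of mates is an identity between coefficients. *)
Lemma rep_drinfeld V chi : line V chi ->
  rcomp (rev_ (rdual V)) (rtensm (drinfeld (V : rep_braidedData k cA z)) (rid (rdual V)))
  = rcomp (rev_ V) (rbraid cA z V (rdual V)).
Proof.
move=> [dV lV]; have dVV : (rdim V * rdim V)%N = 1%N by rewrite dV.
apply: entry_sum_inj => //; rewrite !entry_sum_comp // entry_sum_tens.
rewrite !entry_sum_ev // entry_sum_id !mul1r.
rewrite /drinfeld /mate /= !entry_sum_comp //=; try by rewrite ?dV.
rewrite !entry_sum_tens !entry_sum_id !entry_sum_basis entry_sum_comp //=.
rewrite entry_sum_ev // entry_sum_coev //.
by rewrite /= dV !mulr1 !mul1r.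
Qed.

End Braid.
End Lines.

(** * The image of Rep(A,z) in C, degrees and twists *)

Section Pointed.
Variables (k : closedFieldType) (C : pivotalData k).
Hypothesis fusC : braided_pivotal_fusion C.
Implicit Types U V W X Y Z : C.

Local Notation linC := (fusion_linear fusC).
Local Notation monC := (fusion_monoidal fusC).
Local Notation rigC := (fusion_rigid fusC).
Local Notation braC := (fusion_braided fusC).
Local Notation one := (unit_obj : C).
Local Notation compA := (compA linC).
Local Notation comp1m := (comp1m linC).
Local Notation compm1 := (compm1 linC).
Local Notation wlM := (wlM linC monC).
Local Notation wrM := (wrM linC monC).
Local Notation interchange := (interchange linC monC).
Local Notation compZl := (compZl linC).
Local Notation compZr := (compZr linC).
Local Notation tail0 := (tail0 linC).
Local Notation tail1 := (tail1 linC).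
Local Notation tail2 := (tail2 linC).
Local Notation cap_nat := (cap_nat linC monC).
Local Notation tens_id := (tensm_id monC).
Local Notation zig := (zig linC monC rigC).
Local Notation zag := (zag linC monC rigC).

Local Notation aK := (aK monC).
Local Notation aVK := (aVK monC).

Variables (A : finGroupType) (cA : abelian [set: A]) (z : A).
Hypotheses (char0 : [pchar k] =i pred0) (z2 : (z ^+ 2 = 1)%g).
Local Notation D := (rep_pivotalData k cA z).
Variable F : functorData D C.
Hypothesis embF : braided_pivotal_embedding F.
Implicit Types alpha beta : linear_character k A.

Local Notation fullF := (embedding_full embF).
Local Notation tensF := (embedding_monoidal embF).

Lemma fmap0 (V W : D) : fmap F (0 : mor V W) = 0.
Proof.
have := fmap_linear fullF 1 (0 : mor V W) 0; rewrite !scale1r addr0 => /eqP.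
by rewrite -subr_eq0 opprD addrA subrr add0r oppr_eq0 => /eqP.
Qed.

Lemma fmapZ (V W : D) c (f : mor V W) : fmap F (c *: f) = c *: fmap F f.
Proof. by have := fmap_linear fullF c f 0; rewrite fmap0 !addr0. Qed.

Lemma functor_iso (V W : D) : isomorphic V W -> isomorphic (F V) (F W).
Proof.
move=> [f [g [gf fg]]]; exists (fmap F f), (fmap F g).
by split; rewrite -(fmap_comp fullF) ?gf ?fg (fmap_id fullF).
Qed.

Lemma functor_tens (V W : D) : isomorphic (F V ⊗ F W) (F (V ⊗ W)).
Proof. by exists (ften F V W); apply: (ften_iso tensF). Qed.

Lemma functor_unit : isomorphic one (F unit_obj).
Proof. by exists (fone F); apply: (fone_iso tensF). Qed.

Lemma mate_ev Z Y (p : mor (Z ⊗ Y) one) : ev Y ∘ (mate p ▷ Y) = p.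
Proof.
apply: (wr1_inj linC monC); apply: (iso_epiE linC (f := associ Z Y one)).
  by exists (assoc Z Y one); apply/inverse_sym/(assocK monC).
apply: (iso_monoE linC (l_iso monC one)); rewrite -capE -[RHS]capE.
by rewrite (cap_wr linC monC) (mate_cap linC monC rigC).
Qed.

(** Tensoring with G' is faithful, so End(G ⊗ Y) embeds into End(G' ⊗ (G ⊗ Y)), which is End(Y) up
    to isomorphism and has dimension 1. *)
Lemma invertible_simple G G' Y : isomorphic (G' ⊗ G) one -> simple_object Y ->
  simple_object (G ⊗ Y).
Proof.
move=> iG' sY; apply/(dim_simpleP fusC).
have iG : isomorphic (G ⊗ G') one := iso_trans linC (braid_isom fusC _ _) iG'.
have i2 : isomorphic (G' ⊗ (G ⊗ Y)) Y.
  apply: (iso_trans linC (iso_sym (assoc_iso monC _ _ _))).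
  apply: (iso_trans linC (tens_iso monC iG' (iso_refl linC _))).
  exact: (lunit_iso monC).
have linw : linear (fun f : mor (G ⊗ Y) (G ⊗ Y) => G' ◁ f).
  by move=> c f g; rewrite (wlD monC) (wlZ monC).
have injw : injective (fun f : mor (G ⊗ Y) (G ⊗ Y) => G' ◁ f).
  move=> f g /(congr1 (fun h => associ G G' _ ⊚ (G ◁ h) ⊚ assoc G G' _)).
  rewrite -!(a_nat_r monC) !(tail0 _ (aK _ _ _)) => e.
  have [u [v [vu uv]]] := iG.
  apply: (wl1_inj linC monC); move: e.
  move/(congr1 (fun h => (u ▷ _) ⊚ h ⊚ (v ▷ _))).
  by rewrite -!interchange !compA -!wrM uv tens_id !comp1m.
apply/eqP; rewrite eqn_leq (leq_trans (dim_le_inj linw injw)) /=; last first.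
  by rewrite (dim_hom_iso fusC i2 i2) dim_end_simple.
rewrite lt0n dimv_eq0; apply/eqP => e.
have z1 : idmor (G ⊗ Y) = 0.
  by apply/eqP; rewrite -memv0 -e memvf.
have [f [g [gf fg]]] := i2; case: sY => Y0 _; apply: Y0.
by rewrite /is_zero -fg -[f]compm1 -tens_id z1 (wl0 monC) (compm0 linC) (comp0m linC).
Qed.

Local Notation Xc alpha := (Xchar F alpha).

Lemma Xchar_tens alpha beta : isomorphic (Xc alpha ⊗ Xc beta) (Xc (charM alpha beta)).
Proof.
apply: (iso_trans linC (functor_tens _ _)); apply: functor_iso.
apply: (line_iso (line_tens (line_char alpha) (line_char beta)) (line_char _)).
by move=> g; rewrite charME.
Qed.

Lemma line_unit (V : D) chi : line V chi -> chi =1 (fun=> 1) -> isomorphic (F V) one.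
Proof.
move=> lV h; apply: (iso_trans linC _ (iso_sym functor_unit)); apply: functor_iso.
exact: (line_iso lV (line_one k A) h).
Qed.

Lemma Xchar_inv alpha beta : (forall g, alpha g * beta g = 1) ->
  isomorphic (Xc alpha ⊗ Xc beta) one.
Proof.
move=> h; apply: (iso_trans linC (Xchar_tens _ _)).
by apply: (line_unit (line_char _)) => g; rewrite charME.
Qed.

Lemma line_simple (V W : D) chi psi : line V chi -> line W psi ->
  (forall g, chi g * psi g = 1) -> simple_object (F V).
Proof.
move=> lV lW h; apply: (simple_iso fusC (runit_iso monC _)).
apply: (invertible_simple (G' := F W)) (fusion_unit fusC).
apply: (iso_trans linC (functor_tens _ _)).
by apply: (line_unit (line_tens lW lV)) => g; rewrite mulrC.
Qed.

Lemma Xchar_simple alpha : simple_object (Xc alpha).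
Proof.
apply: (line_simple (line_char alpha) (line_char (charV alpha))) => g.
by rewrite charVE mulfV // char_neq0.
Qed.

Lemma braid_Xchar alpha :
  braid (Xc alpha) (Xc alpha) = alpha z *: idmor (Xc alpha ⊗ Xc alpha).
Proof.
apply: (iso_monoE linC (ften_iso tensF _ _)); rewrite -(embedding_braided embF).
have -> : braid (char_rep alpha : D) (char_rep alpha) = alpha z *: idmor _.
  apply: entry_sum_inj => //; rewrite entry_sum_scale [LHS]entry_sum_braid_char //.
  by rewrite [entry_sum _]entry_sum_id mulr1.
by rewrite fmapZ (fmap_id fullF) compZl compZr comp1m compm1.
Qed.

Lemma Xchar_symmetric alpha beta :
  braid (Xc beta) (Xc alpha) ∘ braid (Xc alpha) (Xc beta)
  = idmor (Xc alpha ⊗ Xc beta).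
Proof.
apply: (iso_monoE linC (ften_iso tensF (char_rep alpha : D) (char_rep beta))).
rewrite compA -(embedding_braided embF) -compA -(embedding_braided embF).
rewrite compA -(fmap_comp fullF) compm1 -[RHS]comp1m -(fmap_id fullF).
congr (fmap F _ ∘ _).
apply: entry_sum_inj => //; rewrite [LHS]entry_sum_comp // (_ : entry_sum (rid _) = 1);
  last by rewrite entry_sum_id.
rewrite (entry_sum_braid _ _ (line_char alpha) (line_char beta)).
rewrite (entry_sum_braid _ _ (line_char beta) (line_char alpha)).
have n2 : 2%:R != 0 :> k by move/pcharf0P: char0 => ->.
have sq (gamma : linear_character k A) : gamma z = 1 \/ gamma z = - 1.
  by have /eqP := char_z z2 gamma; rewrite -expr2 sqrf_eq1 => /orP[] /eqP; [left|right].
rewrite [LHS]mulrC; case: (sq alpha) => ->; case: (sq beta) => ->.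
all: by field.
Qed.

Lemma dual_Xchar alpha : isomorphic (dual (Xc alpha)) (Xc (charV alpha)).
Proof.
have sd := dual_simple fusC (Xchar_simple alpha).
apply/(dim_hom_isoP fusC sd (Xchar_simple _)).
rewrite (dim_hom_iso fusC (iso_sym (runit_iso monC _)) (iso_refl linC _)).
rewrite dim_hom_dual //.
rewrite (dim_hom_iso fusC (iso_refl linC _) (Xchar_inv _)) ?dim_end_simple //.
  exact: (fusion_unit fusC).
by move=> g; rewrite charVE mulfV // char_neq0.
Qed.

Lemma cap_braid X Y (p : mor (Y ⊗ X) one) U :
  cap (p ∘ braid X Y) U = cap p U ∘ bw X Y U.
Proof. by rewrite bwE !capE wrM -!compA (tail0 _ (aK _ _ _)). Qed.

(** In Rep(A,z) the pivotal structure is the Drinfeld morphism; [embedding_pivotal] carries this to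
    the image of [F], up to the comparison [fdual]. *)
Lemma evR_functor_dual alpha (V : D := char_rep alpha) :
  (evR (F V)) ∘ (F V ◁ (fdual F V)) =
  (ev (F V) ∘ braid (F V) (dual (F V))) ∘ (F V ◁ (fdual F V)).
Proof.
rewrite /evR -!compA interchange.
have ev_dual X Y (f : mor X Y) : ev Y ∘ (dual Y ◁ f) = ev X ∘ (dualm f ▷ X).
  by rewrite mate_ev.
rewrite compA ev_dual -compA -wrM (embedding_pivotal embF) wrM compA.
rewrite mate_ev (braid_natural braC) (compA (ev _)) mate_ev.
rewrite -!compA; congr (_ ∘ _).
rewrite -(embedding_braided embF) -(fmap_id fullF) (ften_natural tensF).
rewrite !compA -!(fmap_comp fullF); congr (fmap F _ ∘ _).
exact: (rep_drinfeld cA z (line_char alpha)).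
Qed.

(** Expresses that X_alpha has trivial twist. [fdual] is nonzero because [F] is faithful and a line
    has nonzero evaluation; between simple objects it is then invertible and can be cancelled. *)
Lemma evR_Xchar alpha :
  evR (Xc alpha) = ev (Xc alpha) ∘ braid (Xc alpha) (dual (Xc alpha)).
Proof.
suff fi : is_iso (fdual F (char_rep alpha)).
  apply: (iso_epiE linC (wl_iso linC monC (Xc alpha) fi)).
  exact: evR_functor_dual.
have ldual := line_dual (line_char alpha).
apply: (schur_iso linC (fusion_abelian fusC)).
- apply: (line_simple ldual (line_char alpha)) => g.
  by rewrite -char_M mulVg char_1.
- exact: (dual_simple fusC (Xchar_simple alpha)).
apply/eqP => f0; set V : D := char_rep alpha.
have := mate_ev (inv_hom (fone F) ∘ fmap F (ev V) ∘ ften F (dual V) V).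
rewrite -/(fdual F V) f0 (wr0 monC) (compm0 linC) => /esym e.
have e1 : inv_hom (fone F) ∘ fmap F (ev V) = 0.
  apply: (iso_epiE linC (ften_iso tensF (dual V) V)).
  by rewrite e (comp0m linC).
have e2 : fmap F (ev V) = fmap F 0.
  have [_ h] := inv_homP (fone_iso tensF).
  by rewrite fmap0 -[LHS]comp1m -h -compA e1 (compm0 linC).
have /(congr1 (@entry_sum _ _ _ _)) := bij_inj (fmap_bij fullF _ _) e2.
rewrite [LHS]entry_sum_ev // -[0]/(0 : rhom _ _) -(scale0r (0 : rhom _ _)) entry_sum_scale mul0r.
by move/eqP; rewrite oner_eq0.
Qed.

(** By [evR_Xchar] the cap of the loop is an [ev] cap after a crossing. Pulling a strand off the
    [ev] cap costs the self-crossing alpha(z) and leaves a zigzag, whence alpha(z) dim^R(X_alpha) =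
    1. *)
Lemma dimR_Xchar alpha : dimR (Xc alpha) = alpha z.
Proof.
set x := Xc alpha; have sx : simple_object x := Xchar_simple alpha.
have az0 := char_neq0 alpha z.
have bx : bw x x one = alpha z *: idmor _.
  rewrite bwE braid_Xchar (wrZ monC) tens_id compZl compZr comp1m.
  by rewrite aVK.
have := cap_bwr fusC (ev x) x one; rewrite bx (wlZ monC) !tens_id.
rewrite compZl comp1m compZr => /(congr1 (fun h => h ∘ cup (coev x) (x ⊗ one))).
rewrite zig compZl -cap_braid -evR_Xchar dimR_word // scalerA.
rewrite -[X in _ = X]scale1r => /(scale_id_unitI fusC sx) e.
by apply: (mulfI az0); rewrite e char_z.
Qed.

(** [F] is full, so the isomorphism comes from a nonzero intertwiner between alpha and the trivial
    character. *)
Lemma Xchar_unit alpha : isomorphic (Xc alpha) one -> forall g, alpha g = 1.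
Proof.
move=> h; have [f [f' [ff _]]] := iso_trans linC h functor_unit.
have [G GK KG] := fmap_bij fullF (char_rep alpha : D) unit_obj.
move=> g; have := rhomP (G f) g; rewrite /= mul_scalar_mx mulmx1.
set M := vsval (G f) => e.
have M0 : M != 0.
  apply/eqP => M0; have G0 : G f = 0 by apply/val_inj.
  have f0 : f = 0 by rewrite -(KG f) G0 fmap0.
  have [s1 _] := Xchar_simple alpha; apply: s1.
  by rewrite /is_zero -ff f0 (compm0 linC).
apply/eqP; rewrite -subr_eq0 -[_ == 0]orbF -(negPf M0) -scaler_eq0.
by rewrite scalerBl scale1r e subrr.
Qed.

(** The monodromy is a scalar because X_alpha ⊗ Y is simple, and its trace is an entry of S. The
    factor alpha(z) is the inverse of dim^R(X_alpha). *)
Lemma monodromy_Xchar Y alpha : simple_object Y ->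
  braid Y (Xc alpha) ∘ braid (Xc alpha) Y
  = (alpha z * chi Y (Xc alpha)) *: idmor (Xc alpha ⊗ Y).
Proof.
move=> sY; have sXY : simple_object (Xc alpha ⊗ Y).
  apply: (invertible_simple (G' := Xc (charV alpha))) sY.
  by apply: Xchar_inv => g; rewrite charVE mulVf // char_neq0.
have [c e] := schur_scalar linC (fusion_abelian fusC)
  (braid Y (Xc alpha) ∘ braid (Xc alpha) Y) sXY.
rewrite e; congr (_ *: _).
rewrite /chi SmatC // /Smat e traceRZ // -/(dimR _) dimR_tens // dimR_Xchar.
rewrite (mulrA c) mulfK ?(dimR_neq0 fusC sY) //.
by rewrite mulrCA (char_z z2) mulr1.
Qed.

Lemma has_degreeP h Y : simple_object Y ->
  has_degree F h Y <-> forall alpha, chi Y (Xc alpha) = alpha z * alpha h.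
Proof.
move=> sY; rewrite /has_degree; split=> H alpha.
  have := H alpha; rewrite monodromy_Xchar // => e.
  have sXY : simple_object (Xc alpha ⊗ Y).
    apply: (invertible_simple (G' := Xc (charV alpha))) sY.
    by apply: Xchar_inv => g; rewrite charVE mulVf // char_neq0.
  have [n0 _] := sXY; move/eqP: e; rewrite -subr_eq0 -scalerBl scaler_eq0.
  case/orP => [|/eqP //]; rewrite subr_eq0 => /eqP <-.
  by rewrite mulrA (char_z z2) mul1r.
by rewrite monodromy_Xchar // H mulrA (char_z z2) mul1r.
Qed.

(* The partial trace of the self-braiding of [Y]: up to inversion, the twist. *)
Definition twist Y U : mor (Y ⊗ U) (Y ⊗ U) :=
  (Y ◁ (cap (evR Y) U)) ⊚ bw Y Y (dual Y ⊗ U) ⊚ (Y ◁ (cup (coev Y) U)).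

Definition op_twist Y : op [:: Y] [:: Y] :=
  op_comp linC monC (op_wl linC monC Y (op_cap linC monC (evR Y) [::]))
    (op_comp linC monC (op_bw fusC Y Y [:: dual Y])
       (op_wl linC monC Y (op_cup linC monC (coev Y) [::]))).

Lemma op_twistE Y U : op_twist Y U = twist Y U.
Proof.
rewrite /twist -(op_capE linC monC (evR Y) [::] U) -(op_bwE fusC Y Y [:: dual Y] U).
by rewrite -(op_cupE linC monC (coev Y) [::] U).
Qed.

Lemma twist_scalar Y : simple_object Y ->
  exists t, forall U, twist Y U = t *: idmor (Y ⊗ U).
Proof.
move=> sY; have [t ht] := op_scalar fusC (op_twist Y) sY.
by exists t => U; rewrite -op_twistE ht.
Qed.

(** With the cup pulled through the crossing, t = 0 makes the [evR] cap after an inverse crossing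
    vanish, hence [evR] itself, against its zigzag. *)
Lemma twist_neq0 Y t : simple_object Y ->
  (forall U, twist Y U = t *: idmor (Y ⊗ U)) -> t != 0.
Proof.
move=> sY ht; apply/eqP => t0; case: (sY) => Y0 _; apply: Y0.
pose U := Y ⊗ one; have [B [BK KB]] := bw_iso fusC Y (dual Y) U.
pose p := cap (evR Y) U ∘ B.
have e : (Y ◁ p) ∘ cup (coev Y) (Y ⊗ U) = 0.
  have := ht U; rewrite t0 scale0r => <-; rewrite /twist -(cup_bwr fusC).
  by rewrite /p wlM -!compA (compA (Y ◁ B)) -wlM BK tens_id comp1m.
have p0 : p = 0.
  rewrite -[p]compm1 -(zag Y (Y ⊗ U)) compA -cap_nat -compA -wlM e.
  by rewrite (wl0 monC) (compm0 linC).
have e0 : cap (evR Y) U = 0.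
  by rewrite -[LHS]compm1 -BK compA -/p p0 (comp0m linC).
apply: (wr1_inj linC monC); rewrite tens_id -(zagR fusC) e0 (comp0m linC).
by rewrite (wr0 monC).
Qed.

Lemma twist_nat Y Y' U (f : mor Y Y') :
  twist Y' U ∘ (f ▷ U) = (f ▷ U) ∘ twist Y U.
Proof.
rewrite /twist -!compA -(interchange f) (tail2 _ (bw_natl fusC _ _ f)).
rewrite (compA (Y' ◁ _)) -wlM (capR_dual fusC f) wlM -!compA.
rewrite (tail2 _ (esym (bw_nat fusC Y Y' (dualm f ▷ U)))) -wlM.
rewrite -(coevw_dual linC monC rigC) wlM (tail2 _ (bw_natr fusC _ _ f)).
by rewrite (tail2 _ (esym (interchange f _))).
Qed.

(** A curl on the doubled strand: the curl of [Y] is collected in [twist Y], while the loop of [X]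
    stays linked with [Y]. Once the self-crossing of [X] is a scalar, that loop is a ring around
    [Y]. *)
Lemma twist_tens X Y U :
  assoc X Y U ∘ twist (X ⊗ Y) U =
  (X ◁ (Y ◁ (cap (evR X) U))) ⊚ (X ◁ (bw X Y (dual X ⊗ U))) ⊚
  bw X X (Y ⊗ (dual X ⊗ U)) ⊚ (X ◁ (X ◁ (twist Y (dual X ⊗ U)))) ⊚
  (X ◁ (bw Y X (dual X ⊗ U))) ⊚ (X ◁ (Y ◁ (cup (coev X) U))) ⊚ assoc X Y U.
Proof.
have := evR_tens fusC X Y U; have := coev_tens fusC X Y U; rewrite /twist.
move: (dtens X Y U) => t -> eR; rewrite !wlM -!compA (tail2 _ (bw_nat fusC _ _ _)).
rewrite (compA ((X ⊗ Y) ◁ (cap _ _))) -wlM eR !wlM -!compA.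
rewrite !(tail2 _ (a_nat_r monC _ _ _)).
set W := dual Y ⊗ (dual X ⊗ U).
(* The crossing of X ⊗ Y with itself splits into four elementary crossings, by the two hexagons. *)
have crossings : (X ◁ (Y ◁ (assoc X Y W))) ⊚ assoc X Y ((X ⊗ Y) ⊗ W) ⊚
    bw (X ⊗ Y) (X ⊗ Y) W ⊚ ((X ⊗ Y) ◁ (associ X Y W))
  = (X ◁ (bw X Y (Y ⊗ W))) ⊚ bw X X (Y ⊗ (Y ⊗ W)) ⊚
    (X ◁ (X ◁ (bw Y Y W))) ⊚ (X ◁ (bw Y X (Y ⊗ W))) ⊚ assoc X Y (X ⊗ (Y ⊗ W)).
  rewrite (tail2 _ (esym (a_nat_r monC _ _ _))) (tail1 _ (bw_tensl fusC _ _ _ _)) -!compA.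
  rewrite (tail1 _ (bw_tensr fusC _ _ _ _)) -!compA.
  rewrite (compA (X ◁ (assoc _ _ _)) (X ◁ _)) -wlM (bw_tensr fusC) !wlM -!compA.
  rewrite (a_nat_r monC) (compA (X ◁ (Y ◁ (assoc _ _ _)))) -2!wlM aVK.
  by rewrite !tens_id comp1m.
have := congr1 (fun h => h ⊚ ((X ⊗ Y) ◁ (X ◁ (cup (coev Y) (dual X ⊗ U)))) ⊚
  ((X ⊗ Y) ◁ (cup (coev X) U))) crossings.
rewrite -!compA => ->; rewrite (tail2 _ (a_nat_r monC _ _ _)) (a_nat_r monC).
congr (_ ∘ _).
have slide V (f : mor V (dual X ⊗ U)) : X ◁ (Y ◁ (X ◁ f)) ∘ (X ◁ (bw X Y V))
    = (X ◁ (bw X Y _)) ∘ (X ◁ (X ◁ (Y ◁ f))).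
  by rewrite -!wlM (bw_nat fusC).
rewrite (tail2 _ (slide _ _)); congr (_ ∘ _).
rewrite (tail2 _ (esym (bw_nat fusC X X _))); congr (_ ∘ (_ ∘ (_ ∘ _))).
have slide' V T (f : mor T V) : X ◁ (bw Y X V) ∘ (X ◁ (Y ◁ (X ◁ f)))
    = (X ◁ (X ◁ (Y ◁ f))) ∘ (X ◁ (bw Y X T)).
  by rewrite -!wlM (bw_nat fusC).
by rewrite (tail2 _ (slide' _ _ _)).
Qed.

(** The twist of X_alpha ⊗ Y is computed in two ways. Naturality along the isomorphism gives the
    scalar [t] of [Y]; [twist_tens] gives [t] times the self-crossing alpha(z) times the ring of
    X_alpha around [Y], which is alpha(z) alpha(h). *)
Lemma free_action Y h alpha : simple_object Y -> has_degree F h Y ->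
  isomorphic (Xc alpha ⊗ Y) Y -> alpha h = 1.
Proof.
move=> sY hY [f fi]; have [t ht] := twist_scalar sY.
have t0 := twist_neq0 sY ht; set x := Xc alpha.
have sXY : simple_object (x ⊗ Y) by apply: (simple_iso fusC (iso_sym _) sY); exists f.
have e1 : twist (x ⊗ Y) one = t *: idmor _.
  apply: (iso_monoE linC (wr_iso linC monC one fi)).
  by rewrite -twist_nat ht compZl comp1m compZr compm1.
have bx U : bw x x U = alpha z *: idmor _.
  rewrite bwE braid_Xchar (wrZ monC) tens_id compZl compZr comp1m.
  by rewrite aVK.
have e2 : twist (x ⊗ Y) one = (t * alpha h) *: idmor _.
  apply: (iso_monoE linC (a_iso monC x Y one)); rewrite twist_tens ht bx.
  have -> : t * alpha h = alpha z * (t * chi Y x).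
    by rewrite (proj1 (has_degreeP h sY) hY alpha) mulrCA (mulrA (alpha z)) char_z // mul1r.
  rewrite compZr compm1 -scalerA -scalerA.
  rewrite !(wlZ monC) !tens_id !compZl comp1m comp1m !compZr; congr (_ *: (_ *: _)).
  have := ring_simple fusC x one sY; rewrite -/(chi Y x).
  move=> /(congr1 (fun h => (x ◁ h) ∘ assoc x Y one)).
  by rewrite ringE mw_bw (wlZ monC) tens_id compZl comp1m !wlM -!compA.
have e := scale_id_unitI fusC sXY (etrans (esym e1) e2).
by apply: (mulfI t0); rewrite mulr1.
Qed.

End Pointed.

(** * Characters of the group *)

Section CharacterGroup.
Variables (k : closedFieldType) (A : finGroupType) (a : A).
Hypotheses (char0 : [pchar k] =i pred0) (gen_a : generator [set: A] a).
Local Notation lc := (linear_character k A).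
Implicit Types alpha beta : lc.

Lemma gen_expg g : exists i, g = (a ^+ i)%g.
Proof.
have : g \in <[a]>%g by rewrite -(eqP gen_a) inE.
by case/cycleP => i ->; exists i.
Qed.

Lemma char_gen_inj alpha beta : alpha a = beta a -> alpha = beta.
Proof. by move=> e; apply: charP => g; have [i ->] := gen_expg g; rewrite !char_X e. Qed.

Lemma char_gen1 alpha : alpha a = 1 -> alpha = char1 k A.
Proof. by move=> e; apply: char_gen_inj; rewrite e char1E. Qed.

Lemma order_gen : #[a]%g = #|A|.
Proof. by rewrite orderE -(eqP gen_a) cardsT. Qed.

Lemma card_gt0A : (0 < #|A|)%N.
Proof. by apply/card_gt0P; exists a. Qed.

Lemma roots_of_unityE : 'X^#|A| - 1%:P = \prod_(x <- roots_of_unity k A) ('X - x%:P).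
Proof.
rewrite /roots_of_unity; case: closed_field_poly_normal => r /= {1}->.
by have /monicP -> := monicXnsubC (1 : k) card_gt0A; rewrite scale1r.
Qed.

Lemma size_roots : size (roots_of_unity k A) = #|A|.
Proof.
have := congr1 (fun p : {poly k} => size p) roots_of_unityE.
by rewrite size_prod_XsubC size_XnsubC ?card_gt0A // => -[].
Qed.

Lemma uniq_roots : uniq (roots_of_unity k A).
Proof.
rewrite -separable_prod_XsubC -roots_of_unityE separable_Xn_sub_1 //.
by move/pcharf0P: char0 => ->; rewrite -lt0n card_gt0A.
Qed.

Lemma root_char x : x \in roots_of_unity k A -> exists alpha, alpha a = x.
Proof.
rewrite -root_prod_XsubC -roots_of_unityE rootE !hornerE subr_eq0 => /eqP xn.
(* A discrete logarithm, chosen arbitrarily; powers of [x] depend only on the exponent modulo #A, so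
   the choice does not affect the character. *)
pose lg g := projT1 (cid (gen_expg g)).
have lgP g : g = (a ^+ lg g)%g := projT2 (cid (gen_expg g)).
have xE i j : (a ^+ i = a ^+ j)%g -> x ^+ i = x ^+ j.
  move/eqP; rewrite eq_expg_mod_order order_gen => /eqP e.
  by rewrite -(expr_mod i xn) -(expr_mod j xn) e.
have lin : is_linear_character [ffun g => x ^+ lg g].
  rewrite /is_linear_character ffunE (xE _ 0) ?expr0 -?lgP ?expg0 // eqxx /=.
  apply/forallP => g; apply/forallP => h; rewrite !ffunE -exprD; apply/eqP/xE.
  by rewrite expgD -!lgP.
exists (LinearCharacter lin); rewrite /char_fun ffunE.
by rewrite (xE _ 1) ?expr1 -?lgP ?expg1.
Qed.

(** Evaluation at the generator identifies characters with roots of X^#A - 1, which are distinct in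
    characteristic 0. *)
Lemma card_char : #|{: lc}| = #|A|.
Proof.
pose f (x : seq_sub (roots_of_unity k A)) : lc := projT1 (cid (root_char (ssvalP x))).
have fE x : f x a = ssval x := projT2 (cid (root_char (ssvalP x))).
pose g (alpha : lc) : seq_sub (roots_of_unity k A) := SeqSub (char_root alpha a).
have fg : cancel f g by move=> x; apply: val_inj; rewrite /= fE.
have gf : cancel g f by move=> x; apply: char_gen_inj; rewrite fE.
rewrite (bij_eq_card (Bijective gf fg)) card_seq_sub ?uniq_roots //.
exact: size_roots.
Qed.

Lemma charM_inj alpha : injective (charM alpha).
Proof.
move=> beta gamma e; apply: charP => g; apply: (mulfI (char_neq0 alpha g)).
by rewrite -!charME e.
Qed.

Lemma char_sum0 (phi : lc -> k) gamma :
  (forall alpha beta, phi (charM alpha beta) = phi alpha * phi beta) ->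
  phi gamma != 1 -> \sum_alpha phi alpha = 0.
Proof.
move=> phiM ng; apply/eqP.
have : \sum_alpha phi alpha = phi gamma * \sum_alpha phi alpha.
  rewrite mulr_sumr [LHS](reindex_inj (@charM_inj gamma)).
  by apply: eq_bigr => alpha _; apply: phiM.
move/eqP; rewrite -subr_eq0 -{1}[\sum_alpha _]mul1r -mulrBl mulf_eq0 subr_eq0.
by rewrite eq_sym (negPf ng).
Qed.

End CharacterGroup.

(** * Degrees, orbits and sums of entries *)

Section Main.
Variables (k : closedFieldType) (C : pivotalData k).
Hypothesis fusC : braided_pivotal_fusion C.
Implicit Types U V W X Y Z : C.

Local Notation linC := (fusion_linear fusC).
Local Notation monC := (fusion_monoidal fusC).


Variables (A : finGroupType) (cA : abelian [set: A]) (z a : A).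
Hypotheses (char0 : [pchar k] =i pred0) (z2 : (z ^+ 2 = 1)%g).
Hypotheses (gen_a : generator [set: A] a) (ndC : nondegenerate_category C).
Variable F : functorData (rep_pivotalData k cA z) C.
Hypothesis embF : braided_pivotal_embedding F.
Variables (Irr : finType) (s : Irr -> C).
Hypothesis irr_s : simple_system s.
Local Notation lc := (linear_character k A).
Implicit Types (alpha beta : lc) (R T : {set Irr}).

Local Notation Xc alpha := (Xchar F alpha).
Local Notation s_simple := (s_simple irr_s).
Local Notation s_inj := (s_inj irr_s).
Local Notation bar_index := (bar_index fusC irr_s char0 ndC).
Local Notation bar_indexK := (bar_indexK fusC irr_s char0 ndC).
Local Notation chis := (chis s).
Local Notation Sirr := (Sirr s).
Local Notation global_dim := (global_dim s).
Local Notation i0 := (i0 fusC irr_s).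
Local Notation E := (global_dim * dimR (s (bar_index i0))).
Local Notation one_char := (char1 k A).
Local Notation n := (#|A|%:R : k).

Let cz alpha : alpha z * alpha z = 1 := char_z z2 alpha.

Lemma n_neq0 : n != 0.
Proof.
move/pcharf0P: char0 => ->; rewrite -lt0n; exact: (card_gt0A a).
Qed.

Lemma act_ex alpha i : exists j, isomorphic (Xc alpha ⊗ s i) (s j).
Proof.
have [_ _ h] := irr_s; apply/h.
apply: (invertible_simple fusC (G' := Xc (charV alpha))) (s_simple i).
by apply: (Xchar_inv fusC embF) => g; rewrite charVE mulVf // char_neq0.
Qed.

Definition act alpha i : Irr := projT1 (cid (act_ex alpha i)).

Lemma actP alpha i : isomorphic (Xc alpha ⊗ s i) (s (act alpha i)).
Proof. exact: projT2 (cid (act_ex alpha i)). Qed.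

Lemma isom_act alpha i j : isomorphic (s j) (Xc alpha ⊗ s i) <-> j = act alpha i.
Proof.
split=> [h|->]; last exact: (iso_sym (actP alpha i)).
exact: (s_inj (iso_trans linC h (actP alpha i))).
Qed.

Lemma actM alpha beta i : act alpha (act beta i) = act (charM alpha beta) i.
Proof.
apply/isom_act; apply: (iso_trans linC (iso_sym (actP _ _))).
apply: (iso_trans linC (tens_iso monC (iso_refl linC _) (iso_sym (actP _ _)))).
apply: (iso_trans linC (iso_sym (assoc_iso monC _ _ _))).
exact: (tens_iso monC (Xchar_tens fusC embF _ _) (iso_refl linC _)).
Qed.

Lemma act1 i : act one_char i = i.
Proof.
apply/esym/isom_act; apply: (iso_trans linC (iso_sym (lunit_iso monC _))).
apply: (tens_iso monC _ (iso_refl linC _)); apply: iso_sym.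
by apply: (line_unit fusC embF (line_char _)) => g; apply: char1E.
Qed.

Lemma charVM alpha : charM (charV alpha) alpha = one_char.
Proof. by apply: charP => g; rewrite charME charVE char1E mulVf // char_neq0. Qed.

Lemma actVK alpha : cancel (act alpha) (act (charV alpha)).
Proof. by move=> i; rewrite actM charVM act1. Qed.

Lemma act_inj alpha : injective (act alpha).
Proof. exact: can_inj (actVK alpha). Qed.

Lemma act_sep alpha beta i : act alpha i = act beta i ->
  act (charM (charV alpha) beta) i = i.
Proof. by move=> e; rewrite -actM -e actVK. Qed.

Lemma chis_tens i Y Z : chis i (Y ⊗ Z) = chis i Y * chis i Z.
Proof. by have [_ h _] := chis_char fusC irr_s i. Qed.

Lemma Sirr_act alpha i y : Sirr y (act alpha i) = chis y (Xc alpha) * Sirr y i.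
Proof.
by rewrite !(SirrE fusC irr_s) -(chis_iso fusC irr_s y (actP alpha i)) chis_tens mulrA.
Qed.

(** By [monodromy_Xchar] this is the monodromy scalar of X_alpha with [s i]. It is multiplicative in
    alpha, and [s i] has degree [h] when it is evaluation at [h]. *)
Definition deg i alpha : k := alpha z * chis i (Xc alpha).

Lemma chis_deg i alpha : chis i (Xc alpha) = alpha z * deg i alpha.
Proof. by rewrite /deg mulrA cz mul1r. Qed.

Lemma deg_M i alpha beta : deg i (charM alpha beta) = deg i alpha * deg i beta.
Proof.
rewrite /deg charME -(chis_iso fusC irr_s i (Xchar_tens fusC embF alpha beta)).
by rewrite chis_tens mulrACA.
Qed.

Lemma in_Ideg h i : reflect (forall alpha, deg i alpha = alpha h) (i \in Ideg F s h).
Proof.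
rewrite inE; apply: (iffP idP) => [/asboolP H alpha|H].
  rewrite /deg; have := proj1 (has_degreeP fusC char0 z2 embF h (s_simple i)) H alpha.
  by rewrite -/(chis i _) => ->; rewrite mulrA cz mul1r.
apply/asboolP/(has_degreeP fusC char0 z2 embF h (s_simple i)) => alpha.
by rewrite -/(chis i _) chis_deg H.
Qed.

Lemma chis_one i : chis i (Xc one_char) = 1.
Proof.
have [_ _ h] := chis_char fusC irr_s i; rewrite -h; apply: (chis_iso fusC irr_s).
by apply: (line_unit fusC embF (line_char _)) => g; apply: char1E.
Qed.

(** When [deg i] is not evaluation at [h], the summand is a nontrivial character of the group of all
    alpha, and its sum vanishes. *)
Lemma deg_sum h i : \sum_(alpha : lc) (alpha h)^-1 * deg i alpha = (i \in Ideg F s h)%:R * n.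
Proof.
case: (in_Ideg h i) => H.
  rewrite mul1r (eq_bigr (fun=> 1)) => [|alpha _]; last by rewrite H mulVf // char_neq0.
  by rewrite sumr_const (card_char char0 gen_a).
rewrite mul0r; have [gamma ng] : exists gamma, deg i gamma != gamma h.
  by apply: contrapT => h'; apply: H => alpha; apply/eqP/negPn/negP => h2; apply: h'; exists alpha.
apply: (@char_sum0 _ _ _ gamma) => [alpha beta|].
  by rewrite deg_M charME invfM mulrACA.
by apply: contraNneq ng => e; rewrite -[deg i gamma](mulVKf (char_neq0 gamma h)) e mulr1.
Qed.

Lemma sum_Ideg h (f : Irr -> k) :
  \sum_(i in Ideg F s h) f i
  = n^-1 * \sum_(alpha : lc) (alpha h)^-1 * \sum_i deg i alpha * f i.
Proof.
transitivity (n^-1 * \sum_i (i \in Ideg F s h)%:R * n * f i).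
  rewrite mulr_sumr big_mkcond; apply: eq_bigr => i _.
  by case: ifP => _; rewrite ?mul0r ?mulr0 // mul1r mulrA mulVf ?n_neq0 // mul1r.
congr (_ * _); under [RHS]eq_bigr do rewrite mulr_sumr.
rewrite exchange_big; apply: eq_bigr => i _ /=.
by rewrite -deg_sum mulr_suml; apply: eq_bigr => alpha _; rewrite -mulrA.
Qed.

(** The weight is absorbed by the action: up to alpha(z), it turns S_{i,y} into the entry at X_alpha
    ⊗ s_i, and [Sirr2] applies. *)
Lemma deg_Sirr2 alpha i j : \sum_y deg y alpha * (Sirr i y * Sirr y j)
  = alpha z * (act alpha i == bar_index j)%:R * E.
Proof.
rewrite -mulrA -(Sirr2 fusC irr_s char0 ndC) mulr_sumr; apply: eq_bigr => y _.
rewrite [Sirr (act _ _) _]SirrC // Sirr_act chis_deg [Sirr i y]SirrC //.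
by rewrite -(mul1r (deg y alpha * _)) -(cz alpha); ring.
Qed.

Lemma sum_Ideg_Sirr h i j : \sum_(y in Ideg F s h) Sirr i y * Sirr y j
  = E / n * \sum_(alpha : lc) alpha z * (alpha h)^-1 * (act alpha i == bar_index j)%:R.
Proof.
rewrite sum_Ideg mulrC mulr_suml mulr_sumr; apply: eq_bigr => alpha _.
by rewrite deg_Sirr2; ring.
Qed.

(** A weighted entry of S^2 is evaluated twice, with X_alpha absorbed into the left or into the
    right factor; as the constant is nonzero, the two Kronecker deltas agree. *)
Lemma bar_index_act alpha i : bar_index (act alpha i) = act (charV alpha) (bar_index i).
Proof.
have e : act alpha (bar_index (act alpha i)) = bar_index i.
  apply/eqP; have := deg_Sirr2 alpha (bar_index (act alpha i)) i.
  have -> : \sum_y deg y alpha * (Sirr (bar_index (act alpha i)) y * Sirr y i) = alpha z * E.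
    transitivity (alpha z * \sum_y Sirr (bar_index (act alpha i)) y * Sirr y (act alpha i)).
      rewrite mulr_sumr; apply: eq_bigr => y _.
      by rewrite Sirr_act chis_deg -(mul1r (deg y alpha * _)) -(cz alpha); ring.
    by rewrite Sirr2 eqxx mul1r.
  case: (act _ _ == _) => //; rewrite mulr0 mul0r => /eqP; rewrite mulf_eq0.
  by rewrite (negPf (char_neq0 alpha z)) (negPf (global_dim_dimR_bar_neq0 fusC irr_s char0 ndC)).
by rewrite -e actVK.
Qed.

(** For nontrivial alpha the average pairs dim^L with the row of S at X_alpha, which is not the
    unit, and [killing] makes it vanish; the trivial character contributes dim(C). *)
Lemma dim_deg1 : dim_deg F s 1%g = global_dim / n.
Proof.
rewrite /dim_deg sum_Ideg mulrC; congr (_ / _).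
rewrite (bigD1 one_char) //= [X in _ + X]big1 => [|alpha na].
  rewrite addr0 char1E invr1 mul1r; apply: eq_bigr => i _.
  by rewrite /deg char1E chis_one !mul1r.
have [_ _ /(_ _ (Xchar_simple fusC embF alpha))[x hx]] := irr_s.
have nx : x != i0.
  apply: contraNneq na => e; apply/eqP/charP => g; rewrite char1E.
  apply: (Xchar_unit fusC embF) => //; rewrite e in hx.
  exact: (iso_trans linC hx (iso_sym (i0P fusC irr_s))).
have k0 := killing fusC irr_s ndC x; rewrite (negPf nx) mul0r in k0.
rewrite (_ : \sum_i _ = alpha z * dimR (s x) * \sum_y dimL (s y) * chis x (s y)).
  by rewrite k0 !mulr0.
rewrite mulr_sumr; apply: eq_bigr => y _.
have := SirrC fusC s x y; rewrite !(SirrE fusC irr_s) => e.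
rewrite /deg (chis_iso fusC irr_s y hx).
transitivity (alpha z * dimL (s y) * (chis y (s x) * dimR (s y))); first by ring.
by rewrite -e; ring.
Qed.

(** * Sums over orbits of a free action *)

Section Orbits.
Variables R T : {set Irr}.
Hypothesis repR : representatives F s R T.
Hypothesis freeT : forall i alpha, i \in T -> act alpha i = i -> alpha = one_char.
Hypothesis actT : forall i alpha, i \in T -> act alpha i \in T.

Lemma same_orbitP i j : same_orbit F s i j <-> exists alpha, j = act alpha i.
Proof.
by split=> -[alpha h]; exists alpha; apply/isom_act.
Qed.

Lemma sub_repr i : i \in R -> i \in T.
Proof. by case: repR => /subsetP h _; apply: h. Qed.

Lemma repr_uniq i j alpha : i \in R -> j \in R -> j = act alpha i -> i = j.
Proof.
move=> iR jR e; have [_ /(_ j (sub_repr jR))[m [_ um]]] := repR.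
rewrite -(um j) //; last first.
  by split=> //; apply/same_orbitP; exists one_char; rewrite act1.
by apply/esym/um; split=> //; apply/same_orbitP; exists alpha.
Qed.

Lemma orbit_uniq i j alpha beta : i \in R -> j \in R ->
  act alpha i = act beta j -> i = j /\ alpha = beta.
Proof.
move=> iR jR e.
have ij : i = j.
  apply: (repr_uniq (alpha := charM (charV beta) alpha)) => //.
  by rewrite -actM e actVK.
split=> //; move: e; rewrite -ij => /esym/act_sep/(freeT (sub_repr iR)) e.
apply: charP => g; have := congr1 (fun c : lc => c g) e.
rewrite charME charVE char1E => /(congr1 (fun x => beta g * x)).
by rewrite mulrA mulfV ?char_neq0 // mul1r mulr1.
Qed.

(** Stated for any commutative monoid, to serve both the cardinalities in [card_orbits] and the sums
    in [k] of [sum_repr]. *)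
Lemma big_orbit (V : Type) (idx : V) (op : Monoid.com_law idx) (f : Irr -> V) :
  \big[op/idx]_(j in T) f j
  = \big[op/idx]_(i in R) \big[op/idx]_(alpha : lc) f (act alpha i).
Proof.
rewrite pair_big_dep /=.
pose h (p : Irr * lc) := act p.2 p.1.
(* Orbit coordinates of [j]; the default pair can occur only outside [T]. *)
pose h' j := odflt (j, one_char) [pick p : Irr * lc | (p.1 \in R) && (h p == j)].
have h'P j : j \in T -> (h' j).1 \in R /\ h (h' j) = j.
  move=> jT; rewrite /h'; case: pickP => [p /andP[pR /eqP //]|none].
  have [_ /(_ j jT)[i [[iR /same_orbitP[alpha e]] _]]] := repR.
  by have := none (i, alpha); rewrite /= iR /h /= -e eqxx.
rewrite (reindex_onto h h') => [|j jT]; last by case: (h'P j jT).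
apply: eq_bigl => p; rewrite andbT; apply/andP/idP => [[pT /eqP e]|pR].
  by rewrite -e; case: (h'P _ pT).
have pT : h p \in T by apply/actT/sub_repr.
split=> //; have [h1 h2] := h'P _ pT; apply/eqP.
have [e1 e2] := orbit_uniq h1 pR h2.
by rewrite (surjective_pairing (h' _)) e1 e2 -surjective_pairing.
Qed.

Lemma card_orbits : #|T| = (#|R| * #|A|)%N.
Proof.
rewrite -sum1_card big_orbit (eq_bigr (fun=> #|A|)) => [|i _].
  by rewrite sum_nat_const.
by rewrite sum1_card (card_char char0 gen_a).
Qed.

Lemma sum_repr (f : Irr -> k) : (forall i alpha, i \in R -> f (act alpha i) = f i) ->
  \sum_(i in R) f i = n^-1 * \sum_(j in T) f j.
Proof.
move=> h; rewrite big_orbit mulr_sumr; apply: eq_bigr => i iR.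
rewrite (eq_bigr (fun=> f i)) => [|alpha _]; last exact: h.
rewrite sumr_const (card_char char0 gen_a) -[f i *+ _]mulr_natr mulrCA.
by rewrite mulVf ?mulr1 // n_neq0.
Qed.

End Orbits.

Lemma chis_Xchar x alpha beta : isomorphic (Xc beta) (s x) -> chis x (Xc alpha) = alpha z.
Proof.
move=> hx; rewrite -[LHS]/(chi (s x) (Xc alpha)) /chi -(dimR_iso fusC hx).
rewrite SmatC // -(Smat_iso fusC _ hx).
rewrite /Smat (Xchar_symmetric fusC char0 z2 embF) -/(dimR _) dimR_tens //.
by rewrite !(dimR_Xchar fusC char0 z2 embF) mulfK // char_neq0.
Qed.

Lemma Xchar_index beta : exists x, isomorphic (Xc beta) (s x).
Proof. by have [_ _ h] := irr_s; apply/h/(Xchar_simple fusC embF). Qed.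

Lemma dimR_act alpha i : dimR (s (act alpha i)) = alpha z * dimR (s i).
Proof.
rewrite -(dimR_iso fusC (actP alpha i)) dimR_tens //.
by rewrite (dimR_Xchar fusC char0 z2 embF).
Qed.

(** Rep(A,z) is symmetric, so X_alpha has trivial monodromy with every X_beta, that is, degree 1. *)
Lemma deg_act alpha beta i : deg (act alpha i) beta = deg i beta.
Proof.
have [x hx] := Xchar_index beta; rewrite /deg !(chis_iso fusC irr_s _ hx); congr (_ * _).
have az0 := char_neq0 alpha z; have d0 := dimR_neq0 fusC (s_simple i).
apply: (mulfI (mulf_neq0 az0 d0)); rewrite -{1}dimR_act mulrC -(SirrE fusC irr_s).
rewrite SirrC // Sirr_act (chis_Xchar _ hx) -mulrA; congr (_ * _).
by rewrite SirrC // (SirrE fusC irr_s) mulrC.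
Qed.

Lemma Ideg_act h alpha i : i \in Ideg F s h -> act alpha i \in Ideg F s h.
Proof. by move=> /in_Ideg H; apply/in_Ideg => beta; rewrite deg_act. Qed.

Lemma Ideg_bar_index h i : i \in Ideg F s h -> bar_index i \in Ideg F s h^-1%g.
Proof.
move=> /in_Ideg H; apply/in_Ideg => alpha; have [x hx] := Xchar_index alpha.
rewrite /deg (chis_iso fusC irr_s _ hx) (chis_bar_index fusC irr_s char0 ndC).
have dx : isomorphic (dual (s x)) (Xc (charV alpha)).
  apply: (iso_trans linC _ (dual_Xchar fusC embF alpha)).
  exact: (dual_iso_simple fusC (s_simple x) (iso_sym hx)).
rewrite (chis_iso fusC irr_s _ dx) chis_deg H !charVE mulrA mulfV ?char_neq0 //.
by rewrite mul1r charV_E.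
Qed.

Lemma IfreeP i : reflect (i \in Ideg F s 1%g /\ forall alpha, act alpha i = i -> alpha = one_char)
  (i \in Ifree F s).
Proof.
rewrite [i \in Ifree F s]in_set; apply: (iffP andP) => [[-> /asboolP H]|[-> H]]; split=> //.
  move=> alpha e; apply: charP => g; rewrite char1E; apply: (H alpha).
  by rewrite -{2}e; apply: actP.
apply/asboolP => alpha h g; rewrite (H alpha) ?char1E //.
exact/esym/isom_act/iso_sym.
Qed.

Lemma Ifree_free i alpha : i \in Ifree F s -> act alpha i = i -> alpha = one_char.
Proof. by move=> /IfreeP[_]; apply. Qed.

Lemma Ifree_act i alpha : i \in Ifree F s -> act alpha i \in Ifree F s.
Proof.
move=> /IfreeP[i1 fi]; apply/IfreeP; split=> [|beta]; first exact: Ideg_act.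
rewrite actM (_ : charM beta alpha = charM alpha beta).
  by rewrite -actM => /act_inj/fi.
by apply: charP => g; rewrite !charME mulrC.
Qed.

Lemma Ifree_bar_index i : i \in Ifree F s -> bar_index i \in Ifree F s.
Proof.
move=> /IfreeP[i1 fi]; apply/IfreeP; split=> [|alpha e].
  by rewrite -invg1; apply: Ideg_bar_index.
have /fi e1 : act (charV alpha) i = i by rewrite -{1}(bar_indexK i) -bar_index_act e bar_indexK.
by rewrite -(charVM alpha) e1; apply: charP => g; rewrite charME char1E mul1r.
Qed.

Lemma Ideg_free i alpha : i \in Ideg F s a -> act alpha i = i -> alpha = one_char.
Proof.
rewrite inE => /asboolP H e; apply: (char_gen1 gen_a).
apply: (free_action fusC char0 z2 embF (s_simple i) H).
by rewrite -{2}e; apply: actP.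
Qed.

(* If [X_alpha] stabilizes an object of degree 1, comparing dimensions gives
   [alpha z = 1]; a nonzero entry would then force [alpha a = 1]. *)
Lemma Sirr_nonfree i j : i \in Ideg F s 1%g -> i \notin Ifree F s ->
  j \in Ideg F s a -> Sirr j i = 0.
Proof.
move=> i1 nf /in_Ideg ja.
have [alpha [e na]] : exists alpha, act alpha i = i /\ alpha <> one_char.
  apply: contrapT => h; case/negP: nf; apply/IfreeP; split=> // alpha e.
  by apply: contrapT => na; apply: h; exists alpha.
have az : alpha z = 1.
  by apply: (mulIf (dimR_neq0 fusC (s_simple i))); rewrite -dimR_act e mul1r.
have := Sirr_act alpha i j; rewrite e chis_deg ja az mul1r => /eqP.
rewrite -subr_eq0 -{1}[Sirr _ _]mul1r -mulrBl mulf_eq0 => /orP[|/eqP //].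
by rewrite subr_eq0 => /eqP/esym/(char_gen1 gen_a).
Qed.

(** * The three matrix identities and the cardinalities *)

Section Sums.
Variables R1 Ra : {set Irr}.
Hypothesis repR1 : representatives F s R1 (Ifree F s).
Hypothesis repRa : representatives F s Ra (Ideg F s a).

Local Notation d := (global_dim / n / n * dimR (s (bar_index i0))).

(** Rows of degree 1 both pick up alpha(z) when [y] is replaced by X_alpha ⊗ y, so the summand is
    constant on orbits. *)
Lemma sum_1a i j : i \in R1 -> j \in R1 -> \sum_(y in Ra) Sirr i y * Sirr j y
  = d * \sum_(alpha : lc) alpha z * alpha a^-1%g * (bar_index j == act alpha i)%:R.
Proof.
move=> iR jR; have deg1 l : l \in R1 -> forall alpha, deg l alpha = 1.
  by move=> /(sub_repr repR1)/IfreeP[/in_Ideg H _] alpha; rewrite H char_1.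
rewrite (sum_repr repRa Ideg_free (fun _ _ => @Ideg_act _ _ _)) => [|y alpha _].
  under eq_bigr do rewrite (SirrC fusC s j).
  rewrite sum_Ideg_Sirr mulrA; congr (_ * _); first by ring.
  by apply: eq_bigr => alpha _; rewrite charV_E eq_sym.
rewrite !Sirr_act !chis_deg !deg1 // !mulr1 -[RHS]mul1r -(cz alpha); ring.
Qed.

(** Bar inverts the action and the representatives lie in distinct free orbits, so at most the
    trivial character contributes: hence Q, unlike P, has no sum over characters. *)
Lemma bi_orbit i j alpha : i \in Ra -> j \in Ra ->
  (act alpha (bar_index i) == bar_index j) = (alpha == one_char) && (i == j).
Proof.
move=> iR jR; apply/eqP/andP => [e|[/eqP -> /eqP ->]]; last exact: act1.
have e' : act (charV alpha) i = j.
  by apply: (can_inj bar_indexK); rewrite bar_index_act -e; congr (act _ _);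
     apply: charP => g; rewrite !charVE invrK.
have [|h1 h2] := orbit_uniq repRa Ideg_free (i := i) (j := j) (alpha := charV alpha)
  (beta := one_char) iR jR; first by rewrite act1.
by rewrite h1 eqxx -(charVM alpha) h2;
  split=> //; apply/eqP/charP => g; rewrite charME char1E mul1r.
Qed.

(** The factors alpha(z) alpha(a)^-1 and alpha(z) alpha(a) cancel along an orbit. The sum over free
    objects extends to all of degree 1, since the other terms vanish by [Sirr_nonfree]. *)
Lemma sum_a1 w i : w \in Ra -> i \in Ra ->
  \sum_(x in R1) Sirr x (bar_index w) * Sirr x i = d * (w == i)%:R.
Proof.
move=> wR iR; have wd := sub_repr repRa wR; have idg := sub_repr repRa iR.
have bw := Ideg_bar_index wd; have bd := in_Ideg _ _ bw; have id := in_Ideg _ _ idg.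
have degw : forall alpha, deg (bar_index w) alpha = alpha a^-1%g by apply/in_Ideg.
have degi : forall alpha, deg i alpha = alpha a by apply/in_Ideg.
rewrite (sum_repr repR1 Ifree_free (fun _ _ => @Ifree_act _ _)) => [|x alpha _].
  have -> : \sum_(x in Ifree F s) Sirr x (bar_index w) * Sirr x i
          = \sum_(x in Ideg F s 1%g) Sirr (bar_index w) x * Sirr x i.
    rewrite [RHS](bigID (mem (Ifree F s))) /= [X in _ = _ + X]big1 ?addr0.
      apply: eq_big => [x|x _]; last by rewrite (SirrC fusC s x (bar_index w)).
      by apply/idP/andP => [xf|[]//]; split=> //; case/IfreeP: xf.
    by move=> x /andP[x1 nx]; rewrite (SirrC fusC s x i) (Sirr_nonfree x1 nx idg) mulr0.
  rewrite sum_Ideg_Sirr (bigD1 one_char) //= [X in _ + X]big1 ?addr0 => [|alpha na].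
    by rewrite !char1E invr1 !mul1r act1 (inj_eq (can_inj bar_indexK)); ring.
  by rewrite bi_orbit // (negPf na) !mulr0.
rewrite (SirrC fusC s (act alpha x)) (SirrC fusC s (act alpha x) i) !Sirr_act !chis_deg.
rewrite degw degi (SirrC fusC s x) (SirrC fusC s x i) charV_E.
have aa := mulVf (char_neq0 alpha a).
by rewrite -[RHS]mul1r -[RHS]mul1r -{1}(cz alpha) -aa; ring.
Qed.

Lemma sum_aa w i : w \in Ra -> i \in Ra ->
  \sum_(y in Ra) Sirr (bar_index w) y * Sirr y i = d * (w == i)%:R.
Proof.
move=> wR iR; have wd := sub_repr repRa wR; have idg := sub_repr repRa iR.
have degw : forall alpha, deg (bar_index w) alpha = alpha a^-1%g by apply/in_Ideg/Ideg_bar_index.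
have degi : forall alpha, deg i alpha = alpha a by apply/in_Ideg.
rewrite (sum_repr repRa Ideg_free (fun _ _ => @Ideg_act _ _ _)) => [|y alpha _].
  rewrite sum_Ideg_Sirr (bigD1 one_char) //= [X in _ + X]big1 ?addr0 => [|alpha na].
    by rewrite !char1E invr1 !mul1r act1 (inj_eq (can_inj bar_indexK)); ring.
  by rewrite bi_orbit // (negPf na) !mulr0.
rewrite (SirrC fusC s (act alpha y) i) !Sirr_act !chis_deg.
rewrite degw degi (SirrC fusC s i y) charV_E.
have aa := mulVf (char_neq0 alpha a).
by rewrite -[RHS]mul1r -[RHS]mul1r -{1}(cz alpha) -aa; ring.
Qed.

Lemma d_neq0 : d != 0.
Proof.
have := global_dim_dimR_bar_neq0 fusC irr_s char0 ndC; rewrite mulf_eq0 negb_or => /andP[D0 b0].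
by rewrite !mulf_neq0 ?invr_eq0 ?n_neq0.
Qed.

Lemma bar_setE R : bar_set s R = bar_index @: R.
Proof.
apply/setP => j; rewrite inE; apply/asboolP/imsetP => [[i iR h]|[i iR ->]].
  by exists i => //; rewrite (bar_s fusC irr_s char0 ndC) in h; apply: s_inj.
by exists i => //; rewrite (bar_s fusC irr_s char0 ndC); apply: iso_refl linC _.
Qed.

Lemma PmxE i j : Pmx F s a R1 i j = \sum_(alpha : lc)
  alpha z * alpha a^-1%g * (bar_index (enum_val j) == act alpha (enum_val i))%:R.
Proof.
rewrite mxE; apply: eq_bigr => alpha _; congr (_ * _%:R).
rewrite (bar_s fusC irr_s char0 ndC).
by apply: congr1; apply/asboolP/eqP => /isom_act.
Qed.

Lemma QmxE R T i j : Qmx s R T i j = (bar_index (enum_val i) == enum_val j)%:R.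
Proof.
rewrite mxE (bar_s fusC irr_s char0 ndC); congr (_%:R); apply: congr1.
by apply/asboolP/eqP => [/s_inj|->] //; apply: iso_refl linC _.
Qed.

Lemma Smx_1a_a1 : Smx s R1 Ra *m (Smx s R1 Ra)^T = d *: Pmx F s a R1.
Proof.
apply/matrixP => i j; rewrite [RHS]mxE PmxE -sum_1a ?enum_valP //.
rewrite big_enum_val mxE; apply: eq_bigr => c _.
by rewrite !mxE.
Qed.

Lemma Smx_a1_1a :
  (Smx s R1 (bar_set s Ra))^T *m Smx s R1 Ra = d *: Qmx s (bar_set s Ra) Ra.
Proof.
apply/matrixP => i j; rewrite [RHS]mxE QmxE.
have := enum_valP i; rewrite {2}bar_setE => /imsetP[w wR ew].
rewrite ew bar_indexK -sum_a1 ?enum_valP // big_enum_val mxE; apply: eq_bigr => c _.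
by rewrite !mxE ew.
Qed.

Lemma Smx_aa :
  Smx s (bar_set s Ra) Ra *m Smx s Ra Ra = d *: Qmx s (bar_set s Ra) Ra.
Proof.
apply/matrixP => i j; rewrite [RHS]mxE QmxE.
have := enum_valP i; rewrite {2}bar_setE => /imsetP[w wR ew].
rewrite ew bar_indexK -sum_aa ?enum_valP // big_enum_val mxE; apply: eq_bigr => c _.
by rewrite !mxE ew.
Qed.

Lemma card_bar_set : #|bar_set s Ra| = #|Ra|.
Proof. by rewrite bar_setE card_imset //; apply: can_inj bar_indexK. Qed.

(* Each row of [P] has a nonzero entry that is alone in its column. *)
Lemma Pmx_free : row_free (Pmx F s a R1).
Proof.
apply: inj_row_free => v vP; apply/rowP => i; rewrite mxE.
have iF := sub_repr repR1 (enum_valP i).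
have [_ /(_ _ (Ifree_bar_index iF))[l [[lR /same_orbitP[gamma e]] _]]] := repR1.
have el : bar_index l = act gamma (enum_val i).
  apply: (@act_inj (charV gamma)); rewrite actVK -(bar_indexK (enum_val i)) e bar_index_act.
  by rewrite -bar_index_act -e bar_indexK.
have /eqP := congr1 (fun u : 'rV[k]_#|R1| => u 0 (enum_rank_in lR l)) vP.
rewrite !mxE (bigD1 i) //= [X in _ + X]big1 ?addr0 => [|j nj].
  rewrite PmxE enum_rankK_in // el (bigD1 gamma) //= [X in _ + X]big1 => [|alpha na].
    by rewrite addr0 eqxx mulr1 !mulf_eq0 !(negPf (char_neq0 _ _)) !orbF => /eqP.
  rewrite (negPf (_ : act gamma _ != _)) ?mulr0 //.
  apply: contraNneq na => e1.
  by have [_ ->] := orbit_uniq repR1 Ifree_free (enum_valP i) (enum_valP i) e1.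
rewrite PmxE enum_rankK_in // el big1 ?mulr0 // => alpha _.
rewrite (negPf (_ : act gamma _ != _)) ?mulr0 //.
apply: contraNneq nj => e1.
have [e2 _] := orbit_uniq repR1 Ifree_free (enum_valP i) (enum_valP j) e1.
by apply/eqP/enum_val_inj.
Qed.

Lemma Qmx_full : row_free (Qmx s (bar_set s Ra) Ra)^T.
Proof.
apply: inj_row_free => v vQ; apply/rowP => i; rewrite mxE.
have iB : bar_index (enum_val i) \in bar_set s Ra.
  by rewrite bar_setE imset_f // enum_valP.
have := congr1 (fun u : 'rV[k]__ => u 0 (enum_rank_in iB (bar_index (enum_val i)))) vQ.
rewrite !mxE (bigD1 i) //= [X in _ + X]big1 ?addr0 => [|j nj].
  by rewrite mxE QmxE enum_rankK_in // bar_indexK eqxx mulr1.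
rewrite mxE QmxE enum_rankK_in // bar_indexK (inj_eq enum_val_inj) eq_sym (negPf nj).
by rewrite mulr0.
Qed.

Lemma card_reps : #|R1| = #|Ra|.
Proof.
apply/eqP; rewrite eqn_leq; apply/andP; split.
  have := eqP Pmx_free; rewrite -(eqmx_scale _ d_neq0) -Smx_1a_a1 => <-.
  exact: leq_trans (mxrankM_maxl _ _) (rank_leq_col _).
have := eqP Qmx_full; rewrite mxrank_tr -(eqmx_scale _ d_neq0) -Smx_a1_1a => <-.
exact: leq_trans (mxrankM_maxr _ _) (rank_leq_row _).
Qed.

Lemma card_free : #|Ifree F s| = #|Ideg F s a|.
Proof.
rewrite (card_orbits repR1 Ifree_free (fun _ _ => @Ifree_act _ _)).
by rewrite (card_orbits repRa Ideg_free (fun _ _ => @Ideg_act _ _ _)) card_reps.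
Qed.

End Sums.
End Main.

Theorem theorem2p5
  (k : closedFieldType) (char0 : [pchar k] =i pred0)
  (A : finGroupType) (cycA : cyclic [set: A])
  (z : A) (z2 : (z ^+ 2 = 1)%g)
  (a : A) (gen_a : generator [set: A] a)
  (C : pivotalData k) (fusC : braided_pivotal_fusion C)
  (ndC : nondegenerate_category C)
  (F : functorData (rep_pivotalData k (cyclic_abelian cycA) z) C)
  (embF : braided_pivotal_embedding F)
  (Irr : finType) (s : Irr -> C) (irr_s : simple_system s)
  (R1 Ra : {set Irr})
  (reps_R1 : representatives F s R1 (Ifree F s))
  (reps_Ra : representatives F s Ra (Ideg F s a))
  (Ra_stable : #|A| = 2%N -> bar_stable s Ra) :
  let Ra' := bar_set s Ra in
  let S_1_a := Smx s R1 Ra in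
  let S_a_1 := S_1_a^T in
  let S_1_a' := Smx s R1 Ra' in
  let S_a'_1 := S_1_a'^T in
  let S_a'_a := Smx s Ra' Ra in
  let S_a_a := Smx s Ra Ra in
  let d := dim_deg F s 1%g / #|A|%:R * dimR (bar s unit_obj) in
  [/\ S_1_a *m S_a_1 = d *: Pmx F s a R1,
      S_a'_1 *m S_1_a = d *: Qmx s Ra' Ra,
      S_a'_a *m S_a_a = d *: Qmx s Ra' Ra
    & [/\ #|R1| = #|Ra|, #|R1| = #|Ra'| & #|Ifree F s| = #|Ideg F s a|]].
Proof.
move=> Ra' S_1_a S_a_1 S_1_a' S_a'_1 S_a'_a S_a_a d.
have dE :
    d = global_dim s / #|A|%:R / #|A|%:R * dimR (s (bar_index fusC irr_s char0 ndC (i0 fusC irr_s))).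
  by rewrite /d (dim_deg1 fusC char0 z2 gen_a ndC embF irr_s) (bar_one fusC irr_s char0 ndC).
rewrite dE; split.
- exact: (Smx_1a_a1 fusC char0 z2 gen_a ndC embF irr_s reps_R1 reps_Ra).
- exact: (Smx_a1_1a fusC char0 z2 gen_a ndC embF irr_s reps_R1 reps_Ra).
- exact: (Smx_aa fusC char0 z2 gen_a ndC embF irr_s reps_Ra).
have e := card_reps fusC char0 z2 gen_a ndC embF irr_s reps_R1 reps_Ra.
split=> //.
  by rewrite e /Ra' (card_bar_set fusC char0 ndC irr_s).
exact: (card_free fusC char0 z2 gen_a ndC embF irr_s reps_R1 reps_Ra).
Qed.
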